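(* Let $\epsilon\in(0,1]$. Consider the linear model $Y=X\beta^*+\mathcal E$ with the dependent Gaussian design $X$, noise $\mathcal E\sim N(\mathbf 0,\Upsilon_n)$ and minimum-norm interpolator $\hat\beta$ described in the context, and suppose that $\lambda_{n+1}>0$ and that the coherence assumption holds with the number $\epsilon$ and reference matrix $\Xi_{0,n}$. (i) There exist constants $b=b(\epsilon)\ge1$ and $c=c(\epsilon)\ge 1$ depending only on $\epsilon$ such that if $k^*\le n/c$ with $k^*:=k^*(b)$, then $$\mathbb E_{\mathcal E}[R(\hat\beta)]\ \ge\ \frac{1}{c\,\|\Upsilon_n^{-1}\Xi_{0,n}\|}\left(\frac{k^*}{n}+\frac{n}{R_{k^*}(\Sigma)}\right)$$ with probability at least $1-c\exp(-n/c)$. (ii) Suppose in addition that $\beta^*$ is random with the sign-prior distribution described in the context, with nonrandom $\bar\beta\in\mathbb R^p$. There exist constants $b=b(\epsilon)\ge1$ and $c=c(\epsilon)\ge1$ depending only on $\epsilon$ such that for any $k\in\{1,\dots,p\}$ with $r_k(\Sigma)\ge bn$, with probability at least $1-10e^{-n/c}$, $$\mathbb E_{\mathcal E,\beta^*}[R(\hat\beta)]\ \ge\ \frac12\sum_{i=1}^p\frac{\lambda_i(\bar\beta^{(i)})^2}{\left(1+\frac{c\lambda_in}{\lambda_{k+1}r_k(\Sigma)}\right)^2}.$$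
   Context: Design. $n,p\in\mathbb N$. $\Sigma\in\mathbb R^{p\times p}$ is positive definite, $\Sigma=U\Lambda U^\top$ with $U$ orthogonal and $\Lambda=\mathrm{diag}\{\lambda_1,\dots,\lambda_p\}$, $\lambda_1\ge\dots\ge\lambda_p>0$; put $\lambda_j=0$ for $j>p$ (so $\lambda_{n+1}>0$ means $p\ge n+1$). $\Xi_{1,n},\dots,\Xi_{p,n}\in\mathbb R^{n\times n}$ are positive definite, $z_1,\dots,z_p$ are i.i.d. $N(\mathbf 0,I_n)$, and $$X=[\Xi_{1,n}^{1/2}z_1,\dots,\Xi_{p,n}^{1/2}z_p]\Lambda^{1/2}U^\top\in\mathbb R^{n\times p}.$$ Model. $Y=X\beta^*+\mathcal E$ with $\beta^*\in\mathbb R^p$ (deterministic in (i)), $\mathcal E\sim N(\mathbf 0,\Upsilon_n)$ independent of $X$, $\Upsilon_n\in\mathbb R^{n\times n}$ positive definite. The interpolator is $\hat\beta=X^\top(XX^\top)^{-1}Y$, the minimum-Euclidean-norm solution of $X\beta=Y$. Risk. $R(\hat\beta)=\mathbb E^*[(y^*-\langle\hat\beta,x^*\rangle)^2-(y^*-\langle\beta^*,x^*\rangle)^2]$, where $x^*\sim N(\mathbf 0,\Sigma)$, $y^*=\langle\beta^*,x^*\rangle+\varepsilon^*$, $\varepsilon^*\sim N(0,\sigma_\varepsilon^2)$ with $\sigma_\varepsilon>0$ arbitrary, $(x^*,\varepsilon^* )$ are independent of each other and of everything else, and $\mathbb E^*$ is the expectation over $(x^*,y^* )$ only (with $\beta^*$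 and the data fixed). $\mathbb E_{\mathcal E}$ and $\mathbb E_{\mathcal E,\beta^*}$ are the conditional expectations over $\mathcal E$, respectively $(\mathcal E,\beta^* )$, given all other random variables. Coherence assumption (with $\epsilon\in(0,1]$). There is a positive definite reference matrix $\Xi_{0,n}\in\mathbb R^{n\times n}$ with $\epsilon\le\mu_n(\Xi_{0,n}^{-1}\Xi_{i,n})\le\mu_1(\Xi_{0,n}^{-1}\Xi_{i,n})\le 1/\epsilon$ for all $i=1,\dots,p$ (the same $\epsilon$ for all $n$), where $\mu_i(\cdot)$ is the $i$-th largest eigenvalue. Sign prior. $(U^\top\beta^* )^{(i)}=s_i\bar\beta^{(i)}$, $i=1,\dots,p$, where $\bar\beta\in\mathbb R^p$ is an arbitrary nonrandom vector, and $s_1,\dots,s_p$ are i.i.d. with $P(s_i=1)=P(s_i=-1)=1/2$, independent of all other random variables. $v^{(i)}$ denotes the $i$-th coordinate of $v$. Notation. $\|\cdot\|$ is the operator norm. For $0\le k<p$: $r_k(\Sigma)=\sum_{i>k}\lambda_i/\lambda_{k+1}$ and $R_k(\Sigma)=(\sum_{i>k}\lambda_i)^2/\sum_{i>k}\lambda_i^2$; the condition $r_k(\Sigma)\ge bn$ is considered to fail for $k=p$. For $b>0$: $k^*(b)=\min\{k\ge 0: r_k(\Sigma)\ge bn\}$, and $k^*(b)=\infty$ if the set is empty. *)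

(* Defs.v *)
From HB Require Import structures.
From mathcomp Require Import all_boot all_order all_algebra.
From mathcomp Require Import all_classical all_reals all_analysis measurable_realfun.

Set Implicit Arguments.
Unset Strict Implicit.
Unset Printing Implicit Defensive.

Import Order.TTheory GRing.Theory Num.Theory.
Import numFieldNormedType.Exports.

Local Open Scope classical_set_scope.
Local Open Scope ring_scope.

Section linear_algebra.
Context {R : realType}.

Definition dotv n (u v : 'cV[R]_n) : R := (u^T *m v) 0 0.

(* The norm carried by matrices in the library is the max-norm. *)
Definition enorm n (u : 'cV[R]_n) : R := Num.sqrt (dotv u u).

Definition opnorm m n (A : 'M[R]_(m, n)) : R :=
  sup [set enorm (A *m u) | u in [set u : 'cV[R]_n | enorm u <= 1]].

Definition posdef n (A : 'M[R]_n) : Prop :=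
  A^T = A /\ forall u : 'cV[R]_n, u != 0 -> 0 < dotv u (A *m u).

Definition possemidef n (A : 'M[R]_n) : Prop :=
  A^T = A /\ forall u : 'cV[R]_n, 0 <= dotv u (A *m u).

(* The principal square root: every positive semidefinite matrix has exactly
   one positive semidefinite square root (the default 0 is for other A). *)
Definition mxsqrt n (A : 'M[R]_n) : 'M[R]_n :=
  xget 0 [set B : 'M[R]_n | possemidef B /\ B *m B = A].

(* Nonincreasing list of the eigenvalues of A, with algebraic multiplicity.
   It has length n when the characteristic polynomial splits over R, as it
   does for a product of two positive definite matrices, and is empty
   otherwise. *)
Definition eigenvals n (A : 'M[R]_n) : seq R :=
  xget [::] [set s : seq R | sorted >=%R s /\
                             char_poly A = \prod_(a <- s) ('X - a%:P)].

(* The i-th largest eigenvalue, counting from i = 1. *)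
Definition eigval n (i : nat) (A : 'M[R]_n) : R := (eigenvals A)`_i.-1.

Definition coherent n p (eps : R) (Xi0 : 'M[R]_n) (Xi : 'I_p -> 'M[R]_n) :=
  posdef Xi0 /\
  forall i, [/\ eps <= eigval n (invmx Xi0 *m Xi i),
                eigval n (invmx Xi0 *m Xi i) <= eigval 1 (invmx Xi0 *m Xi i) &
                eigval 1 (invmx Xi0 *m Xi i) <= eps^-1].

End linear_algebra.

Section effective_ranks.
Context {R : realType} {p : nat}.
Implicit Type lam : 'rV[R]_p.

(* ev lam j is lambda_(j+1), extended by 0 beyond p: the entries of lam are
   numbered from 0. *)
Definition ev lam (j : nat) : R := if insub j is Some i then lam 0 i else 0.

Definition small_r lam (k : nat) : R := (\sum_(k <= i < p) ev lam i) / ev lam k.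

Definition big_R lam (k : nat) : R :=
  (\sum_(k <= i < p) ev lam i) ^+ 2 / \sum_(k <= i < p) ev lam i ^+ 2.

(* r_k >= x, considered to fail when k = p. *)
Definition r_ge lam (k : nat) (x : R) : bool := (k < p)%N && (x <= small_r lam k).

(* None stands for infinity. *)
Definition kstar lam (n : nat) (b : R) : option nat :=
  ohead [seq k <- iota 0 p | r_ge lam k (b * n%:R)].

End effective_ranks.

Section random_elements.
Context {R : realType} {d : measure_display} {T : measurableType d}.
Variable P : probability T R.

Definition random_mx m n (X : T -> 'M[R]_(m, n)) : Prop :=
  forall i j, measurable_fun setT (fun w => X w i j).

Definition sigma_mx m n (X : T -> 'M[R]_(m, n)) : set (set T) :=
  <<s \bigcup_(ij in [set: 'I_m * 'I_n])
        preimage_set_system setT (fun w => X w ij.1 ij.2) measurable >>.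

(* For sigma-algebras the product rule over all of I gives the product rule over
   every subfamily, by taking some of the A i equal to setT. *)
Definition mutual_indep (I : finType) (G : I -> set (set T)) : Prop :=
  forall A : I -> set T, (forall i, G i (A i)) ->
    P (\bigcap_(i in [set: I]) A i) = (\prod_(i : I) P (A i))%E.

Definition indep2 (G H : set (set T)) : Prop :=
  forall A B, G A -> H B -> P (A `&` B) = (P A * P B)%E.

(* The law N(0, v). The second argument of normal_prob is the standard
   deviation, and normal_prob 0 0 is not the point mass at 0. *)
Definition normal0 (v : R) (B : set R) : \bar R :=
  if v == 0 then \d_(0 : R) B else normal_prob 0 (Num.sqrt v) B.

(* Z ~ N(0, S): every linear functional <u, Z> has law N(0, u^T S u). *)
Definition gaussian n (Z : T -> 'cV[R]_n) (S : 'M[R]_n) : Prop :=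
  random_mx Z /\
  forall (u : 'cV[R]_n) (B : set R), measurable B ->
    P [set w | B (dotv u (Z w))] = normal0 (dotv u (S *m u)) B.

(* g is a version of the conditional expectation E[f | G] of a nonnegative,
   not necessarily integrable, f. These equations determine g up to a P-null
   set and force g >= 0 almost surely, even if g takes the value +oo. *)
Definition is_cond_expectation (G : set (set T)) (f g : T -> \bar R) : Prop :=
  (forall B : set (\bar R), measurable B -> G (g @^-1` B)) /\
  forall A, G A -> (\int[P]_(w in A) g w = \int[P]_(w in A) f w)%E.

End random_elements.

Section linear_model.
Context {R : realType}.

Definition design_of n p (T : Type) (Xi : 'I_p -> 'M[R]_n)
    (z : 'I_p -> T -> 'cV[R]_n) (lam : 'rV[R]_p) (U : 'M[R]_p) (w : T) :
    'M[R]_(n, p) :=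
  (\matrix_(j, i) (mxsqrt (Xi i) *m z i w) j 0)
    *m diag_mx (map_mx Num.sqrt lam) *m U^T.

(* The training data live on (Omega, Prob). The test pair (xstar, epsstar) lives
   on a space (Omegas, Probs) of its own, which is what makes it independent of
   everything else; E^* is the expectation under Probs. *)
Record model (n p : nat) := Model {
  Sigma : 'M[R]_p;
  rot : 'M[R]_p;
  lam : 'rV[R]_p;
  Sigma_posdef : posdef Sigma;
  rot_orthogonal : rot *m rot^T = 1%:M;
  Sigma_spectral : Sigma = rot *m diag_mx lam *m rot^T;
  lam_nonincreasing : forall i j : 'I_p, (i <= j)%N -> lam 0 j <= lam 0 i;
  lam_gt0 : forall i, 0 < lam 0 i;

  Xi : 'I_p -> 'M[R]_n;
  Xi_posdef : forall i, posdef (Xi i);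
  Upsilon : 'M[R]_n;
  Upsilon_posdef : posdef Upsilon;

  disp : measure_display;
  Omega : measurableType disp;
  Prob : probability Omega R;
  z : 'I_p -> Omega -> 'cV[R]_n;
  z_gaussian : forall i, gaussian Prob (z i) 1%:M;
  z_indep : mutual_indep Prob (fun i => sigma_mx (z i));
  noise : Omega -> 'cV[R]_n;
  noise_gaussian : gaussian Prob noise Upsilon;
  noise_indep : indep2 Prob (sigma_mx noise) (sigma_mx (design_of Xi z lam rot));

  disps : measure_display;
  Omegas : measurableType disps;
  Probs : probability Omegas R;
  xstar : Omegas -> 'cV[R]_p;
  xstar_gaussian : gaussian Probs xstar Sigma;
  sigma_eps : R;
  sigma_eps_gt0 : 0 < sigma_eps;
  epsstar : {RV Probs >-> R};
  epsstar_normal : forall B : set R, measurable B ->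
    Probs (epsstar @^-1` B) = normal_prob 0 sigma_eps B;
  test_indep : indep2 Probs (sigma_mx xstar)
    (preimage_set_system setT epsstar measurable)
}.

Arguments z {n p} m i w.
Arguments noise {n p} m w.
Arguments xstar {n p} m w.
Arguments epsstar {n p} m.

Section derived.
Context {n p : nat} (M : model n p).

Definition design : Omega M -> 'M[R]_(n, p) :=
  design_of (Xi M) (z M) (lam M) (rot M).

Definition response (beta : 'cV[R]_p) (w : Omega M) : 'cV[R]_n :=
  design w *m beta + noise M w.

Definition interpolator (beta : 'cV[R]_p) (w : Omega M) : 'cV[R]_p :=
  (design w)^T *m invmx (design w *m (design w)^T) *m response beta w.

Definition ystar (beta : 'cV[R]_p) (w : Omegas M) : R :=
  dotv beta (xstar M w) + epsstar M w.

(* R(b) when the true coefficient vector is beta. *)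
Definition risk (beta b : 'cV[R]_p) : \bar R :=
  'E_(Probs M)[fun w => (ystar beta w - dotv b (xstar M w)) ^+ 2
                     - (ystar beta w - dotv beta (xstar M w)) ^+ 2].

(* The random variable R(betahat), for a possibly random beta. *)
Definition risk_interpolator (beta : Omega M -> 'cV[R]_p) (w : Omega M) : \bar R :=
  risk (beta w) (interpolator (beta w) w).

(* Taking the expectation over the noise, and over beta if it is random, amounts
   to conditioning on the design. *)
Definition is_expected_risk (beta : Omega M -> 'cV[R]_p) (g : Omega M -> \bar R) :=
  is_cond_expectation (Prob M) (sigma_mx design) (risk_interpolator beta) g.

Record sign_prior (betabar : 'cV[R]_p) (s beta : Omega M -> 'cV[R]_p) : Prop := {
  sign_measurable : random_mx s;
  sign_pos : forall i, Prob M [set w | s w i 0 = 1] = (2^-1)%:E;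
  sign_neg : forall i, Prob M [set w | s w i 0 = -1] = (2^-1)%:E;
  sign_mutual_indep : mutual_indep (Prob M) (fun i : 'I_p =>
    preimage_set_system setT (fun w => s w i 0) measurable);
  sign_indep : indep2 (Prob M) (sigma_mx s)
    (sigma_mx (fun w => row_mx (design w) (noise M w)));
  sign_beta : forall w i, ((rot M)^T *m beta w) i 0 = s w i 0 * betabar i 0
}.

End derived.
End linear_model.

Arguments model : clear implicits.

(* Main.v *)
(** Let [x_i = Xi_i^(1/2) z_i], so that [A = X X^T = sum_i lam_i x_i x_i^T], and put
    [w_i = A^-1 x_i], [q_i = lam_i x_i^T w_i] and [y_i = Xi0^(-1/2) x_i].  In the
    eigenbasis of [Sigma] the excess risk is a sum over [i] of [lam_i h_i^2], where
    [h_i] is affine in the noise and in [U^T beta].  Averaging over the noise leaves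
    at least [lam_i^2 w_i^T Upsilon w_i >= q_i^2 / (kappa |y_i|^2)], with
    [kappa = ||Upsilon^-1 Xi0||]; averaging over the signs leaves at least
    [lam_i (1 - q_i)^2 betabar_i^2].

    By coherence [<u, y_i>] is centred Gaussian with variance between
    [eps |u|^2] and [|u|^2 / eps].  Chernoff bounds and a union bound over a net
    control the tail form [sum_(j >= k) lam_j <u, y_j>^2] from above, and from below
    when [sum_(j >= k) lam_j >= b n lam_k]; a small-ball estimate bounds from below
    the singular values of at most [k + 1] of the [y_j].  The last bound gives the
    part of [y_i] orthogonal to the other leading columns, hence a lower bound on
    [q_i]; the lower bound on the tail form gives an upper bound on [q_i].  Each
    term is controlled with probability [1 - delta] only, and Markov's inequality
    turns this into half of the whole sum with probability [1 - 2 delta]. *)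
Require Import Defs.
From mathcomp Require Import all_boot all_order all_algebra complex spectral.
From mathcomp Require Import all_classical all_reals all_analysis measurable_realfun.
From mathcomp Require Import ring lra zify.
Set Implicit Arguments.
Unset Strict Implicit.
Unset Printing Implicit Defensive.
Import Order.TTheory GRing.Theory Num.Theory.
Import numFieldNormedType.Exports.
Local Open Scope classical_set_scope.
Local Open Scope ring_scope.

(** * Linear algebra *)

(** Three obstacles shape the proof. The number [p] is not controlled by [n], so no union bound over
    the index [i] is affordable: every event concerns one [i] and has a failure probability free of
    [p]. The columns have different covariances, and a Gaussian vector is given only through its
    linear functionals, so each estimate is first made for a fixed vector, by Chernoff bounds or by
    the decay of a characteristic function, and a net makes it uniform. The risk is not assumed
    integrable and [g] is any version of the conditional expectation, hence the truncation by design
    events. With [L] the tail sum from [k*], the lower bound on the leverage is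
    [q_i >= (1 + a L / (n lam_i))^-1]. For [i < k*] minimality of [k*] gives [L <= b n lam_i], so
    each such term is of constant order, which yields [k*]. The constants are fixed in the order
    [s], [K], [b], [c]: [s] sets the rate of the small-ball bound, [1/K] is the mesh of the nets,
    and [b] lets the Chernoff exponent beat their cardinality. *)

Section dotv_theory.
Context {R : realType}.

Lemma dotvE n (u v : 'cV[R]_n) : dotv u v = \sum_i u i 0 * v i 0.
Proof. by rewrite /dotv mxE; apply: eq_bigr => i _; rewrite mxE. Qed.

Lemma dotvC n (u v : 'cV[R]_n) : dotv u v = dotv v u.
Proof. by rewrite !dotvE; apply: eq_bigr => i _; rewrite mulrC. Qed.

Lemma dotvDl n (u v w : 'cV[R]_n) : dotv (u + v) w = dotv u w + dotv v w.
Proof. by rewrite /dotv linearD /= mulmxDl mxE. Qed.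

Lemma dotvDr n (u v w : 'cV[R]_n) : dotv w (u + v) = dotv w u + dotv w v.
Proof. by rewrite dotvC dotvDl !(dotvC w). Qed.

Lemma dotvZl n a (u w : 'cV[R]_n) : dotv (a *: u) w = a * dotv u w.
Proof. by rewrite /dotv linearZ /= -scalemxAl mxE. Qed.

Lemma dotvZr n a (u w : 'cV[R]_n) : dotv w (a *: u) = a * dotv w u.
Proof. by rewrite dotvC dotvZl dotvC. Qed.

Lemma dotv0l n (u : 'cV[R]_n) : dotv 0 u = 0.
Proof. by rewrite -(scale0r 0) dotvZl mul0r. Qed.

Lemma dotv0r n (u : 'cV[R]_n) : dotv u 0 = 0.
Proof. by rewrite dotvC dotv0l. Qed.

Lemma dotvNl n (u w : 'cV[R]_n) : dotv (- u) w = - dotv u w.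
Proof. by rewrite -scaleN1r dotvZl mulN1r. Qed.

Lemma dotvNr n (u w : 'cV[R]_n) : dotv w (- u) = - dotv w u.
Proof. by rewrite dotvC dotvNl dotvC. Qed.

Lemma dotvBl n (u v w : 'cV[R]_n) : dotv (u - v) w = dotv u w - dotv v w.
Proof. by rewrite dotvDl dotvNl. Qed.

Lemma dotvBr n (u v w : 'cV[R]_n) : dotv w (u - v) = dotv w u - dotv w v.
Proof. by rewrite dotvDr dotvNr. Qed.

Lemma dotv_suml n (I : Type) (r : seq I) (P : pred I) (F : I -> 'cV[R]_n) w :
  dotv (\sum_(i <- r | P i) F i) w = \sum_(i <- r | P i) dotv (F i) w.
Proof.
apply: (big_morph (fun u => dotv u w)); last exact: dotv0l.
by move=> x y; rewrite dotvDl.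
Qed.

Lemma dotv_sumr n (I : Type) (r : seq I) (P : pred I) (F : I -> 'cV[R]_n) w :
  dotv w (\sum_(i <- r | P i) F i) = \sum_(i <- r | P i) dotv w (F i).
Proof. by rewrite dotvC dotv_suml; apply: eq_bigr => i _; rewrite dotvC. Qed.

Lemma dotv_mulmx m n (A : 'M[R]_(m, n)) u v :
  dotv u (A *m v) = dotv (A^T *m u) v.
Proof. by rewrite /dotv trmx_mul trmxK mulmxA. Qed.

Lemma dotv_ge0 n (u : 'cV[R]_n) : 0 <= dotv u u.
Proof. by rewrite dotvE sumr_ge0// => i _; rewrite -expr2 sqr_ge0. Qed.

Lemma dotv_eq0 n (u : 'cV[R]_n) : (dotv u u == 0) = (u == 0).
Proof.
apply/eqP/eqP => [|->]; last by rewrite dotv0l.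
rewrite dotvE => /eqP; rewrite psumr_eq0 => [/allP h|i _]; last first.
  by rewrite -expr2 sqr_ge0.
apply/matrixP => i j; rewrite ord1 mxE.
by have := h i (mem_index_enum _); rewrite mulf_eq0 orbb => /eqP.
Qed.

Lemma dotv_gt0 n (u : 'cV[R]_n) : (0 < dotv u u) = (u != 0).
Proof. by rewrite lt_def dotv_ge0 andbT dotv_eq0. Qed.

Lemma dotv_parallelogram n (u v : 'cV[R]_n) :
  dotv (u + v) (u + v) <= 2 * dotv u u + 2 * dotv v v.
Proof.
have := dotv_ge0 (u - v).
rewrite !(dotvDl, dotvDr, dotvNl, dotvNr) (dotvC v u); lra.
Qed.

(** The form at [u + t *: v] is a nonnegative polynomial of degree at most two in [t], so its
    discriminant is not positive. [A] may be degenerate, hence the case of a vanishing leading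
    coefficient. *)
Lemma cauchy_schwarz_psd n (A : 'M[R]_n) (u v : 'cV[R]_n) : possemidef A ->
  dotv u (A *m v) ^+ 2 <= dotv u (A *m u) * dotv v (A *m v).
Proof.
move=> [sA pA].
have sym : dotv v (A *m u) = dotv u (A *m v) by rewrite dotvC dotv_mulmx sA dotvC dotvC dotvC.
have key t : 0 <= dotv v (A *m v) * t ^+ 2 + 2 * dotv u (A *m v) * t + dotv u (A *m u).
  have := pA (u + t *: v).
  rewrite mulmxDr -scalemxAr !(dotvDl, dotvDr, dotvZl, dotvZr) sym.
  by move=> h; apply: le_trans h _; rewrite le_eqVlt; apply/orP; left; apply/eqP; ring.
set a := dotv v _ in key *; set b := dotv u (A *m v) in key *.
set c := dotv u (A *m u) in key *.
have a0 : 0 <= a by exact: pA.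
have [aE|an0] := eqVneq a 0; last first.
  have := key (- b / a).
  have ap : 0 < a by rewrite lt_def an0.
  rewrite -(pmulr_rge0 _ ap).
  have -> : a * (a * (- b / a) ^+ 2 + 2 * b * (- b / a) + c) = c * a - b ^+ 2 by field.
  lra.
have [bE|bn0] := eqVneq b 0; first by rewrite bE aE expr0n /= mulr0.
(* The leading coefficient is 0 but the slope is not: this [t] gives the affine function the value
   -1. *)
have := key (- (c + 1) / (2 * b)).
rewrite aE mul0r add0r.
have -> : 2 * b * (- (c + 1) / (2 * b)) = - (c + 1) by field.
lra.
Qed.

Lemma possemidef1 n : possemidef (1%:M : 'M[R]_n).
Proof. by split; [rewrite trmx1|move=> u; rewrite mul1mx dotv_ge0]. Qed.

Lemma cauchy_schwarz n (u v : 'cV[R]_n) :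
  dotv u v ^+ 2 <= dotv u u * dotv v v.
Proof. by have := cauchy_schwarz_psd u v (possemidef1 n); rewrite !mul1mx. Qed.

End dotv_theory.

Lemma conj_eq (F : fieldType) n (A P D : 'M[F]_n) : P \in unitmx ->
  A = invmx P *m D *m P -> P *m A = D *m P.
Proof. by move=> Pu ->; rewrite !mulmxA mulmxV// mul1mx. Qed.

(** * Spectral theory of real symmetric matrices *)

Section spectral_real.
Context {R : realType}.

(* Diagonalize over R[i]; two real matrices similar over R[i] are similar over R. *)
Lemma symmetric_diagonalizable n (A : 'M[R]_n) : A^T = A ->
  exists P d, P \in unitmx /\ A = invmx P *m diag_mx d *m P.
Proof.
move=> sA; pose f := real_complex R; pose Ac := map_mx f A.
have rA : Ac \is a mxOver Num.real.
  by apply/mxOverP => i j; rewrite mxE; apply/complex_realP; exists (A i j).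
have hA : Ac \is hermsymmx.
  have sAc : Ac^T = Ac by rewrite /Ac map_trmx sA.
  apply/is_hermitianmxP; rewrite expr0 scale1r sAc.
  by apply/matrixP => i j; rewrite !mxE; apply/esym/CrealP; apply/complex_realP; exists (A i j).
have /orthomx_spectralP eA := hermitian_normalmx hA.
have rd := hermitian_spectral_diag_real hA.
set P := spectralmx Ac in eA; set d := spectral_diag Ac in eA rd.
have Pu : P \in unitmx by exact: spectral_unit.
clearbody P d.
have sim : exists2 P0, P0 \in unitmx & similar P0 Ac (diag_mx d).
  by exists P; [exact: Pu|apply/(similarP Pu); exact: (conj_eq Pu eA)].
have rdd : diag_mx d \is a mxOver Num.real.
  apply/mxOverP => i j; rewrite mxE; case: eqP => _; rewrite ?mulr0n ?mulr1n //.
  exact: (mxOverP rd).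
have [Q] := real_similar sim rA rdd.
rewrite inE => /andP[rQ Qu] /(similarP Qu) e.
pose Qr : 'M[R]_n := map_mx (@complex.Re R) Q.
pose dr : 'rV[R]_n := map_mx (@complex.Re R) d.
have QE : Q = map_mx f Qr.
  apply/matrixP => i j; rewrite !mxE; apply/esym/RRe_real; exact: (mxOverP rQ).
have dE : d = map_mx f dr.
  apply/matrixP => i j; rewrite !mxE; apply/esym/RRe_real; exact: (mxOverP rd).
have Qru : Qr \in unitmx by move: Qu; rewrite QE map_unitmx.
exists Qr, dr; split => //.
have : Qr *m A = diag_mx dr *m Qr.
  apply: (@map_mx_inj _ _ f n n).
  by rewrite !map_mxM -QE map_diag_mx -dE e.
by move=> e2; rewrite -mulmxA -e2 mulmxA mulVmx// mul1mx.
Qed.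

End spectral_real.

Section psd.
Context {R : realType}.

Lemma posdefW n (A : 'M[R]_n) : posdef A -> possemidef A.
Proof.
move=> [sA pA]; split => // u; have [->|u0] := eqVneq u 0.
  by rewrite dotv0l.
exact/ltW/pA.
Qed.

Lemma posdef_unit n (A : 'M[R]_n) : posdef A -> A \in unitmx.
Proof.
move=> [sA pA]; rewrite -row_free_unit -kermx_eq0; apply/eqP/row_matrixP => i.
rewrite row0; set u := row i _.
have uA : u *m A = 0 by apply/sub_kermxP; exact: row_sub.
apply/eqP/contraT => u0.
have : 0 < dotv u^T (A *m u^T).
  by apply: pA; apply: contraNneq u0 => e; rewrite -[u]trmxK e trmx0.
by rewrite dotv_mulmx -trmx_mul uA trmx0 dotv0l ltxx.
Qed.

Section functional_calculus.
Context {n : nat} (A P : 'M[R]_n) (d : 'rV[R]_n).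
Hypotheses (sA : A^T = A) (Pu : P \in unitmx) (AE : A = invmx P *m diag_mx d *m P).

(** [P] is not known to be orthogonal. Symmetry of [A] makes [P *m P^T] commute with [diag_mx d], so
    its entries vanish between distinct eigenvalues; it then commutes with [f] of the diagonal as
    well, which is the symmetry claimed. *)
Lemma spectral_fun_sym (f : R -> R) :
  (invmx P *m diag_mx (map_mx f d) *m P)^T = invmx P *m diag_mx (map_mx f d) *m P.
Proof.
have comm : (P *m P^T) *m diag_mx d = diag_mx d *m (P *m P^T).
  have e1 : diag_mx d = P *m A *m invmx P by rewrite AE !mulmxA mulmxV// mul1mx mulmxK.
  have e2 : diag_mx d = (invmx P)^T *m A *m P^T.
    by rewrite -[LHS](tr_diag_mx) e1 !trmx_mul sA mulmxA.
  rewrite [in LHS]e2 [in RHS]e1 !mulmxA mulmxKV//.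
  rewrite -(mulmxA P P^T) -trmx_mul mulVmx// trmx1 mulmx1 //.
have commf : (P *m P^T) *m diag_mx (map_mx f d) = diag_mx (map_mx f d) *m (P *m P^T).
  apply/matrixP => i j.
  have /matrixP/(_ i j) := comm; rewrite !mul_mx_diag !mul_diag_mx !mxE => e.
  have [->|h] := eqVneq (d 0 i) (d 0 j); first by rewrite mulrC.
  have -> : \sum_j0 P i j0 * P^T j0 j = 0; last by rewrite mul0r mulr0.
  apply/eqP; move: h; apply: contraNT => s0.
  by apply/eqP/(mulIf s0); rewrite -e mulrC.
rewrite !trmx_mul tr_diag_mx.
have -> : P^T = invmx P *m (P *m P^T) by rewrite mulmxA mulVmx// mul1mx.
rewrite trmx_inv.
rewrite !mulmxA -(mulmxA (invmx P) P P^T).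
rewrite -[_ *m diag_mx _]mulmxA commf !mulmxA -mulmxA mulmxV ?unitmx_tr//.
by rewrite mulmx1.
Qed.

Lemma spectral_eigvec i (u := invmx P *m (delta_mx i 0 : 'cV_n)) :
  u != 0 /\ A *m u = d 0 i *: u.
Proof.
split.
  apply/eqP => e; have : P *m u = 0 by rewrite e mulmx0.
  rewrite /u mulmxA mulmxV// mul1mx => /matrixP/(_ i 0)/eqP.
  by rewrite !mxE !eqxx oner_eq0.
rewrite AE /u -!mulmxA (mulmxA P) mulmxV// mul1mx.
rewrite scalemxAr; congr (_ *m _).
apply/matrixP => k l; rewrite mul_diag_mx !mxE; case: eqP => [->|]//.
by rewrite !mulr0.
Qed.

Lemma char_poly_spectral : char_poly A = \prod_i ('X - (d 0 i)%:P).
Proof.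
have -> : char_poly A = char_poly (diag_mx d).
  rewrite /char_poly /char_poly_mx AE.
  rewrite !map_mxM.
  have e : 'X%:M = map_mx polyC (invmx P) *m 'X%:M *m map_mx polyC P :> 'M[{poly R}]_n.
    by rewrite mul_mx_scalar -scalemxAl -map_mxM mulVmx// map_mx1 scalemx1.
  rewrite [in LHS]e -mulmxBl -mulmxBr !det_mulmx mulrAC -det_mulmx -map_mxM.
  by rewrite mulVmx// map_mx1 det1 mul1r.
rewrite char_poly_trig ?diag_mx_is_trig//.
by apply: eq_bigr => i _; rewrite mxE eqxx.
Qed.

(** [A - a%:M] is the square of a symmetric matrix [B], so its form at [u] is the squared norm of
    [B *m u]. *)
Lemma spectral_ge_psd (a : R) : (forall i, a <= d 0 i) ->
  forall u, a * dotv u u <= dotv u (A *m u).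
Proof.
move=> ad u; pose B := invmx P *m diag_mx (map_mx (fun x => Num.sqrt (x - a)) d) *m P.
have BB : B *m B = A - a%:M.
  rewrite /B AE !mulmxA mulmxK// -[_ *m diag_mx _ *m diag_mx _]mulmxA mulmx_diag.
  have -> : a%:M = invmx P *m a%:M *m P by rewrite mul_mx_scalar -scalemxAl mulVmx// scalemx1.
  rewrite -mulmxBl -mulmxBr; congr (_ *m _ *m _).
  apply/matrixP => i j; rewrite !mxE; case: eqP => [->|_]; last by rewrite !mulr0n subr0.
  by rewrite !mulr1n -expr2 sqr_sqrtr// subr_ge0.
have : 0 <= dotv u (B *m B *m u).
  by rewrite -mulmxA dotv_mulmx spectral_fun_sym dotv_ge0.
by rewrite BB mulmxBl dotvBr mul_scalar_mx dotvZr subr_ge0.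
Qed.
End functional_calculus.

Lemma spectral_le_psd n (A P : 'M[R]_n) d (a : R) : A^T = A -> P \in unitmx ->
  A = invmx P *m diag_mx d *m P -> (forall i, d 0 i <= a) ->
  forall u, dotv u (A *m u) <= a * dotv u u.
Proof.
move=> sA Pu AE ad u.
have := @spectral_ge_psd _ (- A) P (- d) _ Pu _ (- a) _ u.
rewrite linearN /= sA mulNmx dotvNr mulNr lerN2; apply => //.
- by rewrite AE raddfN /= mulmxN mulNmx.
- by move=> i; rewrite mxE lerN2.
Qed.

(** Exhibiting one root is enough, because [xget] then cannot fall back on its default. The root is
    the square root of the eigenvalues in the functional calculus. *)
Lemma mxsqrtP n (A : 'M[R]_n) : possemidef A ->
  possemidef (mxsqrt A) /\ mxsqrt A *m mxsqrt A = A.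
Proof.
move=> [sA pA]; rewrite /mxsqrt; case: xgetP => [B -> //|] /= none.
exfalso; have [P [d [Pu AE]]] := symmetric_diagonalizable sA.
have d0 i : 0 <= d 0 i.
  have [u0 e] := spectral_eigvec Pu AE i.
  by have := pA (invmx P *m delta_mx i 0); rewrite e dotvZr pmulr_lge0// dotv_gt0.
pose S f := invmx P *m diag_mx (map_mx f d) *m P.
have SS f g : S f *m S g = S (fun x => f x * g x).
  rewrite /S !mulmxA mulmxK// -[_ *m diag_mx _ *m diag_mx _]mulmxA mulmx_diag.
  by congr (_ *m diag_mx _ *m _); apply/matrixP => i j; rewrite !(mxE, ord1).
have SE f g : (forall i, f (d 0 i) = g (d 0 i)) -> S f = S g.
  move=> h; rewrite /S; congr (_ *m diag_mx _ *m _); apply/matrixP => i j.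
  by rewrite !mxE ord1 h.
apply: (none (S Num.sqrt)); split.
  split; first exact: (spectral_fun_sym sA Pu AE).
  (* The root is positive semidefinite because it is the square of the symmetric fourth root. *)
  move=> u; have -> : S Num.sqrt = S (fun x => Num.sqrt (Num.sqrt x)) *m S (fun x => Num.sqrt (Num.sqrt x)).
    rewrite SS; apply: SE => i; by rewrite -expr2 sqr_sqrtr// sqrtr_ge0.
  by rewrite -mulmxA dotv_mulmx (spectral_fun_sym sA Pu AE) dotv_ge0.
rewrite SS (SE _ id) => [|i]; last by rewrite -expr2 sqr_sqrtr.
by rewrite /S map_mx_id.
Qed.

Lemma mxsqrt_sym n (A : 'M[R]_n) : possemidef A -> (mxsqrt A)^T = mxsqrt A.
Proof. by move=> /mxsqrtP[[]]. Qed.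

Lemma mxsqrt_unit n (A : 'M[R]_n) : posdef A -> mxsqrt A \in unitmx.
Proof.
move=> pA; have [_ e] := mxsqrtP (posdefW pA).
have : mxsqrt A *m mxsqrt A \in unitmx by rewrite e posdef_unit.
by rewrite unitmx_mul => /andP[].
Qed.

(* Xi0^-1 Xi is similar to the symmetric matrix S^-1 Xi S^-1, where S = Xi0^(1/2). *)
Lemma generalized_rayleigh n (Xi0 Xi : 'M[R]_n) (a b : R) :
  posdef Xi0 -> posdef Xi ->
  a <= eigval n (invmx Xi0 *m Xi) -> eigval 1 (invmx Xi0 *m Xi) <= b ->
  let T := invmx (mxsqrt Xi0) in
  forall u, a * dotv u u <= dotv u (T *m Xi *m T *m u) <= b * dotv u u.
Proof.
move=> p0 pX an b1 T u.
have [_ e0] := mxsqrtP (posdefW p0).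
have Su := mxsqrt_unit p0.
have sT : T^T = T by rewrite /T trmx_inv mxsqrt_sym//; exact: posdefW.
have sN : (T *m Xi *m T)^T = T *m Xi *m T by rewrite !trmx_mul sT pX.1 mulmxA.
have [P [d [Pu NE]]] := symmetric_diagonalizable sN.
have PSu : P *m mxsqrt Xi0 \in unitmx by rewrite unitmx_mul Pu.
have e1 : invmx Xi0 *m Xi = invmx (P *m mxsqrt Xi0) *m diag_mx d *m (P *m mxsqrt Xi0).
  have ST : mxsqrt Xi0 *m invmx Xi0 = T.
    apply: (@row_free_inj _ _ _ _ Xi0); first by rewrite row_free_unit posdef_unit.
    by rewrite mulmxKV ?posdef_unit// -{2}e0 mulmxA mulVmx// mul1mx.
  have dP : diag_mx d *m P = P *m (T *m Xi *m T) by rewrite NE !mulmxA mulmxV// mul1mx.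
  rewrite -mulmxA (mulmxA (diag_mx d)) dP -!mulmxA [T *m mxsqrt _]mulVmx// mulmx1.
  by rewrite -ST -!mulmxA (mulmxA P) mulKmx.
have cp := char_poly_spectral PSu e1.
(* The sorted diagonal satisfies the specification of [eigenvals], which is therefore not the
   default empty list. *)
have : exists s : seq R, sorted >=%R s /\ char_poly (invmx Xi0 *m Xi) = \prod_(a <- s) ('X - a%:P).
  exists (sort >=%R [seq d 0 i | i <- enum 'I_n]); split.
    by apply: sort_sorted => x y; exact: ge_total.
  rewrite cp (perm_big _ (permEl (perm_sort _ _))) /= big_map big_enum //.
rewrite /eigval /eigenvals in an b1.
case: xgetP an b1 => [s _ [ss se]|/= none _ _ [s /none]//].
rewrite /= => an b1 _.
have ps : perm_eq s [seq d 0 i | i <- enum 'I_n].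
  apply: prod_XsubC_eq; rewrite -se cp big_map big_enum //.
have szs : size s = n by rewrite (perm_size ps) size_map size_enum_ord.
have ds i : d 0 i \in s by rewrite (perm_mem ps) map_f// mem_enum.
have tr : transitive (>=%R : rel R) by move=> x y z /= h1 h2; exact: le_trans h2 h1.
apply/andP; split.
  apply: (spectral_ge_psd sN Pu NE) => i.
  apply: le_trans an _; have -> : n.-1 = (size s).-1 by rewrite szs.
  rewrite nth_last.
  have := ds i; move: ss; case/lastP: s {se ps szs b1 ds} => // s x ss.
  rewrite last_rcons mem_rcons inE => /predU1P[->//|ys].
  by move: ss; rewrite sorted_pairwise// pairwise_rcons => /andP[/allP/(_ _ ys)].
apply: (spectral_le_psd sN Pu NE) => i; apply: le_trans b1.
have := ds i; move: ss; case: s {se ps szs ds an} => // x s ss.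
rewrite inE => /predU1P[->//|ys].
by move: ss; rewrite /= (path_sortedE tr) => /andP[/allP/(_ _ ys)].
Qed.

Lemma enorm_ge0 n (u : 'cV[R]_n) : 0 <= enorm u.
Proof. exact: sqrtr_ge0. Qed.

Lemma enormZ n a (u : 'cV[R]_n) : enorm (a *: u) = `|a| * enorm u.
Proof.
by rewrite /enorm dotvZl dotvZr mulrA -expr2 sqrtrM ?sqr_ge0// sqrtr_sqr.
Qed.

Lemma enorm_gt0 n (u : 'cV[R]_n) : (0 < enorm u) = (u != 0).
Proof. by rewrite sqrtr_gt0 dotv_gt0. Qed.

Lemma coord_le_enorm n (u : 'cV[R]_n) i : `|u i 0| <= enorm u.
Proof.
rewrite -sqrtr_sqr ler_sqrt ?dotv_ge0// dotvE (bigD1 i)//= -expr2 lerDl.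
by rewrite sumr_ge0// => j _; rewrite -expr2 sqr_ge0.
Qed.

(** An upper bound must exist before the [sup] in [opnorm] can dominate the elements of its set. *)
Lemma opnorm_bounded m n (A : 'M[R]_(m, n)) :
  exists K, forall u : 'cV[R]_n, enorm u <= 1 -> enorm (A *m u) <= K.
Proof.
exists (Num.sqrt (\sum_i (\sum_j `|A i j|) ^+ 2)) => u u1.
rewrite ler_sqrt ?sumr_ge0// => [|i _]; last exact: sqr_ge0.
rewrite dotvE; apply: ler_sum => i _; rewrite -expr2 -[leLHS]real_normK ?num_real//.
rewrite ler_pXn2r// ?nnegrE ?normr_ge0 ?sumr_ge0// mxE.
apply: le_trans (ler_norm_sum _ _ _) _; apply: ler_sum => j _.
by rewrite normrM ler_piMr// (le_trans (coord_le_enorm u j)).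
Qed.

Lemma enorm_mulmx_le m n (A : 'M[R]_(m, n)) u :
  enorm (A *m u) <= opnorm A * enorm u.
Proof.
have [->|u0] := eqVneq u 0; first by rewrite mulmx0 /enorm dotv0l dotv0l sqrtr0 mulr0.
have e0 : 0 < enorm u by rewrite enorm_gt0.
have h : enorm (A *m ((enorm u)^-1 *: u)) <= opnorm A.
  have n1 : enorm ((enorm u)^-1 *: u) <= 1.
    by rewrite enormZ ger0_norm ?invr_ge0 ?enorm_ge0// mulVf ?gt_eqF.
  apply: ub_le_sup; last by exists ((enorm u)^-1 *: u).
  have [K hK] := opnorm_bounded A.
  by exists K => _ [v /= v1 <-]; exact: hK.
move: h; rewrite -scalemxAr enormZ ger0_norm ?invr_ge0 ?enorm_ge0//.
by rewrite mulrC ler_pdivrMr.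
Qed.

Lemma eigenvalue_le_opnorm n (A : 'M[R]_n) (u : 'cV[R]_n) a :
  u != 0 -> A *m u = a *: u -> a <= opnorm A.
Proof.
move=> u0 e; have := enorm_mulmx_le A u; rewrite e enormZ ler_pM2r ?enorm_gt0//.
exact/le_trans/ler_norm.
Qed.

(** With [S] the square root of [Ups] and [T] its inverse, [T *m Xi *m T] is symmetric and similar
    to [invmx Ups *m Xi]. Its eigenvalues are thus bounded by the operator norm, and its Rayleigh
    bound at [S *m u] is the claim. *)
Lemma le_opnorm_posdef n (Xi Ups : 'M[R]_n) u : posdef Xi -> posdef Ups ->
  dotv u (Xi *m u) <= opnorm (invmx Ups *m Xi) * dotv u (Ups *m u).
Proof.
move=> pX pU; have [_ e0] := mxsqrtP (posdefW pU).
have Su := mxsqrt_unit pU; set S := mxsqrt Ups in e0 Su.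
pose T := invmx S.
have sS : S^T = S by rewrite mxsqrt_sym//; exact: posdefW.
have sT : T^T = T by rewrite /T trmx_inv sS.
have sN : (T *m Xi *m T)^T = T *m Xi *m T by rewrite !trmx_mul sT pX.1 mulmxA.
have [P [d [Pu NE]]] := symmetric_diagonalizable sN.
have dle i : d 0 i <= opnorm (invmx Ups *m Xi).
  have [v0 e] := spectral_eigvec Pu NE i; set v := _ *m _ in v0 e.
  apply: (@eigenvalue_le_opnorm _ _ (T *m v)).
    by apply: contra_neq v0 => h; rewrite -[v](mulKVmx Su) -/T h mulmx0.
  have UT : invmx Ups = T *m T.
    apply: (@row_free_inj _ _ _ _ Ups); first by rewrite row_free_unit posdef_unit.
    by rewrite mulVmx ?posdef_unit// -e0 mulmxA -(mulmxA T) mulVmx// mulmx1 mulVmx.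
  by rewrite UT scalemxAr -e !mulmxA.
have := spectral_le_psd sN Pu NE dle (S *m u).
rewrite !mulmxA -(mulmxA (T *m Xi)) mulVmx// mulmx1.
rewrite -!mulmxA dotv_mulmx sT mulmxA mulVmx// mul1mx.
by rewrite -[in dotv u (Ups *m u)]e0 -(mulmxA S) (dotv_mulmx S u) sS.
Qed.

End psd.

(** * Residuals and deterministic bounds on leverages *)

Section residual.
Context {R : realType}.

(** [M *m M^T] and [M] have the same left kernel, so the same rank and the same range. No
    invertibility is assumed, as [M] will have zero rows. *)
Lemma normal_equations m n (M : 'M[R]_(m, n)) (y : 'cV[R]_n) :
  exists a : 'cV[R]_m, M *m (y + M^T *m a) = 0.
Proof.
have kerM : (kermx (M *m M^T) <= kermx M)%MS.
  apply/row_subP => i; apply/sub_kermxP; set u := row i _.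
  have /sub_kermxP h : (u <= kermx (M *m M^T))%MS by exact: row_sub.
  apply: trmx_inj; rewrite trmx0; apply/eqP; rewrite -dotv_eq0 /dotv trmxK.
  by rewrite trmx_mul !mulmxA -(mulmxA u) h mul0mx mxE.
have sub : (y^T *m M^T <= M *m M^T)%MS.
  apply: submx_trans (submxMl _ _) _.
  rewrite -(mxrank_leqif_sup (submxMl M M^T)) eqn_leq mxrankS ?submxMl//=.
  rewrite mxrank_tr; have := mxrankS kerM; rewrite !mxrank_ker.
  by have := rank_leq_row M; have := rank_leq_row (M *m M^T); move: (\rank M) (\rank _) => a b ? ? ?; lia.
have [b e] := submxP sub.
exists (- b^T); rewrite mulmxDr mulmxN mulmxN mulmxA.
by have /(congr1 trmx) := e; rewrite !trmx_mul !trmxK => ->; rewrite subrr.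
Qed.

(** The residual of [y i] after projection on the span of the [y j] with [J j]. It is kept as a
    combination with coefficient 1 at [i] because the small-ball bounds concern combinations of
    columns. *)
Lemma exists_residual n p (y : 'I_p -> 'cV[R]_n) (J : pred 'I_p) i : ~~ J i ->
  exists a : 'I_p -> R, [/\ a i = 1, forall j, ~~ J j -> j != i -> a j = 0,
    forall j, J j -> dotv (\sum_l a l *: y l) (y j) = 0 &
    dotv (\sum_l a l *: y l) (y i) = dotv (\sum_l a l *: y l) (\sum_l a l *: y l)].
Proof.
move=> Ji; pose M : 'M[R]_(p, n) := \matrix_(j, l) (if J j then y j l 0 else 0).
have [b hb] := normal_equations M (y i).
pose a j := if j == i then 1 else if J j then b j 0 else 0.
have rE : \sum_l a l *: y l = y i + M^T *m b.
  rewrite (bigD1 i)//= /a eqxx scale1r; congr (_ + _).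
  apply/matrixP => k l; rewrite ord1 summxE mxE [RHS](bigD1 i)//= !mxE (negbTE Ji) mul0r add0r.
  apply: eq_bigr => j /negbTE ji; rewrite !mxE ji; case: (J j); last by rewrite !mul0r.
  exact: mulrC.
have orth j : J j -> dotv (\sum_l a l *: y l) (y j) = 0.
  move=> Jj; rewrite rE dotvC; have /matrixP/(_ j 0) := hb; rewrite !mxE => h.
  by rewrite -[RHS]h dotvE; apply: eq_bigr => l _; rewrite !mxE Jj.
exists a; split => //.
- by rewrite /a eqxx.
- by move=> j /negbTE Jj /negbTE ji; rewrite /a Jj ji.
rewrite [RHS]dotv_sumr [RHS](bigD1 i)//= [X in _ + X]big1 ?addr0 => [|j ji].
  by rewrite dotvZr /a eqxx mul1r.
rewrite dotvZr; case: (boolP (J j)) => Jj; first by rewrite orth ?mulr0.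
by rewrite /a (negbTE ji) (negbTE Jj) mul0r.
Qed.

End residual.

Section leverage.
Context {R : realType} {n p : nat}.
Variables (l : 'I_p -> R) (x : 'I_p -> 'cV[R]_n).
Hypothesis l0 : forall i, 0 < l i.

Definition gram : 'M[R]_n := \sum_i l i *: (x i *m (x i)^T).

Lemma gram_mul u : gram *m u = \sum_i (l i * dotv (x i) u) *: x i.
Proof.
rewrite /gram mulmx_suml; apply: eq_bigr => i _; rewrite -scalemxAl -mulmxA.
rewrite -scalerA; congr (_ *: _); apply/matrixP => a b.
by rewrite mxE big_ord1 [in RHS]mxE (ord1 b) mulrC.
Qed.

Lemma gram_form u v : dotv u (gram *m v) = \sum_i l i * dotv u (x i) * dotv (x i) v.
Proof.
rewrite gram_mul dotv_sumr; apply: eq_bigr => i _; rewrite dotvZr; ring.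
Qed.

Lemma gram_sqr u : dotv u (gram *m u) = \sum_i l i * dotv u (x i) ^+ 2.
Proof. by rewrite gram_form; apply: eq_bigr => i _; rewrite (dotvC (x i)); ring. Qed.

Lemma gram_sym : gram^T = gram.
Proof.
rewrite /gram linear_sum /=; apply: eq_bigr => i _.
by rewrite linearZ /= trmx_mul trmxK.
Qed.

Lemma gram_psd : possemidef gram.
Proof.
split; first exact: gram_sym.
by move=> u; rewrite gram_sqr sumr_ge0// => i _; rewrite mulr_ge0 ?sqr_ge0// ltW.
Qed.

Variables (S T : 'M[R]_n) (y : 'I_p -> 'cV[R]_n).
Hypotheses (sS : S^T = S) (ST : S *m T = 1%:M) (xE : forall i, x i = S *m y i).

Lemma dotv_white u i : dotv u (x i) = dotv (S *m u) (y i).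
Proof. by rewrite xE dotv_mulmx sS. Qed.

Lemma gram_unit (m : R) (J : pred 'I_p) : 0 < m ->
  (forall u, m * dotv u u <= \sum_(j | J j) l j * dotv u (y j) ^+ 2) ->
  gram \in unitmx.
Proof.
move=> m0 h; apply: posdef_unit; split; first exact: gram_sym.
move=> u u0; rewrite gram_sqr.
apply: (@lt_le_trans _ _ (\sum_(j | J j) l j * dotv u (x j) ^+ 2)); last first.
  rewrite [leRHS](bigID J)/= lerDl sumr_ge0// => i _.
  by rewrite mulr_ge0 ?sqr_ge0// ltW.
under eq_bigr do rewrite dotv_white.
apply: lt_le_trans (h _); rewrite mulr_gt0// dotv_gt0.
apply: contra_neq u0 => e.
have TS : T *m S = 1%:M by exact: mulmx1C.
by rewrite -[u]mul1mx -TS -mulmxA e mulmx0.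
Qed.

Variables (i : 'I_p) (K : R).
Hypotheses (gu : gram \in unitmx) (K0 : 0 < K) (yK : dotv (y i) (y i) <= K).
Let w := invmx gram *m x i.
Let t := dotv (x i) w.

Lemma leverageE : dotv w (gram *m w) = t.
Proof. by rewrite /w mulKVmx// dotvC. Qed.

Lemma leverage_le : t ^+ 2 <= dotv (S *m w) (S *m w) * K.
Proof.
rewrite /t dotvC dotv_white; apply: le_trans (cauchy_schwarz _ _) _.
by rewrite ler_wpM2l ?dotv_ge0.
Qed.

(** Evaluating the form of [gram] at [w] gives [t = l i * t^2 + q], where [q] collects the other
    columns. By hypothesis and [leverage_le], [q >= m * t^2 / K]; hence [t * (l i + m / K) <= 1].
    This replaces a rank-one inversion formula. *)
Lemma one_sub_leverage_ge (m : R) : 0 < m ->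
  (forall u, m * dotv u u <= \sum_(j | j != i) l j * dotv u (y j) ^+ 2) ->
  (1 + l i * K / m)^-1 <= 1 - l i * t.
Proof.
move=> m0 h.
have e := leverageE; rewrite gram_sqr (bigD1 i)//= [dotv w (x i)]dotvC -/t in e.
have : m * (t ^+ 2 / K) <= \sum_(j | j != i) l j * dotv w (x j) ^+ 2.
  under eq_bigr do rewrite dotv_white.
  apply: le_trans (h _); rewrite ler_wpM2l// ?(ltW m0)// ler_pdivrMr//.
  exact: leverage_le.
set q := \sum_(j | _) _ in e *; move=> hq.
have li := l0 i.
have tt : t ^+ 2 * (l i + m / K) <= t.
  rewrite -[leRHS]e; apply: le_trans (lerD (lexx _) hq).
  by rewrite le_eqVlt; apply/orP; left; apply/eqP; ring.
have mu0 : 0 < l i + m / K by rewrite addr_gt0// divr_gt0.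
have t0 : 0 <= t by apply: le_trans tt; rewrite mulr_ge0 ?sqr_ge0// ltW.
have t1 : t * (l i + m / K) <= 1.
  have [->|tn] := eqVneq t 0; first by rewrite mul0r ler01.
  have tp : 0 < t by rewrite lt_def tn.
  by rewrite -(ler_pM2l tp) mulr1 mulrA -expr2.
have -> : (1 + l i * K / m)^-1 = 1 - l i / (l i + m / K).
  field; rewrite !gt_eqF ?addr_gt0 ?mulr_gt0 //.
by rewrite lerD2l lerN2 ler_wpM2l ?(ltW li)// -[leRHS]mul1r ler_pdivlMr.
Qed.

(** By Cauchy-Schwarz for the form of [gram], [t] is at least [<x_i, v>^2 / <v, gram v>] for every
    test vector [v]. The choice [v = T *m r], with [r] the residual of [y i], removes all columns in
    [J] from the denominator, leaving column [i] and a tail controlled by [D]. *)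
Lemma leverage_ge (J : pred 'I_p) (rho D : R) : 0 < rho -> 0 <= D -> ~~ J i ->
  (forall a : 'I_p -> R, (forall j, ~~ J j -> j != i -> a j = 0) ->
    rho * \sum_j a j ^+ 2 <= dotv (\sum_j a j *: y j) (\sum_j a j *: y j)) ->
  (forall u, \sum_(j | ~~ J j && (j != i)) l j * dotv u (y j) ^+ 2 <= D * dotv u u) ->
  (1 + D / (l i * rho))^-1 <= l i * t.
Proof.
move=> rho0 D0 Ji hrho hD.
have [a [ai aJ orth re]] := exists_residual y Ji.
have rle := hrho a aJ.
set r := \sum_j _ in orth re rle.
have rr : rho <= dotv r r.
  apply: le_trans rle; rewrite (bigD1 i)//= ai expr1n ler_pMr// lerDl.
  by rewrite sumr_ge0// => j _; rewrite sqr_ge0.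
have rp : 0 < dotv r r by exact: lt_le_trans rr.
pose v := T *m r.
have Sv : S *m v = r by rewrite /v mulmxA ST mul1mx.
have vA : dotv v (gram *m v) <= l i * dotv r r ^+ 2 + D * dotv r r.
  rewrite gram_sqr (bigD1 i)//= dotv_white Sv re lerD2l.
  rewrite (bigID J)/= big1 => [|j /andP[_ Jj]]; last by rewrite dotv_white Sv orth// expr0n mulr0.
  rewrite add0r; apply: le_trans (hD r).
  by rewrite le_eqVlt (eq_bigl (fun j => ~~ J j && (j != i))) => [|j]; [apply/orP; left; apply/eqP/eq_bigr => j _; rewrite dotv_white Sv|rewrite andbC].
have cs := cauchy_schwarz_psd w v gram_psd.
have wv : dotv w (gram *m v) = dotv r r.
  rewrite dotv_mulmx gram_sym /w mulKVmx// dotvC dotv_white Sv re //.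
rewrite wv leverageE in cs.
have li := l0 i.
have t0 : 0 <= t by rewrite -leverageE; exact: gram_psd.2.
have h1 : dotv r r ^+ 2 <= t * (l i * dotv r r ^+ 2 + D * dotv r r).
  by apply: le_trans cs _; rewrite ler_wpM2l.
have h2 : dotv r r <= t * (l i * dotv r r + D).
  rewrite -(ler_pM2l rp) -expr2; apply: le_trans h1 _.
  by rewrite le_eqVlt; apply/orP; left; apply/eqP; ring.
have h3 : dotv r r / (l i * dotv r r + D) <= t.
  by rewrite ler_pdivrMr// ltr_wpDr// mulr_gt0.
apply: le_trans (ler_wpM2l (ltW li) h3).
have -> : l i * (dotv r r / (l i * dotv r r + D)) = (1 + D / (l i * dotv r r))^-1.
  field; rewrite !gt_eqF //= ?ltr_wpDr// mulr_gt0//.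
rewrite lef_pV2 ?posrE ?ltr_wpDr ?divr_ge0 ?mulr_ge0 ?(ltW li) ?(ltW rp) ?(ltW rho0)//.
by rewrite lerD2l ler_wpM2l// lef_pV2 ?posrE ?mulr_gt0// ler_pM2l.
Qed.

(** [leverage_le] bounds [t^2] by [K] times the [Xi0] form of [w], and the operator norm compares
    the [Xi0] form with the [Ups] form. *)
Lemma variance_term_ge (Xi0 Ups : 'M[R]_n) : S *m S = Xi0 -> posdef Xi0 -> posdef Ups ->
  (l i * t) ^+ 2 / (opnorm (invmx Ups *m Xi0) * K) <=
  l i ^+ 2 * dotv w (Ups *m w).
Proof.
move=> SS p0 pU.
have ka := le_opnorm_posdef w p0 pU.
(* Positivity of the operator norm is read off a nonzero vector, so [w = 0] is treated apart. *)
have [w0|w0] := eqVneq w 0.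
  by rewrite /t w0 !dotv0r mulr0 expr0n /= mul0r mulmx0 dotv0r mulr0.
have kp : 0 < opnorm (invmx Ups *m Xi0).
  by rewrite -(pmulr_lgt0 _ (pU.2 _ w0)); apply: lt_le_trans ka; exact: p0.2.
rewrite exprMn -mulrA ler_wpM2l ?sqr_ge0// ler_pdivrMr ?mulr_gt0//.
apply: le_trans leverage_le _.
have -> : dotv (S *m w) (S *m w) = dotv w (Xi0 *m w).
  by rewrite -SS -mulmxA (dotv_mulmx S w) sS.
by rewrite mulrA ler_wpM2r ?(ltW K0)// mulrC.
Qed.

End leverage.

(** * Integration and independence *)

Section measurable_big.
Context {R : realType} {d : measure_display} {T : measurableType d}.

Lemma measurable_bigprod (J : Type) (s : seq J) (p : pred J) (h : J -> T -> R) :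
  (forall j, p j -> measurable_fun setT (h j)) ->
  measurable_fun setT (fun w => \prod_(j <- s | p j) h j w).
Proof.
move=> mh; elim: s => [|j s IH].
  under eq_fun do rewrite big_nil.
  exact: measurable_cst.
under eq_fun do rewrite big_cons.
by have [pj|//] := boolP (p j); apply: measurable_funM => //; exact: mh.
Qed.

Lemma measurable_bigsum (J : Type) (s : seq J) (p : pred J) (h : J -> T -> R) :
  (forall j, p j -> measurable_fun setT (h j)) ->
  measurable_fun setT (fun w => \sum_(j <- s | p j) h j w).
Proof.
move=> mh; elim: s => [|j s IH].
  under eq_fun do rewrite big_nil.
  exact: measurable_cst.
under eq_fun do rewrite big_cons.
by have [pj|//] := boolP (p j); apply: measurable_funD => //; exact: mh.
Qed.

Lemma measurable_lt_set (f g : T -> R) : measurable_fun setT f ->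
  measurable_fun setT g -> measurable [set w | f w < g w].
Proof.
move=> mf mg; rewrite -[X in measurable X]setTI.
by apply: (measurable_fun_ltr mf mg measurableT (_ : measurable [set true])).
Qed.

End measurable_big.

Section layer_cake.
Context {R : realType} {d : measure_display} {T : measurableType d}.
Local Notation leb := (@lebesgue_measure R).

Definition subgraph (f : T -> R) : set (T * R) := [set z | (0 <= z.2) && (z.2 < f z.1)].

Lemma measurable_subgraph f : measurable_fun setT f -> measurable (subgraph f).
Proof.
move=> mf.
have -> : subgraph f = (fun z : T * R => (0 <= z.2) && (z.2 < f z.1)) @^-1` [set true] by [].
rewrite -[X in measurable X]setTI; apply: (_ : measurable_fun setT _) => //.
apply: measurable_and; first by apply: measurable_fun_ler.
by apply: measurable_fun_ltr => //; exact: measurableT_comp.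
Qed.

Section with_measure.
Variable mu : {sigma_finite_measure set T -> \bar R}.

Lemma integral_set_indic (A : set T) (f : T -> R) :
  (\int[mu]_(w in A) (f w)%:E = \int[mu]_w (f w * \1_A w)%:E)%E.
Proof.
rewrite integral_mkcond; apply: eq_integral => w _.
by rewrite /patch indicE; case: ifPn => _; rewrite ?mulr1 ?mulr0.
Qed.

Lemma integral_cst1 (A : set T) : measurable A ->
  (\int[mu]_(w in A) (cst (1 : R) w)%:E = mu A)%E.
Proof. by move=> mA; rewrite (integral_cst mu mA 1%E) mul1e. Qed.

Variables f G : T -> R.
Hypotheses (mf : measurable_fun setT f) (f0 : forall w, 0 <= f w).
Hypotheses (mG : measurable_fun setT G) (G0 : forall w, 0 <= G w).

Let g (z : T * R) := (G z.1 * \1_(subgraph f) z)%:E.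

Let mg : measurable_fun setT g.
Proof.
apply/measurable_EFinP; apply: measurable_funM; last first.
  by apply: measurable_indic; exact: measurable_subgraph.
exact: measurableT_comp.
Qed.

Let g0 z : (0 <= g z)%E.
Proof. by rewrite lee_fin mulr_ge0. Qed.

(** Tonelli on the region under the graph of [f]. The weight [G] stays arbitrary so that the same
    formula serves a density, an independent factor and the constant 1. *)
Lemma layer_cake : (\int[mu]_w (G w * f w)%:E =
  \int[leb]_t \int[mu]_w (G w * \1_(subgraph f) (w, t))%:E)%E.
Proof.
transitivity (\int[leb]_t \int[mu]_w g (w, t))%E; last by [].
rewrite -fubini_tonelli; [|exact: mg|exact: g0].
apply: eq_integral => w _; rewrite /g /=.
under eq_integral do rewrite EFinM.
rewrite ge0_integralZl//; last first.
- by rewrite lee_fin.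
- apply/measurable_EFinP; have := measurable_subgraph mf; move/measurable_indic => /(_ R setT) mi.
  exact: (measurableT_comp mi).
rewrite EFinM; congr (_ * _)%E.
have -> : (\int[leb]_t (\1_(subgraph f) (w, t))%:E = \int[leb]_t (\1_(`[0%R, f w[%classic) t)%:E)%E.
  by apply: eq_integral => t _; rewrite !indicE; congr (_%:R%:E).
rewrite integral_indic// setIT.
have e : leb `[0, f w[%classic = (f w)%:E.
  rewrite lebesgue_measure_itv /= lte_fin.
  by have := f0 w; rewrite le_eqVlt => /predU1P[<-|->]; rewrite ?ltxx// sube0.
exact: (esym e).
Qed.

Lemma measurable_layer : measurable_fun setT
  (fun t : R => (\int[mu]_w (G w * \1_(subgraph f) (w, t))%:E)%E).
Proof.
by apply: (@measurable_fun_fubini_tonelli_G _ _ _ _ _ mu g); do [exact: mg|exact: g0].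
Qed.

Lemma layer_ge0 t : (0 <= \int[mu]_w (G w * \1_(subgraph f) (w, t))%:E)%E.
Proof. by apply: integral_ge0 => w _; exact: (g0 (w, t)). Qed.

Lemma layer_lt0 t : t < 0 -> (\int[mu]_w (G w * \1_(subgraph f) (w, t))%:E = 0)%E.
Proof.
move=> t0; apply: integral0_eq => w _; rewrite indicE memNset ?mulr0//.
by rewrite /subgraph /= leNgt t0.
Qed.

Lemma layer_itv t : 0 <= t -> (\int[mu]_w (G w * \1_(subgraph f) (w, t))%:E =
  \int[mu]_(w in [set w | (t < f w)%R]) (G w)%:E)%E.
Proof.
move=> t0; rewrite integral_set_indic; apply: eq_integral => w _; rewrite !indicE; congr (_ * _%:R)%:E.
by congr nat_of_bool; apply/idP/idP; rewrite !inE /subgraph /= t0.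
Qed.

End with_measure.

(** After slicing both sides by level, only integrals over superlevel sets of [f] remain, where the
    density hypothesis on sets applies. *)
Lemma ge0_integral_density (mu nu : {sigma_finite_measure set T -> \bar R}) (p f : T -> R) :
  measurable_fun setT p -> (forall w, 0 <= p w) ->
  measurable_fun setT f -> (forall w, 0 <= f w) ->
  (forall A, measurable A -> nu A = \int[mu]_(w in A) (p w)%:E)%E ->
  (\int[nu]_w (f w)%:E = \int[mu]_w (p w * f w)%:E)%E.
Proof.
move=> mp p0 mf f0 nuE; rewrite layer_cake//.
under eq_integral do rewrite -[f _]mul1r.
rewrite (layer_cake nu mf f0 (@measurable_cst _ _ _ _ setT (1 : R)))//.
apply: eq_integral => t _; have [t0|t0] := leP 0 t; last by rewrite !layer_lt0.
have mA : measurable [set w | t < f w] by exact: measurable_lt_set.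
by rewrite !layer_itv// integral_cst1 ?nuE.
Qed.

End layer_cake.

Section indep_integral.
Context {R : realType} {d : measure_display} {T : measurableType d}.
Variable P : probability T R.

(* Layer-cake representation of f. *)
Lemma ge0_integralM_superlevel (F f : T -> R) (K : \bar R) :
  measurable_fun setT F -> measurable_fun setT f ->
  (forall w, 0 <= F w) -> (forall w, 0 <= f w) -> (0 <= K)%E ->
  (forall t, \int[P]_(w in [set w | (t < f w)%R]) (F w)%:E = K * P [set w | (t < f w)%R])%E ->
  (\int[P]_w (F w * f w)%:E = K * \int[P]_w (f w)%:E)%E.
Proof.
move=> mF mf F0 f0 K0 hK.
under [in RHS]eq_integral do rewrite -[f _]mul1r.
have m1 := @measurable_cst _ _ T _ setT (1 : R).
rewrite layer_cake// (layer_cake P mf f0 m1)//.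
rewrite -ge0_integralZl//; last 2 first.
- exact: (measurable_layer P mf m1).
- by move=> t _; exact: layer_ge0.
apply: eq_integral => t _; have [t0|t0] := leP 0 t; last by rewrite !layer_lt0// mule0.
have mA : measurable [set w | t < f w] by exact: measurable_lt_set.
by rewrite !layer_itv// hK integral_cst1.
Qed.

Definition meas_in (G : set (set T)) (f : T -> R) :=
  forall B : set R, measurable B -> G (f @^-1` B).

Variable I : finType.
Variable G : I -> set (set T).
Hypothesis GT : forall i A, G i A -> measurable A.
Hypothesis indepG : mutual_indep P G.

Lemma meas_in_measurable (H : set (set T)) f : (forall A, H A -> measurable A) ->
  meas_in H f -> measurable_fun setT f.
Proof. by move=> HT Hf _ B mB; rewrite setTI; apply: HT; exact: Hf. Qed.

(* Indicators are replaced by functions one index at a time. *)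
Lemma ge0_integral_prod_indep (f : I -> T -> R) :
  (forall i, meas_in (G i) (f i)) -> (forall i w, 0 <= f i w) ->
  (\int[P]_w (\prod_i f i w)%:E = \prod_i \int[P]_w (f i w)%:E)%E.
Proof.
move=> mf f0.
have intI A : measurable A -> (\int[P]_w (\1_A w)%:E = P A)%E.
  by move=> mA; rewrite integral_indic// setIT.
(* [s] lists the indices still carrying a general function; elsewhere there are indicators, so the
   empty list is the product rule for events. *)
suff H (s : seq I) : uniq s -> forall h : I -> T -> R,
   (forall i, if i \in s then meas_in (G i) (h i) /\ forall w, 0 <= h i w
     else exists2 A, G i A & h i = \1_A) ->
   (\int[P]_w (\prod_i h i w)%:E = \prod_i \int[P]_w (h i w)%:E)%E.
  by apply: (H (enum I)); [exact: enum_uniq|move=> i; rewrite mem_enum].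
elim: s => [_ h hh|i s IH /= /andP[is_ us] h hh].
  have /choice[A hA] : forall i, exists A, G i A /\ h i = \1_A.
    by move=> i; have [A ? ?] := hh i; exists A.
  rewrite (eq_bigr (fun i => P (A i))) => [|i _]; last first.
    by rewrite (hA i).2 intI//; apply: GT; exact: (hA i).1.
  rewrite -indepG => [|i]; last exact: (hA i).1.
  rewrite -intI; last first.
    apply: fin_bigcap_measurable => // i _; apply: GT; exact: (hA i).1.
  apply: eq_integral => w _; congr EFin.
  rewrite indicE; case: (boolP (w \in _)) => [|wA]; rewrite ?inE.
    move=> wA; rewrite big1// => i _; rewrite (hA i).2 indicE mem_set//; exact: wA.
  move: wA; rewrite notin_setE => /existsNP[i /not_implyP[_ nA]].
  by rewrite (bigD1 i)//= (hA i).2 indicE memNset// mul0r.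
have [mhi hi0] : meas_in (G i) (h i) /\ forall w, 0 <= h i w.
  by have := hh i; rewrite inE eqxx.
have mh j : measurable_fun setT (h j).
  have := hh j; case: ifP => _ [].
    by move=> + _; apply: meas_in_measurable; exact: GT.
  by move=> A /GT mA ->; exact: measurable_indic.
have h0 j w : 0 <= h j w.
  by have := hh j; case: ifP => _ [] // A _ ->; rewrite indicE.
under eq_integral do rewrite (bigD1 i)//= mulrC.
rewrite (bigD1 i)//= muleC.
apply: ge0_integralM_superlevel => //.
- exact: measurable_bigprod.
- by move=> w; rewrite prodr_ge0.
- by apply: prode_ge0 => j _; apply: integral_ge0 => w _; rewrite lee_fin.
move=> t; rewrite integral_set_indic.
set A := [set w | _].
have GA : G i A.
  have -> : A = h i @^-1` `]t, +oo[%classic by apply/seteqP; split => w; rewrite /A /= in_itv /= andbT.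
  exact: mhi.
pose h' j := if j == i then \1_A else h j.
transitivity (\int[P]_w (\prod_j h' j w)%:E)%E.
  apply: eq_integral => w _; rewrite [in RHS](bigD1 i)//= {1}/h' eqxx mulrC.
  by congr (_ * _)%:E; apply: eq_bigr => j /negbTE ji; rewrite /h' ji.
transitivity (\prod_j \int[P]_w (h' j w)%:E)%E; last first.
  rewrite (bigD1 i)//= {1}/h' eqxx intI; last exact: GT GA.
  by rewrite muleC; congr (_ * _)%E; apply: eq_bigr => j /negbTE ji; rewrite /h' ji.
apply: (IH us) => j; rewrite /h'; have := hh j; rewrite inE.
case: (eqVneq j i) => [->|ji] /=; last by [].
by rewrite (negbTE is_) => _; exists A.
Qed.

End indep_integral.

(** * Real-valued expectations and products of independent variables *)

Section expectation_L1.
Context {R : realType} {d : measure_display} {T : measurableType d}.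
Variable P : probability T R.

Definition L1 (f : T -> R) := P.-integrable setT (EFin \o f).
(** A real number, obtained by [fine], so an infinite integral would read as 0; this is why [L1]
    accompanies it. *)
Definition Ex (f : T -> R) : R := \int[P]_w f w.

Lemma L1_measurable f : L1 f -> measurable_fun setT f.
Proof. by move=> /measurable_int/measurable_EFinP. Qed.

Lemma ExE f : L1 f -> (\int[P]_w (f w)%:E = (Ex f)%:E)%E.
Proof. by move=> h; rewrite fineK//; exact: integrable_fin_num. Qed.

Lemma L1_le (f g : T -> R) : measurable_fun setT f -> (forall w, `|f w| <= g w) ->
  L1 g -> L1 f.
Proof.
move=> mf fg; apply: le_integrable => //; first exact/measurable_EFinP.
move=> w _ /=; rewrite lee_fin; apply: le_trans (fg w) _; exact: ler_norm.
Qed.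

Lemma L1_cst c : L1 (fun=> c).
Proof. exact: finite_measure_integrable_cst. Qed.

Lemma L1_bounded (f : T -> R) c : measurable_fun setT f -> (forall w, `|f w| <= c) -> L1 f.
Proof. by move=> mf fc; exact: (L1_le mf fc (L1_cst c)). Qed.

Lemma L1D f g : L1 f -> L1 g -> L1 (fun w => f w + g w).
Proof. by move=> hf hg; have := integrableD measurableT hf hg. Qed.

Lemma L1Z c f : L1 f -> L1 (fun w => c * f w).
Proof. by move=> hf; have := @integrableZl _ _ _ P setT measurableT c _ hf. Qed.

Lemma L1_sum (I : Type) (s : seq I) (p : pred I) (f : I -> T -> R) :
  (forall i, p i -> L1 (f i)) -> L1 (fun w => \sum_(i <- s | p i) f i w).
Proof.
move=> hf; elim: s => [|i s IH].
  under eq_fun do rewrite big_nil; exact: L1_cst.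
under eq_fun do rewrite big_cons.
by have [pi|//] := boolP (p i); apply: L1D => //; exact: hf.
Qed.

Lemma L1_abs f : L1 f -> L1 (fun w => `|f w|).
Proof.
exact: integrable_norm.
Qed.

Lemma ExD f g : L1 f -> L1 g -> Ex (fun w => f w + g w) = Ex f + Ex g.
Proof. by move=> hf hg; rewrite /Ex RintegralD. Qed.

Lemma ExZ c f : L1 f -> Ex (fun w => c * f w) = c * Ex f.
Proof. by move=> hf; rewrite /Ex RintegralZl. Qed.

Lemma Ex_cst c : Ex (fun=> c) = c.
Proof.
by rewrite /Ex Rintegral_cst//= (@probability_setT _ _ _ P) /= mulr1.
Qed.

Lemma eq_Ex f g : f =1 g -> Ex f = Ex g.
Proof. by move=> h; congr Ex; exact/funext. Qed.

Lemma le_Ex f g : L1 f -> L1 g -> (forall w, f w <= g w) -> Ex f <= Ex g.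
Proof. by move=> hf hg h; exact: le_Rintegral. Qed.

Lemma Ex_sum (I : Type) (s : seq I) (p : pred I) (f : I -> T -> R) :
  (forall i, p i -> L1 (f i)) ->
  Ex (fun w => \sum_(i <- s | p i) f i w) = \sum_(i <- s | p i) Ex (f i).
Proof.
move=> hf; elim: s => [|i s IH].
  by under eq_Ex do rewrite big_nil; rewrite big_nil Ex_cst.
under eq_Ex do rewrite big_cons; rewrite big_cons.
have [pi|//] := boolP (p i); rewrite ExD ?IH//; first exact: hf.
exact: L1_sum.
Qed.

Lemma Ex_indic A : measurable A -> Ex (\1_A) = fine (P A).
Proof. by move=> mA; rewrite /Ex /Rintegral integral_indic// setIT. Qed.

Lemma L1_indic A : measurable A -> L1 (\1_A).
Proof.
move=> mA; apply: (@L1_bounded _ 1) => [|w]; first exact: measurable_indic.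
by rewrite indicE; case: (_ \in _); rewrite ?normr1// normr0.
Qed.

Lemma ExB f g : L1 f -> L1 g -> Ex (fun w => f w - g w) = Ex f - Ex g.
Proof. by move=> hf hg; rewrite /Ex RintegralB. Qed.

Lemma L1N f : L1 f -> L1 (fun w => - f w).
Proof. by move=> hf; under eq_fun do rewrite -mulN1r; exact: L1Z. Qed.

Lemma L1B f g : L1 f -> L1 g -> L1 (fun w => f w - g w).
Proof. by move=> hf hg; apply: L1D => //; exact: L1N. Qed.

Section indep_product.
Variables (G H : set (set T)).
Hypotheses (GT : forall A, G A -> measurable A) (HT : forall A, H A -> measurable A).
Hypothesis GH : indep2 P G H.

(** The superlevel lemma is applied twice: first to [h], which leaves an indicator, then to [f]
    against that indicator. *)
Lemma ge0_integralM_indep2 (f h : T -> R) : meas_in G f -> meas_in H h ->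
  (forall w, 0 <= f w) -> (forall w, 0 <= h w) ->
  (\int[P]_w (f w * h w)%:E = \int[P]_w (f w)%:E * \int[P]_w (h w)%:E)%E.
Proof.
move=> Gf Hh f0 h0.
have mf : measurable_fun setT f by apply: meas_in_measurable Gf.
have mh : measurable_fun setT h by apply: meas_in_measurable Hh.
have lev (q : T -> R) Q t : meas_in Q q -> Q [set w | t < q w].
  move=> mq; rewrite (_ : [set w | _] = q @^-1` `]t, +oo[%classic); first exact: mq.
  by apply/seteqP; split => w; rewrite /= in_itv /= andbT.
apply: ge0_integralM_superlevel => // [|t]; first by apply: integral_ge0 => w _; rewrite lee_fin.
rewrite integral_set_indic; set A := [set w | _].
have HA : H A by exact: lev.
under eq_integral do rewrite mulrC.
rewrite muleC -[X in (X * _)%E](_ : \int[P]_w (\1_A w)%:E = _)%E; last first.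
  by rewrite integral_indic ?setIT//; exact: HT.
apply: ge0_integralM_superlevel => //.
- by apply: measurable_indic; exact: HT.
- by apply: integral_ge0 => w _; rewrite lee_fin.
move=> s; have mA : measurable A by exact: HT.
have mB : measurable [set w | s < f w] by exact: measurable_lt_set.
rewrite [LHS]integral_indic// setIC; apply: etrans (GH (lev _ _ _ Gf) HA) _.
by rewrite muleC integral_indic ?setIT.
Qed.

Let pos (q : T -> R) w := Num.max (q w) 0.
Let neg (q : T -> R) w := Num.max (- q w) 0.

(** Independence replaces square integrability: the absolute values are independent, so the integral
    of their product factors into finite ones. *)
Lemma L1M_indep2 f h : meas_in G f -> meas_in H h -> L1 f -> L1 h ->
  L1 (fun w => f w * h w).
Proof.
move=> Gf Hh Lf Lh; apply/integrableP; split.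
  by apply/measurable_EFinP/measurable_funM; exact: L1_measurable.
have gabs (q : T -> R) Q : meas_in Q q -> meas_in Q (fun w => `|q w|).
  move=> mq B mB; apply: (mq (Num.norm @^-1` B)).
  by rewrite -[X in measurable X]setTI; exact: (@normr_measurable R setT).
under eq_integral do rewrite /= normrM.
rewrite ge0_integralM_indep2 => [||||w]; [|exact: gabs|exact: gabs|by []|by []].
by rewrite !ExE -?EFinM ?ltry//; exact: L1_abs.
Qed.

Lemma ExM_indep2 f h : meas_in G f -> meas_in H h -> L1 f -> L1 h ->
  Ex (fun w => f w * h w) = Ex f * Ex h.
Proof.
have mpos (q : T -> R) Q : meas_in Q q -> meas_in Q (pos q).
  move=> mq B mB; apply: (mq ((fun x => Num.max x 0) @^-1` B)).
  rewrite -[X in measurable X]setTI.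
  by apply: (_ : measurable_fun setT _) => //; apply: measurable_maxr.
have mneg (q : T -> R) Q : meas_in Q q -> meas_in Q (neg q).
  move=> mq B mB; apply: (mq ((fun x => Num.max (- x) 0) @^-1` B)).
  rewrite -[X in measurable X]setTI.
  apply: (_ : measurable_fun setT _) => //; exact: measurable_maxr.
have p0 q w : 0 <= pos q w by rewrite le_max lexx orbT.
have n0 q w : 0 <= neg q w by rewrite le_max lexx orbT.
have E q w : q w = pos q w - neg q w.
  by rewrite /pos /neg /Num.max; case: ltP => ?; case: ltP => ?; lra.
have Lp q : L1 q -> L1 (pos q).
  move=> hq; apply: L1_le (L1_abs hq).
    by apply: measurable_maxr => //; exact: L1_measurable.
  move=> w; rewrite ger0_norm// /pos ge_max normr_ge0 andbT; exact: ler_norm.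
have Ln q : L1 q -> L1 (neg q).
  move=> hq; apply: L1_le (L1_abs hq).
    by apply: measurable_maxr => //; apply: measurableT_comp => //; exact: L1_measurable.
  by move=> w; rewrite ger0_norm// /neg ge_max normr_ge0 andbT -normrN ler_norm.
have base (f' h' : T -> R) : meas_in G f' -> meas_in H h' -> L1 f' -> L1 h' ->
  (forall w, 0 <= f' w) -> (forall w, 0 <= h' w) ->
  Ex (fun w => f' w * h' w) = Ex f' * Ex h'.
  move=> Gf Hh Lf Lh f0 h0; apply: EFin_inj; rewrite EFinM -!ExE//; last exact: L1M_indep2.
  exact: ge0_integralM_indep2.
move=> Gf Hh Lf Lh.
have [Lpf Lnf] := (Lp _ Lf, Ln _ Lf); have [Lph Lnh] := (Lp _ Lh, Ln _ Lh).
have [Gpf Gnf] := (mpos _ _ Gf, mneg _ _ Gf); have [Hph Hnh] := (mpos _ _ Hh, mneg _ _ Hh).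
have -> : Ex f = Ex (pos f) - Ex (neg f) by rewrite -ExB//; apply: eq_Ex => w; exact: E.
have -> : Ex h = Ex (pos h) - Ex (neg h) by rewrite -ExB//; apply: eq_Ex => w; exact: E.
transitivity (Ex (fun w => (pos f w * pos h w - pos f w * neg h w) - (neg f w * pos h w - neg f w * neg h w))).
  by apply: eq_Ex => w; rewrite (E f) (E h); ring.
rewrite !ExB ?base//; first (by ring); do ?[apply: L1B]; exact: L1M_indep2.
Qed.

End indep_product.
End expectation_L1.

(** * One-dimensional Gaussian laws *)

Section law.
Context {R : realType} {d : measure_display} {T : measurableType d}.

Lemma integral_law (P : {measure set T -> \bar R}) (m : {measure set (measurableTypeR R) -> \bar R}) (X : T -> R) (f : R -> R) :
  measurable_fun setT X -> measurable_fun setT f ->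
  (forall B : set R, measurable B -> P (X @^-1` B) = m B) ->
  (\int[P]_w (f (X w))%:E = \int[m]_x (f x)%:E)%E.
Proof.
move=> mX mf hm.
have h (g : R -> R) : measurable_fun setT g -> (forall x, 0 <= g x) ->
    (\int[P]_w (g (X w))%:E = \int[m]_x (g x)%:E)%E.
  move=> mg g0.
  have := @ge0_integral_pushforward _ _ T (measurableTypeR R) R X mX P setT (EFin \o g) measurableT.
  move=> <- //.
  - by apply: eq_measure_integral => //= A mA _; exact: hm.
  - exact/measurable_EFinP.
  - by move=> x _; rewrite lee_fin.
rewrite integralE [RHS]integralE; congr (_ - _)%E.
  transitivity (\int[P]_w ((Num.max (f (X w)) 0)%:E))%E.
    by apply: eq_integral => x _; rewrite funeposE /= EFin_max.
  rewrite (h (fun x => Num.max (f x) 0)).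
  - by apply: eq_integral => x _; rewrite funeposE /= EFin_max.
  - by apply: measurable_maxr.
  - by move=> x; rewrite le_max lexx orbT.
transitivity (\int[P]_w ((Num.max (- f (X w)) 0)%:E))%E.
  by apply: eq_integral => x _; rewrite funenegE /= EFin_max.
rewrite (h (fun x => Num.max (- f x) 0)).
- by apply: eq_integral => x _; rewrite funenegE /= EFin_max.
- by apply: measurable_maxr => //; exact: measurableT_comp.
- by move=> x; rewrite le_max lexx orbT.
Qed.

End law.

Section gaussian1.
Context {R : realType}.
Local Notation leb := (@lebesgue_measure R).

(** The fundamental theorem on [[-n, n]] leaves boundary terms of size at most [2 C / n], and
    dominated convergence passes to the line. The Gaussian integrations by parts rest on this. *)
Lemma integral_derivative_eq0 (F f : R -> R) (C : R) :
  (forall x : R, is_derive x (1 : R) F (f x)) -> continuous f ->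
  leb.-integrable setT (EFin \o f) -> (forall x, `|x| * `|F x| <= C) ->
  \int[leb]_x f x = 0.
Proof.
move=> dF cf intf FC.
have mf : measurable_fun setT f by exact: continuous_measurable_fun.
pose f_ n (x : R) := ((f \_ (`[- n%:R, n%:R]%classic : set R)) x)%:E.
have cvg1 : (\int[leb]_x f_ n x)%E @[n --> \oo] --> (\int[leb]_x (f x)%:E)%E.
  have dom := @dominated_cvg _ _ _ leb setT measurableT f_ (EFin \o f) (fun x => (`|f x|)%:E).
  apply: dom => //.
  - move=> n; apply/measurable_EFinP; apply/(measurable_restrictT _ _).1 => //.
    exact: measurable_funTS.
  - move=> x _; apply: cvg_near_cst; near=> n.
    rewrite /f_ /= patchE mem_set// /= in_itv /= -ler_norml.
    by near: n; exact: nbhs_infty_ger.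
  - exact: integrable_norm.
  - move=> n x _; rewrite /f_ /= lee_fin patchE; case: ifP => // _.
    by rewrite normr0.
have e n : (0 < n)%N -> (\int[leb]_x f_ n x)%E = (F n%:R - F (- n%:R))%:E.
  move=> n0.
  have nn : - n%:R < n%:R :> R by rewrite gtrN ?ltr0n.
  rewrite EFinB -(@continuous_FTC2 _ f F _ _ nn).
  - rewrite [RHS]integral_mkcond; apply: eq_integral => x _.
    by rewrite /f_ /= !patchE; case: ifP.
  - exact: continuous_subspaceT.
  - split.
    + by move=> x _; apply: ex_derive.
    + apply: cvg_at_right_filter; apply: differentiable_continuous.
      by apply/derivable1_diffP; exact: ex_derive.
    + apply: cvg_at_left_filter; apply: differentiable_continuous.
      by apply/derivable1_diffP; exact: ex_derive.
  - by move=> x _; rewrite derive1E; apply: derive_val.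
have cvg2 : (\int[leb]_x f_ n x)%E @[n --> \oo] --> (0 : R)%:E.
  apply: cvg_trans (_ : (F n%:R - F (- n%:R))%:E @[n --> \oo] --> _); first last.
    apply: cvg_EFin; first by near=> n.
    apply/cvgrPdist_le => e0 e0p; near=> n.
    have n0 : 0 < n%:R :> R by rewrite ltr0n; near: n; exact: nbhs_infty_gt.
    rewrite /= sub0r normrN; apply: le_trans (ler_normB _ _) _.
    have h1 := FC n%:R; have h2 := FC (- n%:R).
    rewrite normrN in h2; rewrite (ger0_norm (ltW n0)) in h1 h2.
    rewrite -(ler_pM2l n0) mulrDr; apply: le_trans (lerD h1 h2) _.
    rewrite -ler_pdivrMr//; near: n; exact: nbhs_infty_ger.
  apply: near_eq_cvg; near=> n; rewrite e//.
  by near: n; exact: nbhs_infty_gt.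
rewrite /Rintegral.
by have -> : (\int[leb]_x (f x)%:E = 0)%E by apply: (cvg_unique _ cvg1 cvg2).
Unshelve. all: end_near.
Qed.

Lemma symmetric_lebesgue (f : R -> R) : measurable_fun setT f ->
  \int[leb]_x f (- x) = \int[leb]_x f x.
Proof.
move=> mf; have mN : measurable_fun setT (-%R : measurableTypeR R -> measurableTypeR R) by [].
rewrite /Rintegral; congr fine.
apply: (@integral_law _ _ (measurableTypeR R) leb leb -%R f mN mf) => B mB.
exact: lebesgue_measureN.
Qed.

Section with_sd.
Variable s : R.
Hypothesis s0 : 0 < s.
Local Notation N := (normal_prob 0 s : probability _ R).

Lemma ge0_integral_normal (f : R -> R) : measurable_fun setT f -> (forall x, 0 <= f x) ->
  (\int[N]_x (f x)%:E = \int[leb]_x (normal_pdf 0 s x * f x)%:E)%E.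
Proof.
move=> mf f0; apply: (@ge0_integral_density R _ _ leb N) => //.
- exact: measurable_normal_pdf.
- by move=> x; exact: normal_pdf_ge0.
Qed.

Lemma L1_normal (f : R -> R) : L1 N f ->
  leb.-integrable setT (EFin \o (fun x => normal_pdf 0 s x * f x)).
Proof.
move=> hf; have mf := L1_measurable hf.
have mp := measurable_normal_pdf (0 : R) s.
apply/integrableP; split; first by apply/measurable_EFinP/measurable_funM.
have /integrableP[_] := L1_abs hf.
under eq_integral do rewrite /= normr_id.
rewrite ge0_integral_normal => [|//|//]; last exact: measurableT_comp.
congr (_ < _)%E; apply: eq_integral => x _.
by rewrite /= normrM (ger0_norm (normal_pdf_ge0 _ _ _)).
Qed.

Lemma Ex_normal (f : R -> R) : measurable_fun setT f ->
  Ex N f = \int[leb]_x (normal_pdf 0 s x * f x).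
Proof.
move=> mf; rewrite /Ex /Rintegral integralE [in RHS]integralE; congr (fine (_ - _)%E).
  transitivity (\int[N]_x ((Num.max (f x) 0)%:E))%E.
    by apply: eq_integral => x _; rewrite funeposE /= EFin_max.
  rewrite ge0_integral_normal.
  - apply: eq_integral => x _; rewrite funeposE /= -EFin_max.
    by rewrite maxr_pMr ?mulr0// normal_pdf_ge0.
  - by apply: measurable_maxr.
  - by move=> x; rewrite le_max lexx orbT.
transitivity (\int[N]_x ((Num.max (- f x) 0)%:E))%E.
  by apply: eq_integral => x _; rewrite funenegE /= EFin_max.
rewrite ge0_integral_normal.
- apply: eq_integral => x _; rewrite funenegE /= -EFin_max.
  by rewrite maxr_pMr ?mulr0 ?mulrN// normal_pdf_ge0.
- by apply: measurable_maxr => //; exact: measurableT_comp.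
- by move=> x; rewrite le_max lexx orbT.
Qed.

(** The exponential only rescales the density: with [a] the quantity assumed positive, the product
    is [(Num.sqrt a)^-1] times the density of standard deviation [s / Num.sqrt a]. Positive [c]
    serves upper tails and negative [c] lower tails. *)
Lemma normal_mgf_sqr (c : R) : 0 < 1 - 2 * c * s ^+ 2 ->
  (\int[N]_x (expR (c * x ^+ 2))%:E = ((Num.sqrt (1 - 2 * c * s ^+ 2))^-1)%:E)%E.
Proof.
set a := 1 - _ => a0.
have me : measurable_fun setT (fun x : R => expR (c * x ^+ 2)).
  by apply: measurableT_comp => //; apply: measurable_funM => //; exact: measurable_funX.
rewrite ge0_integral_normal => [|//|x]; last exact: expR_ge0.
pose s' := s / Num.sqrt a.
have sa0 : 0 < Num.sqrt a by rewrite sqrtr_gt0.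
have s'0 : 0 < s' by rewrite divr_gt0.
have s'2 : s' ^+ 2 = s ^+ 2 / a by rewrite expr_div_n sqr_sqrtr// ltW.
have aE : a = 1 - 2 * c * s ^+ 2 by [].
clearbody s' a.
have E x : normal_pdf 0 s x * expR (c * x ^+ 2) = (Num.sqrt a)^-1 * normal_pdf 0 s' x.
  rewrite !normal_pdfE ?gt_eqF// mulrA.
  have -> : normal_peak s = (Num.sqrt a)^-1 * normal_peak s'.
    rewrite /normal_peak -invfM; congr (_^-1).
    rewrite -sqrtrM ?(ltW a0)//; congr Num.sqrt.
    have -> : s ^+ 2 = a * s' ^+ 2 by rewrite s'2 mulrC divfK ?gt_eqF.
    by rewrite -!mulrnAr !mulrA.
  rewrite -[LHS]mulrA; congr (_ * _); rewrite /normal_fun -expRD; congr expR.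
  have q0 : s ^+ 2 != 0 by rewrite expf_neq0// gt_eqF.
  have an0 : 1 - 2 * c * s ^+ 2 != 0 by rewrite -aE gt_eqF.
  rewrite !subr0 s'2 aE; move: (s ^+ 2) (x ^+ 2) q0 an0 => q y q0 an0; field.
  by rewrite q0 an0.
under eq_integral do rewrite E EFinM.
rewrite ge0_integralZl//.
- by rewrite integral_normal_pdf mule1.
- by apply/measurable_EFinP; exact: measurable_normal_pdf.
- by move=> x _; rewrite lee_fin normal_pdf_ge0.
Qed.

Lemma L1_normal_sqr : L1 N (fun x => x ^+ 2).
Proof.
(* This makes [1 - 2 * c * s ^+ 2] equal to one half, so [expR (c * x ^+ 2)] is an integrable
   majorant up to a factor. *)
pose c := (4 * s ^+ 2)^-1.
have c0 : 0 < c by rewrite invr_gt0 mulr_gt0 ?exprn_gt0.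
apply: (@L1_le R _ (measurableTypeR R) N _ (fun x : R => c^-1 * expR (c * x ^+ 2))).
- exact: measurable_funX.
- move=> x; rewrite ger0_norm ?sqr_ge0// mulrC ler_pdivlMr// mulrC.
  by apply: le_trans (expR_ge1Dx _); rewrite lerDr.
- apply: L1Z; apply/integrableP; split.
    apply/measurable_EFinP; apply: measurableT_comp => //.
    by apply: measurable_funM => //; exact: measurable_funX.
  under eq_integral do rewrite /= ger0_norm ?expR_ge0//.
  rewrite normal_mgf_sqr ?ltry//.
  have -> : 1 - 2 * c * s ^+ 2 = 1 / 2 by rewrite /c; field; rewrite gt_eqF.
  by lra.
Qed.

Lemma L1_normal_id : L1 N (fun x => x).
Proof.
apply: (@L1_le R _ (measurableTypeR R) N _ (fun x : R => 1 + x ^+ 2)) => //.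
  move=> x; have := sqr_ge0 (`|x| - 1); rewrite -(real_normK (num_real x)).
  have := normr_ge0 x; move: (`|x|) => y; nra.
apply: L1D; [exact: L1_cst|exact: L1_normal_sqr].
Qed.

Lemma is_derive_normal_pdf (x : R) :
  is_derive x (1 : R) (normal_pdf 0 s) (- (x / s ^+ 2) * normal_pdf 0 s x).
Proof.
have -> : normal_pdf 0 s = (fun x => normal_peak s * expR (- (s ^+ 2 *+ 2)^-1 * x ^+ 2)).
  rewrite normal_pdfE ?gt_eqF//; apply/funext => y; rewrite /normal_fun subr0.
  by congr (_ * expR _); rewrite mulNr mulrC mulNr.
apply: is_derive_eq; rewrite /GRing.scale /=.
set e := expR _; set k := normal_peak s.
have h : (s ^+ 2 *+ 2)^-1 * (x * 1 + x * 1) = x / s ^+ 2.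
  have q0 : s ^+ 2 != 0 by rewrite expf_neq0// gt_eqF.
  rewrite mulr1; move: (s ^+ 2) q0 => q q0; field.
  exact: q0.
by rewrite mulNr h; ring.
Qed.

(** Supplies the decay hypothesis of [integral_derivative_eq0]; it follows from [expR y >= y]. *)
Lemma sqr_normal_pdf_le (x : R) : x ^+ 2 * normal_pdf 0 s x <= 2 * s ^+ 2 * normal_peak s.
Proof.
rewrite normal_pdfE ?gt_eqF// mulrCA mulrC ler_wpM2r ?normal_peak_ge0//.
have q0 : 0 < s ^+ 2 by rewrite exprn_gt0.
rewrite /normal_fun subr0 mulNr expRN ler_pdivrMr ?expR_gt0//.
have -> : x ^+ 2 / (s ^+ 2 *+ 2) = (2 * s ^+ 2)^-1 * x ^+ 2.
  by rewrite mulrC -mulr_natl.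
rewrite -ler_pdivrMl ?mulr_gt0//.
by apply: le_trans (expR_ge1Dx _); rewrite lerDr.
Qed.

Lemma integral_pdf1 : \int[leb]_x normal_pdf 0 s x = 1.
Proof. by rewrite /Rintegral integral_normal_pdf. Qed.

Lemma continuous_pdf : continuous (normal_pdf 0 s : R -> R).
Proof. by apply: continuous_normal_pdf; rewrite gt_eqF. Qed.

(* Integrate the derivative of x |-> x * pdf x. *)
Lemma normal_moment2 : Ex N (fun x => x ^+ 2) = s ^+ 2.
Proof.
have q0 : 0 < s ^+ 2 by rewrite exprn_gt0.
have m2 : measurable_fun setT (fun x : R => x ^+ 2) by exact: measurable_funX.
have L0 := integrable_normal_pdf (0 : R) s.
have L2 := L1_normal L1_normal_sqr.
have L2' : leb.-integrable setT (EFin \o (fun x : R => (s ^+ 2)^-1 * (normal_pdf 0 s x * x ^+ 2))).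
  exact: (@integrableZl _ _ _ leb setT measurableT (s ^+ 2)^-1 _ L2).
have := @integral_derivative_eq0 (fun x => x * normal_pdf 0 s x)
  (fun x => normal_pdf 0 s x - (s ^+ 2)^-1 * (normal_pdf 0 s x * x ^+ 2)) (2 * s ^+ 2 * normal_peak s).
rewrite RintegralB// RintegralZl// integral_pdf1 -Ex_normal// => h.
suff : 1 - (s ^+ 2)^-1 * Ex N (fun x => x ^+ 2) = 0.
  move/eqP; rewrite subr_eq0 => /eqP/(congr1 (fun y => s ^+ 2 * y)).
  by rewrite mulr1 mulrA divff ?gt_eqF// mul1r.
apply: h.
- move=> x; have d := is_derive_normal_pdf x.
  apply: is_derive_eq; rewrite /GRing.scale /= mulr1.
  by move: (normal_pdf 0 s x) (s ^+ 2)^-1 => a b; ring.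
- move=> x; apply: cvgB; first exact: continuous_pdf.
  apply: cvgM; first exact: cvg_cst.
  by apply: cvgM; [exact: continuous_pdf|exact: exprn_continuous].
- exact: (integrableB measurableT L0 L2').
- move=> x; rewrite normrM (ger0_norm (normal_pdf_ge0 _ _ _)) mulrA -expr2 real_normK ?num_real//.
  exact: sqr_normal_pdf_le.
Qed.

Lemma normal_pdf_sym (x : R) : normal_pdf 0 s (- x) = normal_pdf 0 s x.
Proof. by rewrite normal_pdfE ?gt_eqF// /normal_fun !subr0 sqrrN. Qed.

Lemma normal_odd (f : R -> R) : L1 N f -> (forall x, f (- x) = - f x) ->
  Ex N f = 0.
Proof.
move=> Lf fodd; have mf := L1_measurable Lf; rewrite Ex_normal//.
have Lg := L1_normal Lf.
have mg : measurable_fun setT (fun x => normal_pdf 0 s x * f x).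
  by apply: measurable_funM => //; exact: measurable_normal_pdf.
have := symmetric_lebesgue mg.
under [in X in X = _ -> _]eq_Rintegral do rewrite normal_pdf_sym fodd mulrN -mulN1r.
rewrite (RintegralZl _ measurableT Lg) mulN1r; lra.
Qed.

Lemma continuous_sinM (t : R) : continuous (fun x : R => sin (t * x)).
Proof.
move=> x; have ct : {for x, continuous (fun y : R => t * y)}.
  by apply: cvgM; [exact: cvg_cst|exact: cvg_id].
have c := @continuous_comp _ _ _ (fun y : R => t * y) sin x ct (@continuous_sin R _).
exact: c.
Qed.

Lemma continuous_cosM (t : R) : continuous (fun x : R => cos (t * x)).
Proof.
move=> x; have ct : {for x, continuous (fun y : R => t * y)}.
  by apply: cvgM; [exact: cvg_cst|exact: cvg_id].
have c := @continuous_comp _ _ _ (fun y : R => t * y) cos x ct (@continuous_cos R _).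
exact: c.
Qed.

Lemma measurable_sinM (t : R) : measurable_fun setT (fun x : R => sin (t * x)).
Proof. by apply: continuous_measurable_fun; exact: continuous_sinM. Qed.

Lemma measurable_cosM (t : R) : measurable_fun setT (fun x : R => cos (t * x)).
Proof. by apply: continuous_measurable_fun; exact: continuous_cosM. Qed.

Lemma normal_mean : Ex N (fun x => x) = 0.
Proof. by apply: normal_odd => //; exact: L1_normal_id. Qed.

Lemma L1_sinM t : L1 N (fun x => sin (t * x)).
Proof. by apply: (@L1_bounded R _ (measurableTypeR R) N _ 1); [exact: measurable_sinM|move=> x; exact: sin_max]. Qed.

Lemma L1_cosM t : L1 N (fun x => cos (t * x)).
Proof. by apply: (@L1_bounded R _ (measurableTypeR R) N _ 1); [exact: measurable_cosM|move=> x; exact: cos_max]. Qed.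

Lemma normal_sin t : Ex N (fun x => sin (t * x)) = 0.
Proof. by apply: normal_odd => [|x]; [exact: L1_sinM|rewrite mulrN sinN]. Qed.

Lemma L1_id_sin t : L1 N (fun x => x * sin (t * x)).
Proof.
apply: (@L1_le R _ (measurableTypeR R) N _ (fun x : R => `|x|)); last exact: L1_abs L1_normal_id.
  by apply: measurable_funM => //; exact: measurable_sinM.
by move=> x; rewrite normrM ler_piMr// sin_max.
Qed.

(** Stein's identity for the function [sin (t * x)]: integrate the derivative of its product with
    the density. *)
Lemma normal_cos_ibp t : Ex N (fun x => x * sin (t * x)) = s ^+ 2 * t * Ex N (fun x => cos (t * x)).
Proof.
have q0 : 0 < s ^+ 2 by rewrite exprn_gt0.
have Lc := L1_normal (L1_cosM t); have Ls := L1_normal (L1_id_sin t).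
have Lc' : leb.-integrable setT (EFin \o (fun x : R => t * (normal_pdf 0 s x * cos (t * x)))).
  exact: (@integrableZl _ _ _ leb setT measurableT t _ Lc).
have Ls' : leb.-integrable setT (EFin \o (fun x : R => (s ^+ 2)^-1 * (normal_pdf 0 s x * (x * sin (t * x))))).
  exact: (@integrableZl _ _ _ leb setT measurableT (s ^+ 2)^-1 _ Ls).
have := @integral_derivative_eq0 (fun x => sin (t * x) * normal_pdf 0 s x)
  (fun x => t * (normal_pdf 0 s x * cos (t * x)) - (s ^+ 2)^-1 * (normal_pdf 0 s x * (x * sin (t * x))))
  (normal_peak s + 2 * s ^+ 2 * normal_peak s).
rewrite RintegralB// !RintegralZl// -!Ex_normal//; last 2 first.
- by apply: measurable_funM => //; exact: measurable_sinM.
- exact: measurable_cosM.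
move=> h.
suff : t * Ex N (fun x => cos (t * x)) - (s ^+ 2)^-1 * Ex N (fun x => x * sin (t * x)) = 0.
  move/eqP; rewrite subr_eq0 => /eqP/(congr1 (fun y => s ^+ 2 * y)).
  by rewrite [in X in _ = X -> _]mulrA divff ?gt_eqF// mul1r => <-; rewrite mulrA.
apply: h.
- move=> x; have d := is_derive_normal_pdf x.
  have d2 : is_derive x (1 : R) (fun y => sin (t * y)) (t * cos (t * x)).
    apply: is_derive_eq; rewrite /GRing.scale /= mulr1; ring.
  apply: is_derive_eq; rewrite /GRing.scale /=.
  by move: (normal_pdf 0 s x) (s ^+ 2)^-1 (sin _) (cos _) => a b ? ?; ring.
- move=> x; apply: cvgB.
    apply: cvgM; first exact: cvg_cst.
    apply: cvgM; first exact: continuous_pdf.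
    exact: continuous_cosM.
  apply: cvgM; first exact: cvg_cst.
  apply: cvgM; first exact: continuous_pdf.
  apply: cvgM; first exact: cvg_id.
  exact: continuous_sinM.
- exact: (integrableB measurableT Lc' Ls').
- move=> x; have p0 := normal_pdf_ge0 (0 : R) s x.
  rewrite normrM (ger0_norm p0).
  have h1 := sqr_normal_pdf_le x.
  have h2 := @normal_pdf_ub R 0 s x; rewrite gt_eqF// in h2; have {}h2 := h2 isT.
  apply: (@le_trans _ _ (normal_pdf 0 s x + x ^+ 2 * normal_pdf 0 s x)); last exact: lerD.
  rewrite mulrA -[X in X + _]mul1r -mulrDl ler_wpM2r//.
  have := sin_max (t * x); have := normr_ge0 (sin (t * x)); have := normr_ge0 x.
  rewrite -[x ^+ 2](real_normK (num_real x)).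
  move: (`|x|) (`|sin _|) => a b; nra.
Qed.

(* The characteristic function solves phi' t = - s^2 t phi t. *)
Lemma normal_cos t : Ex N (fun x => cos (t * x)) = expR (- (s ^+ 2 * t ^+ 2 / 2)).
Proof.
pose phi u := Ex N (fun x => cos (u * x)).
have dphi (u : R) : is_derive u (1 : R) phi (- (s ^+ 2 * u) * phi u).
  have cd y v : derivable (fun u : R => cos (u * y)) v 1 /\ 'D_1 (fun u : R => cos (u * y)) v = - (y * sin (v * y)).
    have d : is_derive v (1 : R) (fun u : R => cos (u * y)) (- (y * sin (v * y))).
      by apply: is_derive_eq; rewrite /GRing.scale /= mulr1; ring.
    by split; [exact: ex_derive|exact: derive_val].
  have Iu : (`]u - 1, u + 1[%classic : set R) u by rewrite /= in_itv /= ltrDl ltrBlDr ltrDl ltr01.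
  have nge0 (y : R) : 0 <= `|y| by [].
  have bnd (x y : R) : (`]u - 1, u + 1[%classic : set R) x -> [set: R] y -> `|partial1of2 (fun v y => cos (v * y)) x y| <= `|y|.
    move=> _ _; rewrite partial1of2E (cd y x).2 normrN normrM ler_piMr//; exact: sin_max.
  have hd := @derivable_under_integral R _ (measurableTypeR R) N (fun v y => cos (v * y)) setT measurableT
    u (u - 1) (u + 1) Iu (fun x _ => L1_cosM x) (fun x y _ _ => (cd y x).1) (fun y => `|y|) nge0
    (L1_abs L1_normal_id) bnd.
  have hv := @differentiation_under_integral R _ (measurableTypeR R) N (fun v y => cos (v * y)) setT measurableT
    u (u - 1) (u + 1) Iu (fun x _ => L1_cosM x) (fun x y _ _ => (cd y x).1) (fun y => `|y|) nge0
    (L1_abs L1_normal_id) bnd.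
  apply: DeriveDef; first exact: hd.
  rewrite -derive1E [LHS]hv.
  rewrite mulNr -normal_cos_ibp -[RHS]mulN1r -ExZ; last exact: L1_id_sin.
  by apply: eq_Rintegral => x _; rewrite partial1of2E (cd x u).2 mulN1r.
have alg (a b q u : R) : a * (b * (q * u ^+ 2 * (- 2 ^- 2 * 0) + 2^-1 * (q * (u * 1 + u * 1)))) +
  b * (- (q * u) * a) = 0 by field.
(* Integrating factor of the differential equation: [psi] has zero derivative and value 1 at 0. *)
pose psi u := phi u * expR (s ^+ 2 * u ^+ 2 / 2).
have dpsi (u : R) : is_derive u (1 : R) psi 0.
  have := dphi u => d; apply: is_derive_eq; rewrite /GRing.scale /=.
  exact: alg.
have := @is_derive_0_is_cst R psi t 0 dpsi; rewrite /psi expr0n /= mulr0 mul0r expR0 mulr1.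
have -> : phi 0 = 1.
  by rewrite /phi; under eq_Ex do rewrite mul0r cos0; rewrite Ex_cst.
move=> h; have en : expR (s ^+ 2 * t ^+ 2 / 2) != 0 by rewrite gt_eqF// expR_gt0.
by apply: (mulIf en); rewrite -expRD addNr expR0.
Qed.

End with_sd.
End gaussian1.

Section normal_law.
Context {R : realType} {d : measure_display} {T : measurableType d}.
Variable P : probability T R.

Definition normal_law (X : T -> R) (v : R) := measurable_fun setT X /\
  forall B, measurable B -> P [set w | B (X w)] = normal0 v B.

Variables (X : T -> R) (v : R).
Hypotheses (v0 : 0 <= v) (lX : normal_law X v).

Lemma integral_normal_law (f : R -> R) : measurable_fun setT f ->
  (\int[P]_w (f (X w))%:E = if v == 0%R then (f 0%R)%:E else \int[normal_prob 0 (Num.sqrt v)]_x (f x)%:E)%E.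
Proof.
move=> mf; have [mX hX] := lX; case: ifPn => [/eqP ve|vn].
  rewrite (@integral_law R _ _ P (@dirac _ (measurableTypeR R) 0 R)) //.
    by rewrite integral_dirac ?diracT ?mul1e//; exact/measurable_EFinP.
  by move=> B mB; apply: etrans (hX _ mB) _; rewrite /normal0 ve eqxx.
rewrite (@integral_law R _ _ P (normal_prob 0 (Num.sqrt v) : probability (measurableTypeR R) R)) //.
by move=> B mB; apply: etrans (hX _ mB) _; rewrite /normal0 (negbTE vn).
Qed.

Lemma Ex_normal_law (f : R -> R) : measurable_fun setT f ->
  Ex P (fun w => f (X w)) = if v == 0 then f 0 else Ex (normal_prob 0 (Num.sqrt v)) f.
Proof.
by move=> mf; rewrite /Ex /Rintegral integral_normal_law//; case: ifP.
Qed.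

Lemma L1_normal_law (f : R -> R) : measurable_fun setT f ->
  (v != 0 -> L1 (normal_prob 0 (Num.sqrt v)) f) -> L1 P (fun w => f (X w)).
Proof.
move=> mf hf; apply/integrableP; split.
  by apply/measurable_EFinP/measurableT_comp => //; exact: lX.1.
rewrite (@integral_normal_law (fun x => `|f x|)); last exact: measurableT_comp.
by case: ifPn => [|/hf/integrableP[]//]; rewrite ltry.
Qed.

Let sv : v != 0 -> 0 < Num.sqrt v.
Proof. by move=> vn; rewrite sqrtr_gt0 lt_def vn. Qed.

Lemma normal_law_L1 : L1 P X.
Proof. by apply: (@L1_normal_law id) => // vn; exact: L1_normal_id (sv vn). Qed.

Lemma normal_law_L1_sqr : L1 P (fun w => X w ^+ 2).
Proof.
by apply: (@L1_normal_law (fun x => x ^+ 2)) => [|vn]; [exact: measurable_funX|exact: L1_normal_sqr (sv vn)].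
Qed.

Lemma normal_law_mean : Ex P X = 0.
Proof.
by rewrite (@Ex_normal_law id)//; case: ifPn => // vn; exact: normal_mean (sv vn).
Qed.

Lemma normal_law_var : Ex P (fun w => X w ^+ 2) = v.
Proof.
rewrite (@Ex_normal_law (fun x => x ^+ 2)); last exact: measurable_funX.
case: ifPn => [/eqP->|vn]; first by rewrite expr0n.
by rewrite (normal_moment2 (sv vn)) sqr_sqrtr.
Qed.

Lemma normal_law_cos (t : R) : Ex P (fun w => cos (t * X w)) = expR (- (v * t ^+ 2 / 2)).
Proof.
rewrite (@Ex_normal_law (fun x => cos (t * x))); last exact: measurable_cosM.
case: ifPn => [/eqP->|vn]; first by rewrite mulr0 cos0 !mul0r oppr0 expR0.
by rewrite (normal_cos (sv vn)) sqr_sqrtr.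
Qed.

Lemma normal_law_sin (t : R) : Ex P (fun w => sin (t * X w)) = 0.
Proof.
rewrite (@Ex_normal_law (fun x => sin (t * x))); last exact: measurable_sinM.
by case: ifPn => [_|vn]; [rewrite mulr0 sin0|exact: (normal_sin (sv vn))].
Qed.

Lemma normal_law_mgf_sqr (c : R) : 0 < 1 - 2 * c * v ->
  (\int[P]_w (expR (c * X w ^+ 2))%:E = ((Num.sqrt (1 - 2 * c * v))^-1)%:E)%E.
Proof.
move=> h; rewrite (@integral_normal_law (fun x => expR (c * x ^+ 2))); last first.
  by apply: measurableT_comp => //; apply: measurable_funM => //; exact: measurable_funX.
case: ifPn => [/eqP->|vn].
  by rewrite expr0n /= !mulr0 expR0 subr0 sqrtr1 invr1.
by rewrite (normal_mgf_sqr (sv vn)) sqr_sqrtr.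
Qed.

End normal_law.

(** * Small balls *)

Section small_ball.
Context {R : realType}.

Section fubini.
Context {d : measure_display} {T : measurableType d}.
Variables (P : probability T R) (Q : probability (measurableTypeR R) R).
Variables (f : T -> R -> R) (c : R).
Hypotheses (mf : measurable_fun setT (fun z : T * measurableTypeR R => f z.1 z.2))
  (fc : forall w t, `|f w t| <= c).

Let F (z : T * measurableTypeR R) := (f z.1 z.2)%:E.

Let intF : (P \x Q)%E.-integrable setT F.
Proof.
apply/integrable12ltyP; first exact/measurable_EFinP.
apply: (@le_lt_trans _ _ (\int[P]_w \int[Q]_t (c%:E))%E).
  apply: ge0_le_integral => //.
  - by move=> w _; apply: integral_ge0.
  - apply: (measurable_fun_fubini_tonelli_F (fun z => `|F z|)%E) => //.
    by apply: measurableT_comp => //; exact/measurable_EFinP.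
  - move=> w _; apply: ge0_le_integral => //.
    + apply: measurableT_comp => //; apply/measurable_EFinP.
      exact: (measurableT_comp mf (pair1_measurable w)).
    + by move=> t _; rewrite lee_fin; exact: (fc w t).
under eq_integral do rewrite (ExE (L1_cst Q c)) Ex_cst.
by rewrite (ExE (L1_cst P c)) ltry.
Qed.

Lemma Ex_fubini_measurable1 w : measurable_fun setT (f w).
Proof. exact: (measurableT_comp mf (pair1_measurable w)). Qed.

Lemma Ex_fubini_measurable2 t : measurable_fun setT (f ^~ t).
Proof. exact: (measurableT_comp mf (pair2_measurable t)). Qed.

Let L1f w : L1 Q (f w).
Proof. exact: (L1_bounded Q (Ex_fubini_measurable1 w) (fc w)). Qed.

Let L1g t : L1 P (f ^~ t).
Proof. exact: (L1_bounded P (Ex_fubini_measurable2 t) (fc^~ t)). Qed.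

Lemma Ex_fubini_L1 : L1 Q (fun t => Ex P (f ^~ t)).
Proof.
apply: (@L1_bounded _ _ (measurableTypeR R) Q _ c) => [|t].
  apply/measurable_EFinP; have := measurable_fubini_G intF.
  by congr measurable_fun; apply/funext => t; exact: ExE (L1g t).
have Lc := L1_cst P c; have LNc := L1N Lc.
rewrite ler_norml -{1}(Ex_cst P (- c)) -{2}(Ex_cst P c); apply/andP; split.
  by apply: le_Ex => // w; have := fc w t; rewrite ler_norml => /andP[].
by apply: le_Ex => // w; have := fc w t; rewrite ler_norml => /andP[].
Qed.

Lemma Ex_fubini : Ex P (fun w => Ex Q (f w)) = Ex Q (fun t => Ex P (f ^~ t)).
Proof.
rewrite /Ex /Rintegral; congr fine.
transitivity (\int[P]_w \int[Q]_t F (w, t))%E.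
  by apply: eq_integral => w _; rewrite /F /= ExE.
rewrite (Fubini intF); apply: eq_integral => t _; exact: (ExE (L1g t)).
Qed.

End fubini.

Local Notation N1 := (normal_prob 0 1 : probability (measurableTypeR R) R).

(** Read from right to left, it trades a Gaussian weight in [y] for a random phase, which is how
    squared coordinates are absorbed into characteristic functions. *)
Lemma normal_cosD (a y : R) : Ex N1 (fun t => cos (a + y * t)) = cos a * expR (- (y ^+ 2 / 2)).
Proof.
under eq_Ex do rewrite cosD.
rewrite (@ExB _ _ _ N1); last 2 first.
- by apply: L1Z; exact: L1_cosM.
- by apply: L1Z; exact: L1_sinM.
rewrite !(@ExZ _ _ _ N1); [|exact: L1_sinM|exact: L1_cosM].
by rewrite normal_sin// normal_cos// mulr0 subr0 expr1n mul1r.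
Qed.

Lemma normal_expN_sqr_le (e s a : R) : 0 < e -> 0 < s ->
  Ex N1 (fun t => expR (- (e / 2) * (a + s * t) ^+ 2)) <= (Num.sqrt (1 + s ^+ 2 * e))^-1.
Proof.
move=> e0 s0; set q := 1 + _.
have q0 : 0 < q by rewrite addr_gt0// mulr_gt0// exprn_gt0.
have sq0 : 0 < Num.sqrt q by rewrite sqrtr_gt0.
have sq2 : Num.sqrt q ^+ 2 = q by rewrite sqr_sqrtr// ltW.
have mexp : measurable_fun setT (fun t : R => expR (- (e / 2) * (a + s * t) ^+ 2)).
  apply: measurableT_comp => //; apply: measurable_funM => //; apply: measurable_funX.
  by apply: measurable_funD => //; exact: measurable_funM.
rewrite Ex_normal//.
(* Completing the square: the integrand is a constant times the normal density with this mean and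
   standard deviation. *)
pose m := - (e * a * s) / q; pose s' := (Num.sqrt q)^-1.
have s'0 : 0 < s' by rewrite invr_gt0.
have E x : normal_pdf 0 1 x * expR (- (e / 2) * (a + s * x) ^+ 2) =
    (Num.sqrt q)^-1 * expR (- (e * a ^+ 2 / q / 2)) * normal_pdf m s' x.
  rewrite !normal_pdfE ?gt_eqF ?ltr01//.
  have -> : normal_peak 1 = (Num.sqrt q)^-1 * normal_peak s'.
    rewrite /normal_peak -invfM -sqrtrM ?(ltW q0)//; congr (Num.sqrt _)^-1.
    rewrite /s' exprVn sq2 expr1n mul1r -mulrnAr mulrA divff ?gt_eqF// mul1r //.
  rewrite -[LHS]mulrA -[RHS]mulrACA; congr (_ * _).
  rewrite /normal_fun -!expRD; congr expR.
  rewrite /s' /m exprVn sq2 subr0 expr1n.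
  have qE : q = 1 + s ^+ 2 * e by [].
  have qn : 1 + s ^+ 2 * e != 0 by rewrite -qE gt_eqF.
  rewrite qE; clear -qn; move: qn => qn; field; by rewrite qn.
under eq_Rintegral do rewrite E.
rewrite RintegralZl//; last exact: integrable_normal_pdf.
rewrite /Rintegral integral_normal_pdf /= mulr1 ler_piMr ?invr_ge0 ?(ltW sq0)//.
rewrite -expR0 ler_expR oppr_le0 divr_ge0// divr_ge0 ?(ltW q0)//.
by rewrite mulr_ge0 ?sqr_ge0// ltW.
Qed.

Context {d : measure_display} {T : measurableType d}.
Variable P : probability T R.

Lemma measurable_dotv n (Y Z : T -> 'cV[R]_n) : random_mx Y -> random_mx Z ->
  measurable_fun setT (fun w => dotv (Y w) (Z w)).
Proof.
move=> mY mZ; under eq_fun do rewrite dotvE.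
by apply: measurable_bigsum => i _; apply: measurable_funM.
Qed.

Lemma random_mx_cst m n (v : 'M[R]_(m, n)) : random_mx (fun _ : T => v).
Proof. by move=> i j; exact: measurable_cst. Qed.

Section small_ball_bound.
Variables (n : nat) (Y : T -> 'cV[R]_n) (e s : R).
Hypotheses (e0 : 0 < e) (s0 : 0 < s) (mY : random_mx Y).
Hypothesis hY : forall v, Ex P (fun w => cos (dotv v (Y w))) <= expR (- (e * dotv v v / 2)).

Let H m w := expR (- (s ^+ 2 / 2) * \sum_(i < n | (i < m)%N) Y w i 0 ^+ 2).
Let r := (Num.sqrt (1 + s ^+ 2 * e))^-1.

Let H01 m w : 0 <= H m w <= 1.
Proof.
rewrite expR_ge0 /= -expR0 ler_expR mulNr oppr_le0 mulr_ge0 ?divr_ge0 ?sqr_ge0//.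
by rewrite sumr_ge0// => i _; rewrite sqr_ge0.
Qed.

Let mH m : measurable_fun setT (H m).
Proof.
apply: measurableT_comp => //; apply: measurable_funM => //.
by apply: measurable_bigsum => i _; exact: measurable_funX.
Qed.

Let mcos (g : T -> R) : measurable_fun setT g -> measurable_fun setT (fun w => cos (g w)).
Proof.
move=> mg; apply: measurableT_comp mg.
by apply: continuous_measurable_fun; exact: continuous_cos.
Qed.

(* A factor exp(- s^2 Y_m^2 / 2) is the mean of cos (s g Y_m) over an independent
   standard Gaussian g, which is absorbed into the direction v. *)
Lemma small_ball_rec m v : (m <= n)%N ->
  Ex P (fun w => H m w * cos (dotv v (Y w))) <=
  r ^+ m * expR (- (e * (\sum_(i < n | (m <= i)%N) v i 0 ^+ 2) / 2)).
Proof.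
elim: m v => [v _|m IH v mn].
  rewrite expr0 mul1r; under eq_Ex do rewrite /H big_pred0 // mulr0 expR0 mul1r.
  by apply: le_trans (hY v) _; rewrite dotvE.
pose j : 'I_n := Ordinal mn.
have Hm w : H m.+1 w = H m w * expR (- ((s * Y w j 0) ^+ 2 / 2)).
  rewrite /H -expRD; congr expR; rewrite (bigD1 j) ?leqnn //=.
  rewrite (eq_bigl (fun i : 'I_n => (i < m)%N)) => [|i]; last first.
    by rewrite -val_eqE /= ltnS; case: ltngtP.
  by rewrite exprMn; move: (\sum_(_ < _ | _) _) (Y w j 0) => a b; field.
pose u t : 'cV[R]_n := v + (s * t) *: delta_mx j 0.
have uE w t : dotv (u t) (Y w) = dotv v (Y w) + s * Y w j 0 * t.
  rewrite dotvDl dotvZl; congr (_ + _); rewrite [dotv _ _](_ : _ = Y w j 0); first by ring.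
  rewrite dotvE (bigD1 j)//= mxE !eqxx mul1r big1 ?addr0// => i /negbTE ij.
  by rewrite mxE ij mul0r.
pose f w t := H m w * cos (dotv v (Y w) + s * Y w j 0 * t).
have mf : measurable_fun setT (fun z : T * measurableTypeR R => f z.1 z.2).
  apply: measurable_funM; first exact: measurableT_comp.
  have mc : measurable_fun setT (@cos R) by apply: continuous_measurable_fun; exact: continuous_cos.
  apply: (measurableT_comp mc).
  apply: measurable_funD; last first.
    have mYj : measurable_fun setT (fun z : T * measurableTypeR R => Y z.1 j 0).
      exact: (measurableT_comp (mY j 0) measurable_fst).
    by apply: measurable_funM => //; exact: measurable_funM.
  have mvY : measurable_fun setT (fun w => dotv v (Y w)).
    by apply: measurable_dotv => //; exact: random_mx_cst.
  exact: (measurableT_comp mvY measurable_fst).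
have fc w t : `|f w t| <= 1.
  have /andP[h0 h1] := H01 m w; rewrite normrM ger0_norm//.
  by rewrite -[leRHS]mulr1 ler_pM// cos_max.
have -> : Ex P (fun w => H m.+1 w * cos (dotv v (Y w))) = Ex P (fun w => Ex N1 (f w)).
  apply: eq_Ex => w; rewrite /f (@ExZ _ _ _ N1); last first.
    apply: (@L1_bounded _ _ (measurableTypeR R) N1 _ 1) => [|t]; last exact: cos_max.
    apply: measurableT_comp; first by apply: continuous_measurable_fun; exact: continuous_cos.
    by apply: measurable_funD => //; exact: measurable_funM.
  by rewrite normal_cosD Hm; ring.
rewrite (Ex_fubini P N1 mf fc).
set V := expR (- (e * (\sum_(i < n | (m.+1 <= i)%N) v i 0 ^+ 2) / 2)).
have Lg : L1 N1 (fun t => expR (- (e / 2) * (v j 0 + s * t) ^+ 2)).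
  apply: (@L1_bounded _ _ (measurableTypeR R) N1 _ 1) => [|t].
    apply: measurableT_comp => //; apply: measurable_funM => //; apply: measurable_funX.
    by apply: measurable_funD => //; exact: measurable_funM.
  rewrite ger0_norm ?expR_ge0// -expR0 ler_expR mulNr oppr_le0 mulr_ge0 ?sqr_ge0//.
  by rewrite divr_ge0// ltW.
apply: (@le_trans _ _ (Ex N1 (fun t => r ^+ m * V * expR (- (e / 2) * (v j 0 + s * t) ^+ 2)))).
  apply: (@le_Ex _ _ (measurableTypeR R)); [exact: (Ex_fubini_L1 P N1 mf fc)|exact: L1Z|].
  move=> t; have -> : Ex P (f^~ t) = Ex P (fun w => H m w * cos (dotv (u t) (Y w))).
    by apply: eq_Ex => w; rewrite uE.
  apply: le_trans (IH (u t) (ltnW mn)) _.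
  rewrite -[leRHS]mulrA ler_wpM2l ?exprn_ge0 ?invr_ge0 ?sqrtr_ge0//.
  rewrite /V -expRD ler_expR (bigD1 j)//=.
  rewrite (eq_bigl (fun i : 'I_n => (m < i)%N)) => [|i]; last first.
    by rewrite -val_eqE /=; case: ltngtP.
  rewrite (eq_bigr (fun i : 'I_n => v i 0 ^+ 2)) => [|i mi]; last first.
    rewrite !mxE; have -> : (i == j) = false by rewrite -val_eqE /= gtn_eqF.
    by rewrite mulr0 addr0.
  rewrite !mxE !eqxx mulr1; move: (\sum_(_ < _ | _) _) (v j 0) => a b.
  by rewrite le_eqVlt; apply/orP; left; apply/eqP; field.
rewrite (@ExZ _ _ (measurableTypeR R))// exprSr mulrAC ler_wpM2r ?expR_ge0//.
by rewrite ler_wpM2l ?exprn_ge0 ?invr_ge0 ?sqrtr_ge0// normal_expN_sqr_le.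
Qed.

(** All [n] coordinates have been absorbed and [v = 0]. Only the decay [hY] of the characteristic
    function is used, so the bound applies to sums of independent Gaussians with different
    covariances. *)
Lemma small_ball : Ex P (fun w => expR (- (s ^+ 2 / 2) * dotv (Y w) (Y w))) <= r ^+ n.
Proof.
have := small_ball_rec 0 (leqnn n).
rewrite [X in expR (- (e * X / 2))]big1; last by move=> i _; rewrite mxE expr0n.
rewrite mulr0 mul0r oppr0 expR0 mulr1; apply: le_trans.
rewrite le_eqVlt; apply/orP; left; apply/eqP/eq_Ex => w.
by rewrite dotv0l cos0 mulr1 /H dotvE; congr (expR (_ * _)); apply: eq_big => i; rewrite ?ltn_ord.
Qed.

End small_ball_bound.
End small_ball.

(** * Nets of the unit ball and quadratic forms *)

Section nets.
Context {R : realType}.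

(* Weight the grid by prod_j 2^(- m_j), whose total mass is at most 4^d. *)
Lemma grid_card d N K :
  (#|[pred f : {ffun 'I_d -> bool * 'I_N.+1} | (\sum_j (f j).2 <= K * d)%N]|%:R : R)
  <= (2 ^+ (K + 2)) ^+ d.
Proof.
pose x : R := 2^-1.
have x0 : 0 < x by rewrite invr_gt0.
have geo M : \sum_(m < M) x ^+ m <= 2.
  have E : \sum_(m < M) x ^+ m = 2 - 2 * x ^+ M.
    elim: M => [|M IH]; first by rewrite big_ord0 expr0 mulr1 subrr.
    by rewrite big_ord_recr /= IH exprS mulrA divff ?mul1r//; lra.
  by rewrite E gerBl mulr_ge0// exprn_ge0// ltW.
have tot : \sum_(f : {ffun 'I_d -> bool * 'I_N.+1}) \prod_j x ^+ (f j).2 <= 4 ^+ d.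
  rewrite -(bigA_distr_bigA (fun (j : 'I_d) (c : bool * 'I_N.+1) => x ^+ c.2)) /=.
  rewrite prodr_const card_ord; apply: lerXn2r; rewrite ?nnegrE ?sumr_ge0//.
    by move=> i _; rewrite exprn_ge0// ltW.
  rewrite -(pair_bigA _ (fun (b : bool) (m : 'I_N.+1) => x ^+ m)) /= big_bool /=.
  by have := geo N.+1; lra.
have low : \sum_(f in [pred f : {ffun 'I_d -> bool * 'I_N.+1} | (\sum_j (f j).2 <= K * d)%N]) x ^+ (K * d)
    <= \sum_(f : {ffun 'I_d -> bool * 'I_N.+1}) \prod_j x ^+ (f j).2.
  rewrite [leRHS](bigID (mem [pred f : {ffun 'I_d -> bool * 'I_N.+1} | (\sum_j (f j).2 <= K * d)%N])) /=.
  rewrite -[leLHS]addr0 lerD//; last first.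
    by rewrite sumr_ge0// => f _; rewrite prodr_ge0// => j _; rewrite exprn_ge0// ltW.
  apply: ler_sum => f; rewrite inE => hf; rewrite prodrXr.
  by apply: ler_wiXn2l => //; [exact: ltW|rewrite /x invf_le1// ler1n].
rewrite sumr_const in low.
have := le_trans low tot; rewrite -[x ^+ _ *+ _]mulr_natl -ler_pdivlMr ?exprn_gt0//.
move=> /le_trans; apply; rewrite /x exprVn invrK -exprM mulnDl [in leRHS]exprD mulrC.
have e4 : (4 : R) = 2 ^+ 2 by rewrite -natrX.
by rewrite e4 -exprM.
Qed.

(** Points of a grid of mesh [1 / (K * sqrt d)]. By Cauchy-Schwarz a point of the unit ball rounds
    to integer coordinates whose absolute values sum to at most [K * d], and such points are counted
    by [grid_card], with an exponent linear in [d]. *)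
Lemma net_exists d K : (0 < K)%N -> exists s : seq 'cV[R]_d,
  [/\ (size s)%:R <= (2 ^+ (K + 2)) ^+ d :> R,
      forall v, v \in s -> dotv v v <= 1 &
      forall u, dotv u u <= 1 -> exists2 v, v \in s & dotv (u - v) (u - v) <= (K%:R ^+ 2)^-1].
Proof.
move=> K0; pose N := (K * d)%N; pose h : R := (K%:R * Num.sqrt d%:R)^-1.
pose pt (f : {ffun 'I_d -> bool * 'I_N.+1}) : 'cV[R]_d :=
  \col_j ((-1) ^+ (f j).1 * ((f j).2%:R * h)).
pose S := [pred f : {ffun 'I_d -> bool * 'I_N.+1} | (\sum_j (f j).2 <= K * d)%N].
exists [seq v <- [seq pt f | f <- enum S] | dotv v v <= 1]; split.
- apply: le_trans (grid_card d N K); rewrite ler_nat size_filter.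
  by apply: leq_trans (count_size _ _) _; rewrite size_map -cardE.
- by move=> v; rewrite mem_filter => /andP[].
move=> u u1.
(* In dimension 0 the mesh is the inverse of 0, that is 0, so this case is separate. *)
have [d0|dpos] := posnP d.
  have z (v : 'cV[R]_d) : v = 0 by apply/matrixP => -[i hi]; exfalso; rewrite d0 in hi.
  exists 0; last by rewrite (z (u - 0)) dotv0l invr_ge0 sqr_ge0.
  rewrite mem_filter dotv0l ler01 /=; apply/mapP.
  exists [ffun=> (false, ord0)]; last by rewrite (z (pt _)).
  rewrite mem_enum /S inE big1// => j _; by rewrite ffunE.
have sd : 0 < Num.sqrt (d%:R : R) by rewrite sqrtr_gt0 ltr0n.
have Kp : 0 < K%:R :> R by rewrite ltr0n.
have h0 : 0 < h by rewrite invr_gt0 mulr_gt0.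
have sd2 : Num.sqrt (d%:R : R) ^+ 2 = d%:R by rewrite sqr_sqrtr.
(* Rounding towards 0 keeps the grid point inside the ball, with an error below [h] in each of the
   [d] coordinates. *)
pose m j := Num.truncn (`|u j 0| / h).
have mle j : (m j)%:R * h <= `|u j 0|.
  by rewrite -ler_pdivlMr// truncn_le divr_ge0// ltW.
have mgt j : `|u j 0| < (m j)%:R * h + h.
  rewrite -[X in _ + X]mul1r -mulrDl -ltr_pdivrMr// natr1; exact: truncnS_gt.
have summ : (\sum_j m j <= K * d)%N.
  rewrite -(ler_nat R) natr_sum.
  have h1 : \sum_j (m j)%:R * h <= \sum_j `|u j 0| by apply: ler_sum => j _; exact: mle.
  have h2 : \sum_j `|u j 0| <= Num.sqrt d%:R.
    rewrite -[leLHS]ger0_norm ?sumr_ge0// -sqrtr_sqr ler_sqrt//.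
    have := cauchy_schwarz (\col_j `|u j 0|) (\col_(j < d) (1 : R)).
    rewrite !dotvE (eq_bigr (fun j => `|u j 0|)) => [|j _]; last by rewrite !mxE mulr1.
    move=> /le_trans; apply.
    rewrite [X in _ * X](eq_bigr (fun=> 1)) => [|j _]; last by rewrite !mxE mulr1.
    rewrite sumr_const card_ord -[leRHS]mul1r ler_wpM2r//.
    apply: le_trans u1; rewrite dotvE le_eqVlt; apply/orP; left; apply/eqP.
    by apply: eq_bigr => j _; rewrite !mxE -expr2 real_normK ?num_real// expr2.
  have := le_trans h1 h2; rewrite -mulr_suml -ler_pdivlMr// => /le_trans; apply.
  by rewrite /h invrK natrM mulrCA -expr2 sd2.
have mN j : (m j < N.+1)%N.
  by rewrite ltnS; apply: leq_trans summ; rewrite (bigD1 j)//= leq_addr.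
pose f := [ffun j => (u j 0 < 0, Ordinal (mN j))].
have vE j : pt f j 0 = (-1) ^+ (u j 0 < 0)%R * ((m j)%:R * h) by rewrite mxE ffunE.
have mh0 j : 0 <= (m j)%:R * h by rewrite mulr_ge0// ltW.
exists (pt f).
  rewrite mem_filter; apply/andP; split; last first.
    apply/mapP; exists f => //; rewrite mem_enum /S inE.
    by under eq_bigr do rewrite ffunE /=.
  apply: le_trans u1; rewrite !dotvE; apply: ler_sum => j _.
  rewrite vE mulrACA -expr2 sqrr_sign mul1r -!expr2 -[leRHS]real_normK ?num_real//.
  by rewrite ler_pXn2r ?nnegrE.
rewrite dotvE; apply: (@le_trans _ _ (\sum_(j < d) h ^+ 2)); last first.
  rewrite sumr_const card_ord /h exprVn exprMn sd2 invfM -[_ *+ d]mulr_natr.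
  by rewrite mulrVK// unitfE pnatr_eq0 -lt0n.
apply: ler_sum => j _; rewrite !mxE -expr2 -[leLHS]real_normK ?num_real//.
rewrite ler_pXn2r ?nnegrE ?(ltW h0)//.
rewrite ffunE /=.
have := mle j; have := mgt j; have := mh0 j.
move: ((m j)%:R * h) => y y0 hlt hle; move: hlt hle; case: (ltP (u j 0) 0) => u0 /=.
  by rewrite expr1 mulN1r (ltr0_norm u0) opprK ler_norml => ? ?; apply/andP; split; lra.
by rewrite expr0 mul1r (ger0_norm u0) ler_norml => ? ?; apply/andP; split; lra.
Qed.

Section quadratic.
Variables (d : nat) (Q : 'cV[R]_d -> R).
Hypotheses (Q0 : forall u, 0 <= Q u) (QZ : forall c u, Q (c *: u) = c ^+ 2 * Q u)
  (QD : forall u v, Q (u + v) <= 2 * Q u + 2 * Q v)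
  (Qb : exists C, forall u, dotv u u <= 1 -> Q u <= C).

Lemma quadratic_homogeneous_le (C : R) : (forall u, dotv u u <= 1 -> Q u <= C) ->
  forall u, Q u <= C * dotv u u.
Proof.
move=> h u; have [->|u0] := eqVneq u 0.
  by rewrite dotv0l mulr0 -(scale0r 0) QZ expr0n mul0r.
have d0 : 0 < dotv u u by rewrite dotv_gt0.
have d0' := ltW d0.
have := h ((Num.sqrt (dotv u u))^-1 *: u).
rewrite dotvZl dotvZr mulrA -expr2 exprVn sqr_sqrtr// mulVf ?gt_eqF// lexx => /(_ isT).
by rewrite QZ exprVn sqr_sqrtr// mulrC ler_pdivrMr.
Qed.

(* The form Q is only known to be positive, homogeneous and to satisfy the
   parallelogram bound, so the supremum over the unit ball is compared with itself. *)
Lemma net_upper (s : seq 'cV[R]_d) (M : R) :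
  (forall u, dotv u u <= 1 -> exists2 v, v \in s & dotv (u - v) (u - v) <= (2%:R ^+ 2)^-1) ->
  (forall v, v \in s -> Q v <= M) -> forall u, Q u <= 4 * M * dotv u u.
Proof.
move=> net hM; apply: quadratic_homogeneous_le.
pose A := [set Q u | u in [set u : 'cV[R]_d | dotv u u <= 1]].
have supA : has_sup A.
  split; first by exists (Q 0), 0 => //=; rewrite dotv0l ler01.
  by have [C hC] := Qb; exists C => _ [u u1 <-]; exact: hC.
have QS u : dotv u u <= 1 -> Q u <= sup A.
  by move=> u1; apply: ub_le_sup; [exact: supA.2|exists u].
have QSh := quadratic_homogeneous_le QS.
have S0 : 0 <= sup A by apply: le_trans (Q0 0) (QS _ _); rewrite dotv0l ler01.
have h u : dotv u u <= 1 -> Q u <= 2 * M + sup A / 2.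
  move=> u1; have [v vs vu] := net u u1.
  have := QD v (u - v); rewrite subrKC => /le_trans; apply.
  have h1 := hM v vs; have h2 := QSh (u - v).
  have h3 : sup A * dotv (u - v) (u - v) <= sup A * (2%:R ^+ 2)^-1 by rewrite ler_wpM2l.
  have -> : sup A / 2 = 2 * (sup A * (2%:R ^+ 2)^-1) by field.
  lra.
have : sup A <= 2 * M + sup A / 2 by apply: ge_sup; [exact: supA.1|move=> _ [u u1 <-]; exact: h].
by move=> hS u u1; have := QS u u1; lra.
Qed.

(** For a unit vector [u] with net point [v], the parallelogram bound gives
    [Q v <= 2 * Q u + 2 * Q (v - u)], and the last term is at most [2 * C / K^2]. Since [K >= 2], it
    also forces [dotv v v >= 1/4], so net points near 0 need no lower bound. *)
Lemma net_lower (s : seq 'cV[R]_d) (K : nat) (C m : R) : (2 <= K)%N ->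
  (forall u, dotv u u <= 1 -> exists2 v, v \in s & dotv (u - v) (u - v) <= (K%:R ^+ 2)^-1) ->
  (forall u, Q u <= C * dotv u u) -> 0 <= C ->
  (forall v, v \in s -> 4^-1 <= dotv v v -> m <= Q v) ->
  forall u, (m / 2 - C / K%:R ^+ 2) * dotv u u <= Q u.
Proof.
move=> K2 net hC C0 hm u; have [->|u0] := eqVneq u 0.
  by rewrite dotv0l mulr0 Q0.
have d0 : 0 < dotv u u by rewrite dotv_gt0.
have d0' := ltW d0.
pose u1 := (Num.sqrt (dotv u u))^-1 *: u.
have u11 : dotv u1 u1 = 1.
  by rewrite dotvZl dotvZr mulrA -expr2 exprVn sqr_sqrtr// mulVf ?gt_eqF.
suff : m / 2 - C / K%:R ^+ 2 <= Q u1.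
  by rewrite /u1 QZ exprVn sqr_sqrtr// ler_pdivlMl// [dotv u u * _]mulrC.
have [|v vs vu] := net u1; first by rewrite u11.
have K4 : (K%:R ^+ 2)^-1 <= 4^-1 :> R.
  rewrite lef_pV2 ?posrE ?exprn_gt0 ?ltr0n ?(leq_trans _ K2)//.
  by rewrite -natrX ler_nat (@leq_exp2r 2 K 2).
have v4 : 4^-1 <= dotv v v.
  have := dotv_parallelogram v (u1 - v); rewrite subrKC u11; lra.
have h1 := hm v vs v4.
have h2 : Q v <= 2 * Q u1 + 2 * Q (v - u1) by have := QD u1 (v - u1); rewrite subrKC.
have h3 : Q (v - u1) <= C / K%:R ^+ 2.
  apply: le_trans (hC _) _; rewrite ler_wpM2l//.
  by move: vu; rewrite -opprB dotvNl dotvNr opprK.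
lra.
Qed.

End quadratic.
End nets.

(** * Events of high probability and independent families *)

Section whp.
Context {R : realType} {d : measure_display} {T : measurableType d}.
Variable P : probability T R.

(** The failure set is only covered by a measurable one: [Q] often quantifies over all vectors, and
    its measurability is never at issue. *)
Definition whp (delta : R) (Q : T -> Prop) :=
  exists B, [/\ measurable B, (P B <= delta%:E)%E & forall w, ~ B w -> Q w].

Lemma whp_imp delta delta' (Q Q' : T -> Prop) : delta <= delta' -> (forall w, Q w -> Q' w) ->
  whp delta Q -> whp delta' Q'.
Proof.
move=> dd QQ' [B [mB PB BQ]]; exists B; split => //.
- by apply: le_trans PB _; rewrite lee_fin.
- by move=> w /BQ/QQ'.
Qed.

Lemma whp_and d1 d2 (Q1 Q2 : T -> Prop) : whp d1 Q1 -> whp d2 Q2 ->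
  whp (d1 + d2) (fun w => Q1 w /\ Q2 w).
Proof.
move=> [B1 [m1 P1 h1]] [B2 [m2 P2 h2]]; exists (B1 `|` B2); split.
- exact: measurableU.
- apply: (@le_trans _ _ (P B1 + P B2)%E); first exact: measureU2.
  by rewrite EFinD leeD.
- by move=> w /not_orP[n1 n2]; split; [exact: h1|exact: h2].
Qed.

Lemma whp_all_seq (A : eqType) (s : seq A) (eta : R) (Q : A -> T -> Prop) : 0 <= eta ->
  (forall a, a \in s -> whp eta (Q a)) ->
  whp ((size s)%:R * eta) (fun w => forall a, a \in s -> Q a w).
Proof.
move=> eta0; elim: s => [_|a s IH h].
  exists set0; split => //; by rewrite measure0 mul0r.
have h1 := h a (mem_head _ _).
have h2 := IH (fun b bs => h b (ltac:(by rewrite inE bs orbT))).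
apply: whp_imp (whp_and h1 h2) => [|w [q1 q2] b].
  by rewrite /= -natr1 mulrDl mul1r addrC.
by rewrite inE => /predU1P[->|/q2].
Qed.

Lemma markov_fun (A : set T) (g : T -> R) (delta : R) : measurable A -> measurable_fun setT g ->
  (forall w, 0 <= g w) -> (forall w, A w -> 1 <= g w) ->
  (\int[P]_w (g w)%:E <= delta%:E)%E -> (P A <= delta%:E)%E.
Proof.
move=> mA mg g0 Ag; apply: le_trans.
have <- : (\int[P]_w (\1_A w)%:E = P A)%E by rewrite integral_indic// setIT.
apply: ge0_le_integral => //.
- by apply/measurable_EFinP; exact: measurable_indic.
- exact/measurable_EFinP.
- move=> w _; rewrite lee_fin indicE; have [|_] := boolP (w \in A); last exact: g0.
  by rewrite inE => /Ag.
Qed.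

End whp.

Section indep_family.
Context {R : realType} {d : measure_display} {T : measurableType d}.
Variable P : probability T R.
Variable I : finType.
Variable G : I -> set (set T).
Hypothesis GT : forall i A, G i A -> measurable A.
Hypothesis indepG : mutual_indep P G.

Lemma meas_in_comp (H : set (set T)) (f : T -> R) (g : R -> R) :
  measurable_fun setT g -> meas_in H f -> meas_in H (fun w => g (f w)).
Proof.
move=> mg Hf B mB; apply: (Hf (g @^-1` B)).
by rewrite -[X in measurable X]setTI; exact: mg.
Qed.

(* Reduce to nonnegative factors by writing h_i = 2 (1 + h_i) / 2 - 1, one index
   at a time. *)
Lemma Ex_prod_indep_bounded (h : I -> T -> R) : (forall i, meas_in (G i) (h i)) ->
  (forall i w, `|h i w| <= 1) ->
  Ex P (fun w => \prod_i h i w) = \prod_i Ex P (h i).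
Proof.
have Lprod (h' : I -> T -> R) : (forall i, meas_in (G i) (h' i)) ->
    (forall i w, `|h' i w| <= 1) -> L1 P (fun w => \prod_i h' i w).
  move=> mh h1; apply: (@L1_bounded _ _ _ P _ 1).
    by apply: measurable_bigprod => i _; apply: meas_in_measurable (mh i); exact: GT.
  move=> w; rewrite normr_prod; apply: (@le_trans _ _ (\prod_(i : I) 1)); last by rewrite big1.
  by apply: ler_prod => i _; rewrite normr_ge0 h1.
have Li (h' : I -> T -> R) i : (forall i, meas_in (G i) (h' i)) ->
    (forall i w, `|h' i w| <= 1) -> L1 P (h' i).
  move=> mh h1; apply: (@L1_bounded _ _ _ P _ 1) => //.
  by apply: meas_in_measurable (mh i); exact: GT.
suff H (s : seq I) : uniq s -> forall h : I -> T -> R, (forall i, meas_in (G i) (h i)) ->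
   (forall i w, `|h i w| <= 1) -> (forall i, i \notin s -> forall w, 0 <= h i w) ->
   Ex P (fun w => \prod_i h i w) = \prod_i Ex P (h i).
  move=> mh h1; apply: (H (enum I)) => //; first exact: enum_uniq.
  by move=> i; rewrite mem_enum.
elim: s => [_ {}h mh h1 h0|i s IH /= /andP[is_ us] {}h mh h1 h0].
  apply: EFin_inj; rewrite -ExE; last exact: Lprod.
  rewrite (ge0_integral_prod_indep GT indepG mh) => [|i w]; last exact: h0.
  rewrite (eq_bigr (fun i => (Ex P (h i))%:E)) => [|i _]; last by rewrite ExE//; exact: Li.
  by rewrite prodEFin.
pose h' (c : T -> R) j := if j == i then c else h j.
have hE (c : T -> R) w : \prod_j h' c j w = c w * \prod_(j | j != i) h j w.
  rewrite (bigD1 i)//= /h' eqxx; congr (_ * _).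
  by apply: eq_bigr => j /negbTE ->.
have hEx (c : T -> R) : \prod_j Ex P (h' c j) = Ex P c * \prod_(j | j != i) Ex P (h j).
  rewrite (bigD1 i)//= /h' eqxx; congr (_ * _).
  by apply: eq_bigr => j /negbTE ->.
pose c w := (1 + h i w) / 2.
have hi w : -1 <= h i w <= 1 by rewrite -ler_norml.
have key (c' : T -> R) : meas_in (G i) c' -> (forall w, 0 <= c' w <= 1) ->
    (forall j, meas_in (G j) (h' c' j)) /\ (forall j w, `|h' c' j w| <= 1) /\
    Ex P (fun w => \prod_j h' c' j w) = \prod_j Ex P (h' c' j).
  move=> mc c01.
  have m1 j : meas_in (G j) (h' c' j) by rewrite /h'; case: eqP => // ->.
  have b1 j w : `|h' c' j w| <= 1.
    rewrite /h'; case: eqP => // _; have /andP[? ?] := c01 w; by rewrite ger0_norm.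
  split=> //; split => //; apply: (IH us) => // j js w.
  rewrite /h'; case: eqP => [_|/eqP ji]; first by have /andP[] := c01 w.
  by apply: h0; rewrite inE (negbTE ji).
have mc : meas_in (G i) c.
  by apply: (@meas_in_comp _ _ (fun x => (1 + x) / 2)) (mh i); apply: measurable_funM => //; exact: measurable_funD.
have [mc1 [bc1 ec1]] := key c mc (fun w => ltac:(rewrite /c; have := hi w; lra)).
have m1 : meas_in (G i) (fun=> (1 : R)).
  exact: (@meas_in_comp (G i) (h i) (fun=> (1 : R)) (measurable_cst _) (mh i)).
have [mo1 [bo1 eo1]] := key (fun=> (1 : R)) m1 (fun w => ltac:(rewrite ler01 lexx; by [])).
have -> : Ex P (fun w => \prod_i h i w) =
    Ex P (fun w => 2 * \prod_j h' c j w - \prod_j h' (fun=> 1) j w).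
  by apply: eq_Ex => w; rewrite !hE (bigD1 i)//= /c; move: (h i w) (\prod_(_ | _) _) => a b; field.
rewrite (@ExB _ _ _ P); [|by apply: L1Z; exact: Lprod|exact: Lprod].
rewrite (@ExZ _ _ _ P); last exact: Lprod.
rewrite ec1 eo1 !hEx Ex_cst [RHS](bigD1 i)//=.
have -> : Ex P (h i) = 2 * Ex P c - 1.
  rewrite -(@ExZ _ _ _ P); last by have := mc1 i; have := Li _ i mc1 bc1; rewrite /h' eqxx.
  rewrite -[X in _ - X](Ex_cst P) -ExB.
  - by apply: eq_Ex => w; rewrite /c; field.
  - by apply: L1Z; have := Li _ i mc1 bc1; rewrite /h' eqxx.
  - exact: L1_cst.
by ring.
Qed.

(** Addition formulas, one index at a time. The induction carries the cosine and the sine of the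
    partial sum together, times arbitrary bounded functions of the remaining indices; the sine part
    stays 0. *)
Lemma Ex_cos_sum_indep (f : I -> T -> R) : (forall i, meas_in (G i) (f i)) ->
  (forall i, Ex P (fun w => sin (f i w)) = 0) ->
  Ex P (fun w => cos (\sum_i f i w)) = \prod_i Ex P (fun w => cos (f i w)).
Proof.
move=> mf fsin0.
have mcos i : meas_in (G i) (fun w => cos (f i w)).
  by apply: meas_in_comp (mf i); apply: continuous_measurable_fun; exact: continuous_cos.
have msin i : meas_in (G i) (fun w => sin (f i w)).
  by apply: meas_in_comp (mf i); apply: continuous_measurable_fun; exact: continuous_sin.
have mG i (g : T -> R) : meas_in (G i) g -> measurable_fun setT g.
  by apply: meas_in_measurable; exact: GT.
suff H (s : seq I) : uniq s -> forall h : I -> T -> R, (forall i, meas_in (G i) (h i)) ->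
   (forall i w, `|h i w| <= 1) ->
   Ex P (fun w => cos (\sum_(i <- s) f i w) * \prod_(i | i \notin s) h i w) =
     (\prod_(i <- s) Ex P (fun w => cos (f i w))) * \prod_(i | i \notin s) Ex P (h i) /\
   Ex P (fun w => sin (\sum_(i <- s) f i w) * \prod_(i | i \notin s) h i w) = 0.
  have [] := H (index_enum I) (index_enum_uniq I) (fun _ _ => 0) _ _.
  - move=> i; exact: (@meas_in_comp (G i) (f i) (fun=> 0) (measurable_cst _) (mf i)).
  - by move=> i w; rewrite normr0.
  have e (g : I -> R) : \prod_(i | i \notin index_enum I) g i = 1.
    by rewrite big_pred0// => i; rewrite mem_index_enum.
  by rewrite [X in _ = _ * X -> _]e mulr1 => <- _; apply: eq_Ex => w; rewrite e mulr1.
elim: s => [_ h mh h1|i s IH /= /andP[is_ us] h mh h1].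
  split.
    under eq_Ex do rewrite big_nil cos0 mul1r.
    by rewrite big_nil mul1r; exact: Ex_prod_indep_bounded.
  under eq_Ex do rewrite big_nil sin0 mul0r.
  by rewrite Ex_cst.
pose h' (c : T -> R) j := if j == i then c else h j.
have hE (c : T -> R) w : \prod_(j | j \notin s) h' c j w = c w * \prod_(j | j \notin i :: s) h j w.
  rewrite (bigD1 i)//= /h' eqxx; congr (_ * _).
  apply: eq_big => [j|j /andP[_ /negbTE ->]//]; by rewrite inE negb_or andbC.
have hEx (c : T -> R) : \prod_(j | j \notin s) Ex P (h' c j) = Ex P c * \prod_(j | j \notin i :: s) Ex P (h j).
  rewrite (bigD1 i)//= /h' eqxx; congr (_ * _).
  apply: eq_big => [j|j /andP[_ /negbTE ->]//]; by rewrite inE negb_or andbC.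
have key (c : T -> R) : meas_in (G i) c -> (forall w, `|c w| <= 1) ->
    (forall j, meas_in (G j) (h' c j)) /\ (forall j w, `|h' c j w| <= 1).
  by move=> mc c1; split => j; rewrite /h'; case: eqP => // ->.
have [mC bC] := key _ (mcos i) (fun w => cos_max _).
have [mS bS] := key _ (msin i) (fun w => sin_max _).
have [Cc Cs] := IH us _ mC bC; have [Sc Ss] := IH us _ mS bS.
have Lp (h'' : I -> T -> R) (g : R -> R) : measurable_fun setT g -> (forall x, `|g x| <= 1) ->
   (forall j, meas_in (G j) (h'' j)) -> (forall j w, `|h'' j w| <= 1) ->
   L1 P (fun w => g (\sum_(i <- s) f i w) * \prod_(j | j \notin s) h'' j w).
  move=> mg g1 m1 b1; apply: (@L1_bounded _ _ _ P _ 1).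
    apply: measurable_funM.
      by apply: (measurableT_comp mg); apply: measurable_bigsum => j _; exact: mG.
    by apply: measurable_bigprod => j _; exact: mG.
  move=> w; rewrite normrM normr_prod -[leRHS]mul1r ler_pM//; first exact: prodr_ge0.
  apply: (@le_trans _ _ (\prod_(j | j \notin s) 1)); last by rewrite big1.
  by apply: ler_prod => j _; rewrite normr_ge0 b1.
have mc : measurable_fun setT (@cos R) by apply: continuous_measurable_fun; exact: continuous_cos.
have ms : measurable_fun setT (@sin R) by apply: continuous_measurable_fun; exact: continuous_sin.
split.
- have -> : Ex P (fun w => cos (\sum_(j <- i :: s) f j w) * \prod_(j | j \notin i :: s) h j w) =
    Ex P (fun w => cos (\sum_(j <- s) f j w) * \prod_(j | j \notin s) h' (fun w => cos (f i w)) j w -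
       sin (\sum_(j <- s) f j w) * \prod_(j | j \notin s) h' (fun w => sin (f i w)) j w).
    by apply: eq_Ex => w; rewrite big_cons cosD !hE; ring.
  rewrite (@ExB _ _ _ P); [|exact: Lp (@cos_max R) _ _|exact: Lp (@sin_max R) _ _].
  by rewrite Cc Ss subr0 hEx big_cons; ring.
- have -> : Ex P (fun w => sin (\sum_(j <- i :: s) f j w) * \prod_(j | j \notin i :: s) h j w) =
    Ex P (fun w => cos (\sum_(j <- s) f j w) * \prod_(j | j \notin s) h' (fun w => sin (f i w)) j w +
       sin (\sum_(j <- s) f j w) * \prod_(j | j \notin s) h' (fun w => cos (f i w)) j w).
    by apply: eq_Ex => w; rewrite big_cons sinD !hE; ring.
  rewrite (@ExD _ _ _ P); [|exact: Lp (@cos_max R) _ _|exact: Lp (@sin_max R) _ _].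
  by rewrite Sc Cs hEx fsin0 mul0r mulr0 addr0.
Qed.

End indep_family.

Section exp_bounds.
Context {R : realType}.

(** After squaring, it follows from [expR (2 x) >= 1 + 2 x] and [(1 + 2 x) (1 - x) >= 1] on this
    range. *)
Lemma invsqrt_le_expR (x : R) : 0 <= x -> x <= 2^-1 -> (Num.sqrt (1 - x))^-1 <= expR x.
Proof.
move=> x0 x1; have y0 : 0 < 1 - x by lra.
have s0 : 0 < Num.sqrt (1 - x) by rewrite sqrtr_gt0.
have e0 := expR_gt0 x.
rewrite -[leLHS]div1r ler_pdivrMr//.
have h : 1 <= expR x ^+ 2 * (1 - x).
  rewrite expr2 -expRD.
  have h1 := expR_ge1Dx (x + x).
  have : (1 + (x + x)) * (1 - x) <= expR (x + x) * (1 - x) by rewrite ler_wpM2r// ltW.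
  by apply: le_trans; nra.
rewrite -(@ler_pXn2r _ 2)// ?nnegrE ?mulr_ge0 ?(ltW e0) ?(ltW s0)//.
by rewrite exprMn sqr_sqrtr ?expr1n// ltW.
Qed.

Lemma invsqrt_le_expRN (y : R) : 0 <= y -> y <= 2^-1 -> (Num.sqrt (1 + y))^-1 <= expR (- (y / 4)).
Proof.
move=> y0 y1; have p0 : 0 < 1 + y by lra.
have s0 : 0 < Num.sqrt (1 + y) by rewrite sqrtr_gt0.
rewrite expRN lef_pV2 ?posrE ?expR_gt0//.
rewrite -(@ler_pXn2r _ 2)// ?nnegrE ?expR_ge0 ?(ltW s0)//.
rewrite sqr_sqrtr ?(ltW p0)// expr2 -expRD.
have h := expR_ge1Dx (- (y / 4 + y / 4)).
have e0 := expR_gt0 (y / 4 + y / 4).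
rewrite expRN in h.
have q0 : 0 < 1 + - (y / 4 + y / 4) by lra.
apply: (@le_trans _ _ (1 + - (y / 4 + y / 4))^-1).
  by rewrite -[leLHS]invrK lef_pV2 ?posrE ?invr_gt0.
rewrite -[leLHS]div1r ler_pdivrMr//; nra.
Qed.

Lemma exp2_le_expR n : (2 : R) ^+ n <= expR n%:R.
Proof.
rewrite -[n%:R]mulr1 expRM_natl; apply: lerXn2r; rewrite ?nnegrE ?expR_ge0//.
by have := expR_ge1Dx (1 : R); lra.
Qed.

End exp_bounds.

(** * Concentration of weighted forms *)

Section concentration.
Context {R : realType} {d : measure_display} {T : measurableType d}.
Variable P : probability T R.
Context {p n : nat}.
Variable G : 'I_p -> set (set T).
Hypothesis GT : forall i A, G i A -> measurable A.
Hypothesis indepG : mutual_indep P G.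
Variables (y : 'I_p -> T -> 'cV[R]_n) (eps : R).
Hypotheses (eps0 : 0 < eps) (eps1 : eps <= 1).
Hypothesis yG : forall i u, meas_in (G i) (fun w => dotv u (y i w)).
Hypothesis yl : forall i u, exists v, [/\ eps * dotv u u <= v, v <= eps^-1 * dotv u u &
  normal_law P (fun w => dotv u (y i w)) v].
Hypothesis n0 : (0 < n)%N.

Lemma whp_prob (A : set T) (delta : R) (Q : T -> Prop) : measurable A ->
  (P A <= delta%:E)%E -> (forall w, ~ A w -> Q w) -> whp P delta Q.
Proof. by move=> mA PA h; exists A. Qed.

Let my i u : measurable_fun setT (fun w => dotv u (y i w)).
Proof. by apply: meas_in_measurable (yG i u); exact: GT. Qed.

Let mf (c : 'I_p -> R) u : measurable_fun setT (fun w => \sum_i c i * dotv u (y i w) ^+ 2).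
Proof.
by apply: measurable_bigsum => i _; apply: measurable_funM => //; exact: measurable_funX.
Qed.

(** Exponential Markov inequality with the product rule for independent factors. The sign of [c] is
    free: positive for upper tails, negative for lower tails. *)
Lemma chernoff_form (c B : 'I_p -> R) u (s : R) (A : set T) :
  (forall i, exists r, (\int[P]_w (expR (c i * dotv u (y i w) ^+ 2))%:E = r%:E)%E /\ r <= expR (B i)) ->
  measurable A -> (forall w, A w -> s <= \sum_i c i * dotv u (y i w) ^+ 2) ->
  (P A <= (expR (\sum_i B i - s))%:E)%E.
Proof.
move=> hB mA hA.
pose g w := expR (- s) * \prod_i expR (c i * dotv u (y i w) ^+ 2).
have gE w : g w = expR (\sum_i c i * dotv u (y i w) ^+ 2 - s).
  by rewrite /g -expR_sum -expRD addrC.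
have mg : measurable_fun setT g.
  rewrite (_ : g = fun w => expR (\sum_i c i * dotv u (y i w) ^+ 2 - s)); last exact/funext.
  by apply: measurableT_comp => //; apply: measurable_funB.
apply: (@markov_fun _ _ _ P A g) => //.
- by move=> w; rewrite gE expR_ge0.
- by move=> w /hA h; rewrite gE -[leLHS]expR0 ler_expR subr_ge0.
have me i : measurable_fun setT (fun x : R => expR (c i * x ^+ 2)).
  by apply: measurableT_comp => //; apply: measurable_funM => //; exact: measurable_funX.
have mp : measurable_fun setT (fun w => \prod_i expR (c i * dotv u (y i w) ^+ 2)).
  by apply: measurable_bigprod => i _; exact: (measurableT_comp (me i) (my i u)).
have -> : (\int[P]_w (g w)%:E = (expR (- s))%:E * \int[P]_w (\prod_i expR (c i * dotv u (y i w) ^+ 2))%:E)%E.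
  rewrite /g; under eq_integral do rewrite EFinM.
  apply: ge0_integralZl_EFin => //; [|exact/measurable_EFinP].
  by move=> w _; rewrite lee_fin prodr_ge0// => i _; exact: expR_ge0.
rewrite (@ge0_integral_prod_indep _ _ _ P _ _ GT indepG (fun i w => expR (c i * dotv u (y i w) ^+ 2))).
- have /choice[r hr] := hB.
  rewrite (eq_bigr (fun i => (r i)%:E)) => [|i _]; last exact: (hr i).1.
  rewrite prodEFin -EFinM lee_fin addrC expRD ler_wpM2l ?expR_ge0// expR_sum.
  apply: ler_prod => i _; apply/andP; split; last exact: (hr i).2.
  rewrite -lee_fin -(hr i).1; apply: integral_ge0 => w _; rewrite lee_fin; exact: expR_ge0.
- by move=> i; apply: (@meas_in_comp _ _ T (G i) _ (fun x => expR (c i * x ^+ 2)) (me i)); exact: yG.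
- by move=> i w; exact: expR_ge0.
Qed.

Section weighted.
Variables (l : 'I_p -> R) (J : pred 'I_p) (M : R).
Hypotheses (M0 : 0 < M) (lM : forall j, J j -> 0 <= l j <= M).

Definition wform w u := \sum_(j | J j) l j * dotv u (y j w) ^+ 2.
Let L := \sum_(j | J j) l j.

Let L0 : 0 <= L.
Proof. by apply: sumr_ge0 => j /lM /andP[]. Qed.

Let lJ j := if J j then l j else 0.

Let lJ0 j : 0 <= lJ j <= M.
Proof. by rewrite /lJ; case: ifP => [/lM//|_]; rewrite lexx ltW. Qed.

Let wformE w u : wform w u = \sum_j lJ j * dotv u (y j w) ^+ 2.
Proof. by rewrite /wform big_mkcond /=; apply: eq_bigr => j _; rewrite /lJ; case: ifP; rewrite ?mul0r. Qed.

Let LE : L = \sum_j lJ j.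
Proof. by rewrite /L big_mkcond. Qed.

Let mwform u : measurable_fun setT (wform ^~ u).
Proof. by under eq_fun do rewrite wformE; exact: mf. Qed.

Lemma wform_ge0 w u : 0 <= wform w u.
Proof. by apply: sumr_ge0 => j /lM /andP[l0 _]; rewrite mulr_ge0 ?sqr_ge0. Qed.

Lemma wformZ w c u : wform w (c *: u) = c ^+ 2 * wform w u.
Proof. by rewrite /wform mulr_sumr; apply: eq_bigr => j _; rewrite dotvZl; ring. Qed.

Lemma wformD w u v : wform w (u + v) <= 2 * wform w u + 2 * wform w v.
Proof.
rewrite /wform !mulr_sumr -big_split /=; apply: ler_sum => j /lM /andP[l0 _].
rewrite dotvDl; move: (dotv u _) (dotv v _) => a b.
rewrite !(mulrCA 2) -mulrDr ler_wpM2l//; have := sqr_ge0 (a - b); nra.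
Qed.

Lemma wform_bounded w : exists C, forall u, dotv u u <= 1 -> wform w u <= C.
Proof.
exists (\sum_(j | J j) l j * dotv (y j w) (y j w)) => u u1.
apply: ler_sum => j /lM /andP[l0 _]; rewrite ler_wpM2l//.
by apply: le_trans (cauchy_schwarz _ _) _; rewrite ler_piMl ?dotv_ge0.
Qed.

Lemma tail_upper u a : dotv u u <= 1 ->
  (P [set w | (a < wform w u)%R] <= (expR ((2 * L / eps - a) * (eps / (4 * M))))%:E)%E.
Proof.
(* Largest parameter for which [2 * th * l j / eps <= 1/2], the range of [invsqrt_le_expR]. *)
move=> u1; pose th := eps / (4 * M).
have th0 : 0 < th by rewrite divr_gt0// mulr_gt0.
have := @chernoff_form (fun j => th * lJ j) (fun j => 2 * th * lJ j / eps) u (th * a)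
  [set w | a < wform w u].
have -> : \sum_i 2 * th * lJ i / eps - th * a = (2 * L / eps - a) * (eps / (4 * M)).
  rewrite -mulr_suml -mulr_sumr -LE -/th; ring.
apply.
- move=> i; have [v [v1 v2 lv]] := yl i u.
  have v0 : 0 <= v by apply: le_trans v1; rewrite mulr_ge0 ?dotv_ge0// ltW.
  have ve : v <= eps^-1 by apply: le_trans v2 _; rewrite ler_piMr// invr_ge0 ltW.
  have /andP[li0 liM] := lJ0 i.
  have x0 : 0 <= 2 * (th * lJ i) * v by apply: mulr_ge0 => //; apply: mulr_ge0 => //; apply: mulr_ge0 => //; exact: ltW.
  have xle : 2 * (th * lJ i) * v <= 2 * th * lJ i / eps.
    by rewrite mulrA; apply: ler_wpM2l ve; apply: mulr_ge0 => //; apply: mulr_ge0 => //; exact: ltW.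
  have x1 : 2 * th * lJ i / eps <= 2^-1.
    have -> : 2 * th * lJ i / eps = lJ i / M / 2 by rewrite /th; field; rewrite !gt_eqF.
    rewrite ler_pdivrMr// mulVf// ler_pdivrMr// mul1r; exact: liM.
  have x2 : 0 < 1 - 2 * (th * lJ i) * v by have := le_trans xle x1; lra.
  exists (Num.sqrt (1 - 2 * (th * lJ i) * v))^-1; split.
    by rewrite (normal_law_mgf_sqr v0 lv x2).
  apply: le_trans (invsqrt_le_expR x0 (le_trans xle x1)) _.
  by rewrite ler_expR.
- by apply: measurable_lt_set => //; exact: measurable_cst.
- move=> w /= h; rewrite [leRHS](_ : _ = th * wform w u); first by rewrite ler_pM2l// ltW.
  by rewrite wformE mulr_sumr; apply: eq_bigr => j _; rewrite mulrA.
Qed.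

Lemma tail_lower u a : 4^-1 <= dotv u u ->
  (P [set w | (wform w u < a)%R] <= (expR (a / M - eps * L / (8 * M)))%:E)%E.
Proof.
move=> u1.
have := @chernoff_form (fun j => - (lJ j / M)) (fun j => - (eps * lJ j / (8 * M))) u (- (a / M))
  [set w | wform w u < a].
have -> : \sum_i - (eps * lJ i / (8 * M)) - - (a / M) = a / M - eps * L / (8 * M).
  by rewrite sumrN -mulr_suml -mulr_sumr -LE; ring.
apply.
- move=> i; have [v [v1 v2 lv]] := yl i u.
  have v4 : eps / 4 <= v by apply: le_trans v1; rewrite ler_pM2l.
  have v0 : 0 <= v by apply: le_trans v4; rewrite divr_ge0// ltW.
  have /andP[li0 liM] := lJ0 i.
  (* A lower bound for [2 * (lJ i / M) * v], since the variance [v] is at least [eps / 4]; [y0 / 4]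
     is the exponent announced. *)
  pose y0 := lJ i * eps / (2 * M).
  have lM0 : 0 <= lJ i / M by rewrite divr_ge0// ltW.
  have lM1 : lJ i / M <= 1 by rewrite ler_pdivrMr// mul1r; exact: liM.
  have yE : y0 = lJ i / M * (eps / 2) by rewrite /y0; field; rewrite !gt_eqF.
  have y00 : 0 <= y0 by rewrite yE mulr_ge0// divr_ge0// ltW.
  have y01 : y0 <= 2^-1 by rewrite yE; move: (lJ i / M) lM0 lM1 => q q0 q1; have := ler_wpM2l q0 eps1; lra.
  have yv : y0 <= 2 * (lJ i / M) * v.
    by rewrite yE; move: (lJ i / M) lM0 => q q0; have := ler_wpM2l q0 v4; lra.
  have e1 : 1 - 2 * - (lJ i / M) * v = 1 + 2 * (lJ i / M) * v by ring.
  have x2 : 0 < 1 - 2 * - (lJ i / M) * v by rewrite e1; lra.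
  exists (Num.sqrt (1 - 2 * - (lJ i / M) * v))^-1; split.
    by rewrite (normal_law_mgf_sqr v0 lv x2).
  apply: (@le_trans _ _ (Num.sqrt (1 + y0))^-1).
    rewrite e1 lef_pV2 ?posrE ?sqrtr_gt0; [|lra..].
    by rewrite ler_wsqrtr// lerD2l.
  apply: le_trans (invsqrt_le_expRN y00 y01) _.
  by rewrite ler_expR lerN2 /y0 le_eqVlt; apply/orP; left; apply/eqP; field; rewrite !gt_eqF.
- by apply: measurable_lt_set => //; exact: measurable_cst.
- move=> w /= h.
  rewrite [leRHS](_ : _ = - (wform w u / M)); first by rewrite lerN2 ler_pM2r ?invr_gt0// ltW.
  by rewrite wformE mulr_suml -sumrN; apply: eq_bigr => j _; ring.
Qed.

(** The net with [K = 2] has at most [expR (4 n)] points and each fails with probability at most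
    [expR (- 5 n)]. *)
Lemma conc_upper : whp P (expR (- n%:R))
  (fun w => forall u, wform w u <= 80 / eps * (L + n%:R * M) * dotv u u).
Proof.
have [s [ss s1 snet]] := @net_exists R n 2 isT.
(* The first term cancels the drift in [tail_upper]; the second makes the exponent exactly
   [- 5 n]. *)
pose a := 2 / eps * L + 20 / eps * M * n%:R.
have h v : v \in s -> whp P (expR (- (5 * n%:R))) (fun w => wform w v <= a).
  move=> vs; apply: (@whp_prob [set w | (a < wform w v)%R]).
  - by apply: measurable_lt_set => //; exact: measurable_cst.
  - apply: le_trans (tail_upper _ (s1 _ vs)) _; rewrite lee_fin ler_expR.
    by rewrite le_eqVlt; apply/orP; left; apply/eqP; rewrite /a; field; rewrite !gt_eqF.
  - by move=> w /negP; rewrite -leNgt.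
apply: whp_imp (whp_all_seq (expR_ge0 _) h) => [|w hw u].
  apply: (@le_trans _ _ (expR (4 * n%:R) * expR (- (5 * n%:R)))).
    rewrite ler_wpM2r ?expR_ge0//; apply: le_trans ss _.
    rewrite -exprM; apply: le_trans (exp2_le_expR _) _.
    by rewrite ler_expR natrM.
  by rewrite -expRD ler_expR; lra.
have := net_upper (wform_ge0 w) (wformZ w) (wformD w) (wform_bounded w) snet hw u.
move/le_trans; apply; rewrite ler_wpM2r ?dotv_ge0//.
have h1 : 0 <= L / eps by rewrite divr_ge0// ltW.
by rewrite /a; move: h1; rewrite -!(mulrC eps^-1); lra.
Qed.

(** The net has at most [expR ((K + 2) n)] points, so each must fail with probability at most
    [expR (- (K + 3) n)]. This is what the assumption on [L] provides, and it is the origin of the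
    constant [b]. The second [expR (- n)] pays for [conc_upper], which controls the passage from the
    net to all vectors. *)
Lemma conc_lower (K : nat) : (2 <= K)%N -> 128 * (80 / eps) / eps <= K%:R ->
  16 * (K%:R + 3) / eps * (n%:R * M) <= L ->
  whp P (2 * expR (- n%:R)) (fun w => forall u, eps / 64 * L * dotv u u <= wform w u).
Proof.
move=> K2 KC hL.
have [s [ss s1 snet]] := @net_exists R n K (ltnW K2).
pose m := eps * L / 16.
have nM0 : 0 <= n%:R * M by rewrite mulr_ge0// ltW.
have hL' : 16 * (K%:R + 3) * (n%:R * M) <= eps * L.
  move: hL; rewrite mulrAC ler_pdivrMr// [L * _]mulrC; exact.
have h v : v \in s -> whp P (expR (- ((K%:R + 3) * n%:R))) (fun w => 4^-1 <= dotv v v -> m <= wform w v).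
  move=> vs; have [v4|v4] := boolP (4^-1 <= dotv v v); last first.
    exists set0; split => [||w _] //; first by rewrite measure0 lee_fin expR_ge0.
  apply: (@whp_prob [set w | (wform w v < m)%R]).
  - by apply: measurable_lt_set => //; exact: measurable_cst.
  - apply: le_trans (tail_lower _ v4) _; rewrite lee_fin ler_expR.
    have -> : m / M - eps * L / (8 * M) = - (eps * L / 16 / M) by rewrite /m; field; rewrite gt_eqF.
    rewrite lerN2 ler_pdivlMr// ler_pdivlMr//; lra.
  - by move=> w /negP; rewrite -leNgt.
have h2 := whp_all_seq (expR_ge0 _) h.
apply: whp_imp (whp_and h2 conc_upper) => [|w [hw hu] u].
  rewrite [leRHS]mulrDl mul1r lerD2r.
  apply: (@le_trans _ _ (expR ((K%:R + 2) * n%:R) * expR (- ((K%:R + 3) * n%:R)))).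
    rewrite ler_wpM2r ?expR_ge0//; apply: le_trans ss _.
    rewrite -exprM; apply: le_trans (exp2_le_expR _) _.
    by rewrite ler_expR natrM natrD.
  by rewrite -expRD ler_expR; lra.
have C0 : 0 <= 80 / eps * (L + n%:R * M).
  by rewrite mulr_ge0 ?divr_ge0 ?addr_ge0// ltW.
have := net_lower (wform_ge0 w) (wformZ w) (wformD w) K2 snet hu C0 hw u.
apply: le_trans; rewrite ler_wpM2r ?dotv_ge0//.
have K0 : 2 <= K%:R :> R by rewrite ler_nat.
have nML : n%:R * M <= L.
  have := ler_piMl L0 eps1; have : 0 <= K%:R * (n%:R * M) by rewrite mulr_ge0.
  lra.
(* The net error uses up half of [m / 2 = eps * L / 32]; the size required of [K] comes from
   here. *)
have step : 80 / eps * (L + n%:R * M) / K%:R ^+ 2 <= eps * L / 64.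
  rewrite ler_pdivrMr ?exprn_gt0//; last lra.
  move: KC; rewrite ler_pdivrMr//; have : 0 <= 80 / eps by rewrite divr_ge0// ltW.
  move: (80 / eps) => c c0 KC.
  apply: (@le_trans _ _ (2 * c * L)); first by have := ler_wpM2l c0 nML; lra.
  have h1 := ler_wpM2r L0 KC.
  have eL : 0 <= eps * L by rewrite mulr_ge0// ltW.
  have K1 : K%:R <= K%:R ^+ 2 :> R by rewrite expr2 ler_peMl; lra.
  have h3 := ler_wpM2l eL K1; lra.
by rewrite /m; lra.
Qed.

End weighted.

(** The characteristic function of the combination decays at rate [eps / 4], because the squared
    coefficients sum to at least 1/4. With [s ^+ 2 * eps = 4 * expR 3] the factor per dimension is
    [(1 + expR 3)^(-1/2)], below [expR (- 3/2)]. *)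
Lemma combination_small_ball m (f : 'I_m -> 'I_p) (a : 'cV[R]_m) (s : R) : 0 < s ->
  s ^+ 2 * eps = 4 * expR 3 -> injective f ->
  4^-1 <= dotv a a ->
  Ex P (fun w => expR (- (s ^+ 2 / 2) *
     dotv (\sum_k a k 0 *: y (f k) w) (\sum_k a k 0 *: y (f k) w))) <= expR (- (3 / 2 * n%:R)).
Proof.
move=> s0 sE fI a4.
(* The coefficients carried along [f] to all of ['I_p], zero off its image, so that the independence
   of the whole family applies. *)
pose c i := \sum_k if f k == i then a k 0 else 0.
have cf k : c (f k) = a k 0.
  rewrite /c (bigD1 k)//= eqxx big1 ?addr0// => k' /negbTE kk'.
  by rewrite (inj_eq fI) kk'.
have cE (V : nmodType) (F : R -> 'I_p -> V) : (forall i, F 0 i = 0) ->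
    \sum_i F (c i) i = \sum_k F (a k 0) (f k).
  move=> F0.
  rewrite (bigID [pred i | [exists k, f k == i]])/= [X in _ + X]big1 ?addr0; last first.
    move=> i /existsPn h; rewrite /c big1 ?F0// => k _; by rewrite (negbTE (h k)).
  rewrite (eq_bigl (fun i => i \in [set f k | k : 'I_m])); last first.
    move=> i; apply/existsP/imsetP => [[k /eqP <-]|[k _ ->]]; by exists k.
  rewrite big_imset/=; last by move=> k1 k2 _ _ /fI.
  by apply: eq_big => [k|k _]; rewrite ?inE// cf.
pose Y w := \sum_i c i *: y i w.
have YE w : \sum_k a k 0 *: y (f k) w = Y w.
  by rewrite /Y (cE _ (fun x i => x *: y i w))// => i; rewrite scale0r.
have -> : Ex P (fun w => expR (- (s ^+ 2 / 2) *
     dotv (\sum_k a k 0 *: y (f k) w) (\sum_k a k 0 *: y (f k) w))) =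
   Ex P (fun w => expR (- (s ^+ 2 / 2) * dotv (Y w) (Y w))).
  by apply: eq_Ex => w; rewrite !YE.
have dY v w : dotv v (Y w) = \sum_i c i * dotv v (y i w).
  by rewrite /Y dotv_sumr; apply: eq_bigr => i _; rewrite dotvZr.
have mY : random_mx Y.
  move=> i j; rewrite (ord1 j).
  have -> : (fun w => Y w i 0) = (fun w => \sum_k c k * dotv (delta_mx i 0) (y k w)).
    apply/funext => w; rewrite -dY /dotv trmx_delta -rowE mxE; congr (Y w _ _).
  by apply: measurable_bigsum => k _; exact: measurable_funM.
apply: (@le_trans _ _ ((Num.sqrt (1 + s ^+ 2 * (eps / 4)))^-1 ^+ n)).
  apply: small_ball => //; [by rewrite divr_gt0|move=> v].
  have -> : Ex P (fun w => cos (dotv v (Y w))) = Ex P (fun w => cos (\sum_i c i * dotv v (y i w))).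
    by apply: eq_Ex => w; rewrite dY.
  have yl' i : exists r, [/\ eps * dotv v v <= r, 0 <= r & normal_law P (fun w => dotv v (y i w)) r].
    have [r [r1 _ r2]] := yl i v; exists r; split => //.
    by apply: le_trans r1; rewrite mulr_ge0 ?dotv_ge0// ltW.
  have /choice[r hr] := yl'.
  rewrite (Ex_cos_sum_indep GT indepG); first last.
  - by move=> i; have [_ r0 lr] := hr i; have := normal_law_sin r0 lr (c i).
  - move=> i; apply: (@meas_in_comp _ _ T (G i) _ (fun x => c i * x)) => //; exact: measurable_funM.
  rewrite (eq_bigr (fun i => expR (- (r i * c i ^+ 2 / 2)))) => [|i _]; last first.
    by have [_ r0 lr] := hr i; exact: (normal_law_cos r0 lr).
  rewrite -expR_sum ler_expR sumrN lerN2 -mulr_suml ler_pM2r//.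
  apply: (@le_trans _ _ (\sum_i eps * dotv v v * c i ^+ 2)).
    rewrite -mulr_sumr (cE _ (fun x _ => x ^+ 2)) => [|i]; last by rewrite expr0n.
    move: a4; rewrite dotvE; under eq_bigr do rewrite -expr2.
    have := mulr_ge0 (ltW eps0) (dotv_ge0 v).
    move=> h0 h4; rewrite (_ : eps / 4 * dotv v v = eps * dotv v v * 4^-1); last by ring.
    exact: ler_wpM2l.
  by apply: ler_sum => i _; have [r1 _ _] := hr i; rewrite ler_wpM2r ?sqr_ge0.
have -> : s ^+ 2 * (eps / 4) = expR 3 by rewrite mulrA sE; field.
rewrite (_ : - (3 / 2 * n%:R) = n%:R * (- (3 / 2))); last by ring.
rewrite expRM_natl; apply: lerXn2r; rewrite ?nnegrE ?expR_ge0 ?invr_ge0 ?sqrtr_ge0//.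
have e3 := expR_gt0 (3 : R).
have q0 : 0 < 1 + expR 3 :> R by lra.
rewrite expRN lef_pV2 ?posrE ?expR_gt0 ?sqrtr_gt0//.
rewrite -(@ler_pXn2r _ 2)// ?nnegrE ?expR_ge0 ?sqrtr_ge0//.
rewrite sqr_sqrtr; last lra.
rewrite -expRM_natl (_ : 2%:R * (3 / 2) = 3 :> R); last by field.
lra.
Qed.

(** The net lives in the coefficient space of dimension [#|J|], so it has at most [expR (n / 2)]
    points once [2 (K + 2) #|J| <= n], while each point fails with probability at most
    [expR (- n)]. *)
Lemma conc_sv (J : pred 'I_p) (K : nat) (s : R) : (2 <= K)%N -> 0 < s ->
  s ^+ 2 * eps = 4 * expR 3 ->
  8 * (80 / eps) * s ^+ 2 <= K%:R -> (2 * (K + 2) * #|J| <= n)%N ->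
  whp P (expR (- (n%:R / 2)) + expR (- n%:R)) (fun w => forall a : 'I_p -> R,
    (forall j, ~~ J j -> a j = 0) ->
    n%:R / (4 * s ^+ 2) * \sum_j a j ^+ 2 <=
    dotv (\sum_j a j *: y j w) (\sum_j a j *: y j w)).
Proof.
move=> K2 s0 sE KC Jn.
have s20 : 0 < s ^+ 2 by rewrite exprn_gt0.
pose V w (a : 'cV[R]_#|J|) := \sum_k a k 0 *: y (enum_val k) w.
pose Q w a := dotv (V w a) (V w a).
have [S [SS S1 Snet]] := @net_exists R #|J| K (ltnW K2).
pose m := n%:R / s ^+ 2.
have mV v : random_mx (V ^~ v).
  move=> i j; rewrite (ord1 j).
  have -> : (fun w => V w v i 0) = (fun w => \sum_k v k 0 * dotv (delta_mx i 0) (y (enum_val k) w)).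
    apply/funext => w; rewrite /V summxE; apply: eq_bigr => k _.
    by rewrite mxE /dotv trmx_delta -rowE mxE.
  by apply: measurable_bigsum => k _; exact: measurable_funM.
have mQ v : measurable_fun setT (fun w => Q w v) by exact: measurable_dotv.
have mE v : measurable_fun setT (fun w => expR (- (s ^+ 2 / 2) * Q w v)).
  by apply: measurableT_comp => //; exact: measurable_funM.
have Q0 w v : 0 <= Q w v by exact: dotv_ge0.
have h v : v \in S -> whp P (expR (- n%:R)) (fun w => 4^-1 <= dotv v v -> m <= Q w v).
  move=> vs; have [v4|v4] := boolP (4^-1 <= dotv v v); last first.
    exists set0; split => [||w _] //; first by rewrite measure0 lee_fin expR_ge0.
  apply: (@whp_prob [set w | (Q w v < m)%R]).
  - by apply: measurable_lt_set => //; exact: measurable_cst.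
  - have L1E : L1 P (fun w => expR (- (s ^+ 2 / 2) * Q w v)).
      apply: (@L1_bounded _ _ _ P _ 1) => // w.
      rewrite ger0_norm ?expR_ge0// -expR0 ler_expR mulNr oppr_le0.
      by rewrite mulr_ge0// divr_ge0// ltW.
    apply: (@markov_fun _ _ _ P _ (fun w => expR (n%:R / 2) * expR (- (s ^+ 2 / 2) * Q w v))).
    + by apply: measurable_lt_set => //; exact: measurable_cst.
    + by apply: measurable_funM.
    + by move=> w; rewrite mulr_ge0 ?expR_ge0.
    (* Below the threshold [m = n / s^2] the small-ball weight exceeds [expR (- n / 2)]; its mean
       [expR (- 3 n / 2)] leaves [expR (- n)]. *)
    + move=> w /= hw; rewrite -expRD -[leLHS]expR0 ler_expR.
      move: hw; rewrite ltr_pdivlMr// => hw; lra.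
    + rewrite (ExE (L1Z _ L1E)) lee_fin (@ExZ _ _ _ P)//.
      apply: (@le_trans _ _ (expR (n%:R / 2) * expR (- (3 / 2 * n%:R)))).
        rewrite ler_wpM2l ?expR_ge0//; exact: (combination_small_ball s0 sE enum_val_inj).
      by rewrite -expRD ler_expR; lra.
  - by move=> w /negP; rewrite -leNgt.
have h2 := whp_all_seq (expR_ge0 _) h.
have l1 j : J j -> 0 <= (1 : R) <= 1 by rewrite ler01 lexx.
have hup := conc_upper ltr01 l1.
have n1 : (2 * (K%:R + 2) * #|J|%:R : R) <= n%:R by rewrite -natrD -!natrM ler_nat.
have K0 : 2 <= K%:R :> R by rewrite ler_nat.
apply: whp_imp (whp_and h2 hup) => [|w [hw hu] a aJ].
  rewrite lerD2r; apply: (@le_trans _ _ (expR ((K%:R + 2) * #|J|%:R) * expR (- n%:R))).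
    rewrite ler_wpM2r ?expR_ge0//; apply: le_trans SS _.
    rewrite -exprM; apply: le_trans (exp2_le_expR _) _.
    by rewrite ler_expR natrM natrD.
  by rewrite -expRD ler_expR; lra.
have Jsum (W : nmodType) (F : 'I_p -> W) : \sum_(j | J j) F j = \sum_(k < #|J|) F (enum_val k).
  exact: (big_enum_val (A := J)).
have C0 : 0 <= 160 / eps * n%:R by apply: mulr_ge0 => //; apply: divr_ge0 => //; exact: ltW.
(* Upper bound by duality: [Q w v] is the inner product of [v] with the vector [g] of products
   [<V w v, y_j>]. [conc_upper] at [V w v] bounds the squared norm of [g] by a multiple of [Q w v]
   itself, and one factor cancels. *)
have Qup v : Q w v <= 160 / eps * n%:R * dotv v v.
  pose q := Q w v; have q0 : 0 <= q by exact: Q0.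
  have qE : q = \sum_(k < #|J|) v k 0 * dotv (V w v) (y (enum_val k) w).
    by rewrite /q /Q {2}/V dotv_sumr; apply: eq_bigr => k _; rewrite dotvZr.
  have h1 : \sum_(k < #|J|) dotv (V w v) (y (enum_val k) w) ^+ 2 <= 160 / eps * n%:R * q.
    have := hu (V w v); rewrite /wform.
    rewrite Jsum => h1; apply: le_trans (le_trans _ h1) _.
      by apply: ler_sum => k _; rewrite mul1r.
    rewrite ler_wpM2r// mulr1 sumr_const.
    have J1 : #|J|%:R <= n%:R :> R.
      by apply: le_trans n1; rewrite ler_peMl//; lra.
    have e0 : 0 <= 80 / eps by apply: divr_ge0 => //; exact: ltW.
    have := ler_wpM2l e0 J1; lra.
  pose g : 'cV[R]_#|J| := \col_k dotv (V w v) (y (enum_val k) w).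
  have h2' := cauchy_schwarz v g.
  have gv : dotv v g = q by rewrite qE dotvE; apply: eq_bigr => k _; rewrite mxE.
  have gg : dotv g g <= 160 / eps * n%:R * q.
    apply: le_trans h1; rewrite dotvE le_eqVlt; apply/orP; left; apply/eqP.
    by apply: eq_bigr => k _; rewrite !mxE expr2.
  rewrite -/q; have [->|qn] := eqVneq q 0; first by rewrite mulr_ge0// dotv_ge0.
  have qp : 0 < q by rewrite lt_neqAle eq_sym qn.
  have := ler_wpM2l (dotv_ge0 v) gg; rewrite gv in h2'.
  move/(le_trans h2'); rewrite expr2 [leRHS](_ : _ = 160 / eps * n%:R * dotv v v * q); last by ring.
  by rewrite ler_pM2r.
have QZ c v : Q w (c *: v) = c ^+ 2 * Q w v.
  rewrite /Q (_ : V w (c *: v) = c *: V w v); first by rewrite dotvZl dotvZr; ring.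
  by rewrite /V scaler_sumr; apply: eq_bigr => k _; rewrite scalerA mxE.
have QD u v : Q w (u + v) <= 2 * Q w u + 2 * Q w v.
  rewrite /Q (_ : V w (u + v) = V w u + V w v); first exact: dotv_parallelogram.
  by rewrite /V -big_split; apply: eq_bigr => k _; rewrite mxE scalerDl.
have := net_lower (Q0 w) QZ QD K2 Snet Qup C0 hw (\col_(k < #|J|) a (enum_val k)).
have aE (W : nmodType) (F : R -> 'I_p -> W) : (forall i, F 0 i = 0) ->
    \sum_i F (a i) i = \sum_(k < #|J|) F (a (enum_val k)) (enum_val k).
  move=> F0; rewrite (bigID J)/= [X in _ + X]big1 ?addr0; last by move=> i /aJ ->.
  exact: Jsum.
have -> : Q w (\col_(k < #|J|) a (enum_val k)) = dotv (\sum_j a j *: y j w) (\sum_j a j *: y j w).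
  rewrite (aE _ (fun x i => x *: y i w)) => [|i]; last by rewrite scale0r.
  by rewrite /Q /V; congr dotv; apply: eq_bigr => k _; rewrite mxE.
have -> : dotv (\col_(k < #|J|) a (enum_val k)) (\col_(k < #|J|) a (enum_val k)) = \sum_j a j ^+ 2.
  rewrite (aE _ (fun x _ => x ^+ 2)) => [|i]; last by rewrite expr0n.
  by rewrite dotvE; apply: eq_bigr => k _; rewrite !mxE expr2.
apply: le_trans; apply: ler_wpM2r; first by apply: sumr_ge0 => j _; exact: sqr_ge0.
have K1 : K%:R <= K%:R ^+ 2 :> R by rewrite expr2 ler_peMl; lra.
(* The net error costs at most half of [m / 2 = 2 * (n / (4 s^2))]. *)
have step : 160 / eps * n%:R / K%:R ^+ 2 <= n%:R / (4 * s ^+ 2).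
  rewrite ler_pdivrMr ?exprn_gt0//; last lra.
  rewrite [leRHS]mulrAC ler_pdivlMr; last by rewrite mulr_gt0.
  have := ler_wpM2l (ler0n R n) (le_trans KC K1); move: (s ^+ 2) (K%:R ^+ 2) => x z.
  by move: (eps^-1) => e; lra.
have -> : m / 2 = 2 * (n%:R / (4 * s ^+ 2)) by rewrite /m; move: (s ^+ 2) s20 => x x0; field; rewrite gt_eqF.
lra.
Qed.
End concentration.

(** * Random matrices and the risk *)

Section random_matrices.
Context {R : realType} {d : measure_display} {T : measurableType d}.

Lemma measurable_inv : measurable_fun setT (@GRing.inv R).
Proof.
rewrite (_ : setT = [set 0] `|` ~` [set 0]); last by rewrite setUv.
apply/measurable_funU => //; first exact: measurableC.
split.
  exact: measurable_fun_set1.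
apply: open_continuous_measurable_fun => [|x].
  by rewrite openC; exact: closed_eq.
rewrite inE /= => x0; apply: inv_continuous; exact/eqP.
Qed.

Lemma random_mxM m n q (X : T -> 'M[R]_(m, n)) (Y : T -> 'M[R]_(n, q)) :
  random_mx X -> random_mx Y -> random_mx (fun w => X w *m Y w).
Proof.
move=> mX mY i j; under eq_fun do rewrite mxE.
by apply: measurable_bigsum => k _; exact: measurable_funM.
Qed.

Lemma random_mxT m n (X : T -> 'M[R]_(m, n)) : random_mx X -> random_mx (fun w => (X w)^T).
Proof.
move=> mX i j; rewrite (_ : (fun w => _) = (fun w => X w j i))//.
by apply/funext => w; rewrite mxE.
Qed.

Lemma measurable_det n (X : T -> 'M[R]_n) : random_mx X -> measurable_fun setT (fun w => \det (X w)).
Proof.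
move=> mX; rewrite /determinant; apply: measurable_bigsum => s _.
by apply: measurable_funM => //; apply: measurable_bigprod => i _.
Qed.

Lemma random_mx_invmx n (X : T -> 'M[R]_n) : random_mx X -> random_mx (fun w => invmx (X w)).
Proof.
move=> mX i j; have mdet := measurable_det mX.
(* On singular matrices [invmx] is the identity function; elsewhere the adjugate formula is
   measurable. *)
have -> : (fun w => invmx (X w) i j) =
   (fun w => if \det (X w) == 0 then X w i j else (\det (X w))^-1 * \adj (X w) i j).
  apply/funext => w; rewrite /invmx unitmxE unitfE.
  by have [//|_] := eqVneq; rewrite mxE.
have mb : measurable_fun setT (fun w => \det (X w) == 0).
  by apply: measurable_fun_eqr => //; exact: measurable_cst.
apply: measurable_fun_ifT => //.
apply: measurable_funM; first exact: (measurableT_comp measurable_inv).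
under eq_fun do rewrite mxE /cofactor.
apply: measurable_funM => //; apply: measurable_det => k l.
rewrite (_ : (fun w => _) = (fun w => X w (lift j k) (lift i l)))//.
by apply/funext => w; rewrite !mxE.
Qed.

End random_matrices.

Section sigma_mx.
Context {R : realType} {d : measure_display} {T : measurableType d}.

Definition entry_events m n (X : T -> 'M[R]_(m, n)) : set (set T) :=
  \bigcup_(ij in [set: 'I_m * 'I_n])
    preimage_set_system setT (fun w => X w ij.1 ij.2) measurable.

(** Moves to the measurable space generated by the entries, where closure properties of measurable
    functions can be used. *)
Lemma sigma_mxP m n (X : T -> 'M[R]_(m, n)) (f : T -> R) :
  @measurable_fun _ _ (g_sigma_algebraType (entry_events X)) _ setT f <-> meas_in (sigma_mx X) f.
Proof.
split => [mf B mB|mf _ B mB]; last by rewrite setTI; exact: mf.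
by have := mf measurableT _ mB; rewrite setTI.
Qed.

Lemma sigma_mx_entry m n (X : T -> 'M[R]_(m, n)) i j : meas_in (sigma_mx X) (fun w => X w i j).
Proof.
move=> B mB; apply: sub_gen_smallest; exists (i, j) => //=; exists B => //.
by rewrite setTI.
Qed.

Lemma sigma_mx_random m n (X : T -> 'M[R]_(m, n)) :
  @random_mx R _ (g_sigma_algebraType (entry_events X)) m n X.
Proof. by move=> i j; apply/sigma_mxP; exact: sigma_mx_entry. Qed.

Lemma sigma_mx_sub m n (X : T -> 'M[R]_(m, n)) (H : set (set T)) : sigma_algebra setT H ->
  (forall i j, meas_in H (fun w => X w i j)) -> forall A, sigma_mx X A -> H A.
Proof.
move=> sH XH; apply: smallest_sub => // A [[i j] _] [B mB <-].
by rewrite setTI; exact: XH.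
Qed.

Lemma sigma_mx_measurable m n (X : T -> 'M[R]_(m, n)) : random_mx X ->
  forall A, sigma_mx X A -> measurable A.
Proof.
move=> mX; apply: sigma_mx_sub => [|i j B mB]; first exact: sigma_algebra_measurable.
by rewrite -[X in measurable X]setTI; exact: mX.
Qed.

Lemma sigma_mx_sigma_mx m n q r (X : T -> 'M[R]_(m, n)) (Y : T -> 'M[R]_(q, r)) :
  (forall i j, meas_in (sigma_mx Y) (fun w => X w i j)) ->
  forall A, sigma_mx X A -> sigma_mx Y A.
Proof. by apply: sigma_mx_sub; exact: smallest_sigma_algebra. Qed.

End sigma_mx.

Section gaussian_vectors.
Context {R : realType} {d : measure_display} {T : measurableType d}.
Variable P : probability T R.

Lemma gaussian_law n (Z : T -> 'cV[R]_n) S u : gaussian P Z S ->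
  normal_law P (fun w => dotv u (Z w)) (dotv u (S *m u)).
Proof.
move=> [mZ lZ]; split; last by move=> B mB; exact: lZ.
by apply: measurable_dotv => //; exact: random_mx_cst.
Qed.

Lemma gaussian_L1 n (Z : T -> 'cV[R]_n) S u : possemidef S -> gaussian P Z S ->
  L1 P (fun w => dotv u (Z w)).
Proof. by move=> [_ S0] gZ; exact: normal_law_L1 (S0 u) (gaussian_law u gZ). Qed.

Lemma gaussian_mean n (Z : T -> 'cV[R]_n) S u : possemidef S -> gaussian P Z S ->
  Ex P (fun w => dotv u (Z w)) = 0.
Proof. by move=> [_ S0] gZ; exact: normal_law_mean (S0 u) (gaussian_law u gZ). Qed.

(** [gaussian] gives the laws of single functionals only; covariances are recovered from variances
    of sums and differences. *)
Lemma polarization n (u v z : 'cV[R]_n) : dotv u z * dotv v z =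
  4^-1 * (dotv (u + v) z ^+ 2 - dotv (u - v) z ^+ 2).
Proof. by rewrite dotvDl dotvBl; field. Qed.

Lemma gaussian_L1M n (Z : T -> 'cV[R]_n) S u v : possemidef S -> gaussian P Z S ->
  L1 P (fun w => dotv u (Z w) * dotv v (Z w)).
Proof.
move=> [_ S0] gZ; under eq_fun do rewrite polarization.
by apply: L1Z; apply: L1B; apply: normal_law_L1_sqr (S0 _) (gaussian_law _ gZ).
Qed.

Lemma gaussian_cov n (Z : T -> 'cV[R]_n) S u v : possemidef S -> gaussian P Z S ->
  Ex P (fun w => dotv u (Z w) * dotv v (Z w)) = dotv u (S *m v).
Proof.
move=> [Ssym S0] gZ.
have L u' := normal_law_L1_sqr (S0 u') (gaussian_law u' gZ).
have -> : Ex P (fun w => dotv u (Z w) * dotv v (Z w)) =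
   Ex P (fun w => 4^-1 * (dotv (u + v) (Z w) ^+ 2 - dotv (u - v) (Z w) ^+ 2)).
  by apply: eq_Ex => w; rewrite polarization.
rewrite (@ExZ _ _ _ P); last exact: L1B.
rewrite (@ExB _ _ _ P)//.
rewrite !(normal_law_var (S0 _) (gaussian_law _ gZ)).
have e : dotv v (S *m u) = dotv u (S *m v) by rewrite dotv_mulmx Ssym dotvC.
by rewrite !(mulmxDr, mulmxN, dotvDl, dotvNl, dotvDr, dotvNr) e; field.
Qed.

End gaussian_vectors.

(** * The excess risk and its conditional expectation *)

Section risk.
Context {R : realType} {n p : nat} (M : model R n p).

(** The difference of squares is [<D, x>^2 + 2 <D, x> epsstar] with [D = beta - b]; the cross term
    has mean 0 by independence. *)
Lemma riskE (beta b : 'cV[R]_p) :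
  risk M beta b = (dotv (beta - b) (Sigma M *m (beta - b)))%:E.
Proof.
have Spsd := posdefW (Sigma_posdef M).
have gx := xstar_gaussian M.
pose D := beta - b.
have le : normal_law (Probs M) (epsstar M) (sigma_eps M ^+ 2).
  split => // B mB; rewrite /normal0 sqrf_eq0 gt_eqF ?sigma_eps_gt0//.
  by rewrite sqrtr_sqr gtr0_norm ?sigma_eps_gt0//; exact: (epsstar_normal M mB).
have Le : L1 (Probs M) (epsstar M) := normal_law_L1 (sqr_ge0 _) le.
have Lx : L1 (Probs M) (fun w => dotv D (xstar (m:=M) w)) := gaussian_L1 D Spsd gx.
have mD : meas_in (sigma_mx (xstar (m:=M))) (fun w => dotv D (xstar (m:=M) w)).
  apply/sigma_mxP; apply: measurable_dotv; first exact: random_mx_cst.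
  exact: sigma_mx_random.
have me : meas_in (preimage_set_system setT (epsstar M) measurable) (epsstar M).
  by move=> B mB; exists B => //; rewrite setTI.
have GT A : sigma_mx (xstar (m:=M)) A -> measurable A by apply: sigma_mx_measurable; exact: gx.1.
have HT A : preimage_set_system setT (epsstar M) measurable A -> measurable A.
  by move=> [B mB <-]; exact: measurable_funPT.
have := ExM_indep2 GT HT (test_indep (m:=M)) mD me Lx Le.
rewrite (gaussian_mean D Spsd gx) mul0r => cross.
have Lxe := L1M_indep2 GT HT (test_indep (m:=M)) mD me Lx Le.
have Lxx := gaussian_L1M D D Spsd gx.
rewrite /risk unlock -(gaussian_cov D D Spsd gx) -ExE//.
have -> : (fun w => (((ystar beta w - dotv b (xstar (m:=M) w)) ^+ 2 -
    (ystar beta w - dotv beta (xstar (m:=M) w)) ^+ 2))%:E) =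
    (fun w => (dotv D (xstar (m:=M) w) * dotv D (xstar (m:=M) w) +
       2 * (dotv D (xstar (m:=M) w) * epsstar M w))%:E).
  by apply/funext => w; congr EFin; rewrite /ystar /D dotvBl; ring.
rewrite !ExE//; last by apply: L1D => //; exact: L1Z.
by rewrite (@ExD _ _ _ (Probs M))//; [rewrite (@ExZ _ _ _ (Probs M))// cross mulr0 addr0|exact: L1Z].
Qed.

End risk.

Section conditional_lower_bound.
Context {R : realType} {d : measure_display} {T : measurableType d}.
Variable P : probability T R.
Variable H : set (set T).
Hypotheses (sH : sigma_algebra setT H) (HT : forall A, H A -> measurable A).

Lemma sigma_algebraE : H = @measurable _ (g_sigma_algebraType H).
Proof. by rewrite /measurable /= sigma_algebra_id. Qed.

Lemma sigma_algebraI A B : H A -> H B -> H (A `&` B).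
Proof. by rewrite sigma_algebraE; exact: measurableI. Qed.

Lemma meas_inP (f : T -> R) : meas_in H f <->
  @measurable_fun _ _ (g_sigma_algebraType H) _ setT f.
Proof.
split => [Hf _ B mB|mf B mB]; first by rewrite setTI -sigma_algebraE; exact: Hf.
by rewrite sigma_algebraE -[X in measurable X]setTI; exact: mf.
Qed.

(* Conditioning on the events where the finitely many coefficients [c k] are
   bounded avoids any integrability assumption. *)
Lemma cond_expectation_ge (f g : T -> \bar R) (F : T -> R) (I : finType)
    (c : I -> T -> R) (h delta : R) :
  is_cond_expectation P H f g -> (forall w, 0 <= f w)%E ->
  meas_in H F -> (forall i, meas_in H (c i)) ->
  (forall A (N : R), H A -> (forall w i, A w -> `|c i w| <= N) ->
     (\int[P]_(w in A) (F w)%:E <= \int[P]_(w in A) f w)%E) ->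
  0 <= h -> whp P delta (fun w => h <= F w) ->
  ((1 - delta)%:E <= P [set w | (h%:E <= g w)%E])%E.
Proof.
move=> [gH gint] f0 FH cH hA h0 [B [mB PB hB]].
have mF := meas_in_measurable HT FH.
have mg : measurable_fun setT g by move=> _ D mD; rewrite setTI; exact/HT/gH.
pose C w := \sum_i `|c i w|.
have CH : meas_in H C.
  apply/meas_inP; apply: measurable_bigsum => i _; apply: measurableT_comp => //.
  exact/meas_inP.
pose e k : R := (k.+1%:R)^-1.
have e0 k : 0 < e k by rewrite invr_gt0.
(* The events where [g] is at most [- e k]: null, since the integral of [f] over them is
   nonnegative. *)
pose A1 k := g @^-1` [set` `]-oo, (- e k)%:E]].
(* The events where [g] is nonnegative yet below [h] by at least [e k], although [F >= h], with
   coefficients bounded by [k]. Outside [B], the inequality [g < h] forces some [A1 k] or [A2 k]. *)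
pose A2 k := g @^-1` [set` `[0%E, (h - e k)%:E]] `&` F @^-1` [set` `[h, +oo[] `&`
  C @^-1` [set` `]-oo, k%:R]].
have A1H k : H (A1 k) by apply: gH; exact: emeasurable_itv.
have A2H k : H (A2 k).
  apply: sigma_algebraI; [apply: sigma_algebraI|]; [apply: gH|apply: FH|apply: CH]; [exact: emeasurable_itv|exact: measurable_itv..].
have PA1 k : P (A1 k) = 0%E.
  have mA : measurable (A1 k) := HT (A1H k).
  have gA w : A1 k w -> ((e k)%:E <= - g w)%E.
    by rewrite /A1 /= in_itv /= leeNr EFinN.
  have h1 : ((e k)%:E * P (A1 k) <= \int[P]_(w in A1 k) - g w)%E.
    rewrite -integral_cst//; apply: ge0_le_integral => //.
    - by move=> w _; rewrite lee_fin ltW.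
    - by apply: measurableT_comp => //; exact: measurable_funS mg.
  have h2 : (\int[P]_(w in A1 k) - g w <= 0)%E.
    rewrite -oppe_ge0 -integral_ge0N; last by move=> w /gA; apply: le_trans; rewrite lee_fin ltW.
    under eq_integral do rewrite oppeK.
    rewrite gint//; exact: integral_ge0.
  apply/eqP; rewrite eq_le measure_ge0 andbT.
  by have := le_trans h1 h2; rewrite pmule_rle0// lte_fin.
have PA2 k : P (A2 k) = 0%E.
  have mA : measurable (A2 k) := HT (A2H k).
  (* The chain runs through the integrals of [F], [f] and [g] over [A2 k]; since [e k > 0] it forces
     probability 0. *)
  have h1 : (h%:E * P (A2 k) <= (h - e k)%:E * P (A2 k))%E.
    rewrite -!integral_cst//; apply: (@le_trans _ _ (\int[P]_(w in A2 k) (F w)%:E)%E).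
      apply: ge0_le_integral => //.
      - by apply/measurable_EFinP; exact: measurable_funS mF.
      - by move=> w [[_]]; rewrite /= in_itv /= andbT lee_fin.
    apply: (@le_trans _ _ (\int[P]_(w in A2 k) f w)%E).
      apply: (hA _ k%:R) => // w i [_]; rewrite /= in_itv /=; apply: le_trans.
      by rewrite /C (bigD1 i)//= lerDl sumr_ge0.
    rewrite -gint//; apply: ge0_le_integral => //.
    - by move=> w [[]]; rewrite /= in_itv /= => /andP[].
    - exact: measurable_funS mg.
    - by move=> w [[]]; rewrite /= in_itv /= => /andP[].
  apply/eqP; rewrite eq_le measure_ge0 andbT.
  have fP : P (A2 k) \is a fin_num by exact: fin_num_measure.
  move: h1; rewrite -(fineK fP) -!EFinM !lee_fin.
  have := e0 k; move: (fine _) (e k) => x z; nra.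
have nullU : P.-negligible ((\bigcup_k A1 k) `|` (\bigcup_k A2 k)).
  have null A : H A -> P A = 0%E -> P.-negligible A by exists A; split => //; exact: HT.
  by apply: negligibleU; apply: negligible_bigcup => k; exact: null.
have mgh : measurable [set w | (g w < h%:E)%E].
  have -> : [set w | (g w < h%:E)%E] = g @^-1` [set` `]-oo, h%:E[].
    by apply/seteqP; split => w; rewrite /= in_itv.
  by apply: HT; apply: gH; exact: emeasurable_itv.
have sub : [set w | (g w < h%:E)%E] `<=` B `|` ((\bigcup_k A1 k) `|` (\bigcup_k A2 k)).
  move=> w /= gh; have [Bw|nB] := pselect (B w); [by left|right].
  have hF := hB _ nB.
  have arch (x : R) : 0 < x -> exists k, e k <= x.
    move=> x0; exists (Num.bound x^-1); rewrite /e -[leRHS]invrK lef_pV2 ?posrE ?invr_gt0//.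
    have := archi_boundP (ltW (_ : 0 < x^-1)); rewrite invr_gt0 => /(_ x0) /ltW /le_trans; apply.
    by rewrite ler_nat.
  have [g0|g0] := ltP (g w) 0%E.
    left; suff [k hk] : exists k, (g w <= (- e k)%:E)%E by exists k => //=; rewrite in_itv.
    move: g0; case: (g w) => [r|//|_]; last by exists 0; rewrite leNye.
    rewrite lte_fin -oppr_gt0 => /arch[k hk]; exists k; by rewrite lee_fin lerNr.
  right; move: (gh) (g0); case gwE : (g w) => [r|//|//]; rewrite lte_fin lee_fin -subr_gt0 => /arch[k1 hk1] r0.
  have [C0 Ck] : 0 <= C w /\ C w < (Num.bound (C w))%:R.
    have C0 : 0 <= C w by exact: sumr_ge0.
    by split=> //; exact: archi_boundP.
  exists (maxn k1 (Num.bound (C w))) => //; rewrite /A2 /= !in_itv /= gwE hF andbT !lee_fin r0 /=.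
  split; last first.
    by apply: (le_trans (ltW Ck)); rewrite ler_nat leq_maxr.
  split => //; rewrite lerBrDr -lerBrDl; apply: le_trans hk1.
  by rewrite /e lef_pV2 ?posrE// ler_nat ltnS leq_maxl.
have Pgh : (P [set w | (g w < h%:E)%E] <= delta%:E)%E.
  apply: le_trans PB; have [N [mN N0 sN]] := nullU.
  have mBN : measurable (B `|` N) by exact: measurableU.
  apply: (@le_trans _ _ (P (B `|` N))).
    apply: le_measure; rewrite ?inE//; apply: subset_trans sub _; exact: setUS.
  by have := @measureU2 _ _ _ P _ _ mB mN; rewrite [X in (_ <= _ + X)%E]N0 adde0.
have -> : [set w | (h%:E <= g w)%E] = ~` [set w | (g w < h%:E)%E].
  by apply/seteqP; split => w /=; rewrite leNgt => /negP.
rewrite probability_setC// EFinB; exact: leeB.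
Qed.
End conditional_lower_bound.

(** * Conditional second moments *)

Section bounded_coefficients.
Context {R : realType} {d : measure_display} {T : measurableType d}.
Variable P : probability T R.

Lemma integral_set_indicM (A : set T) (f : T -> R) :
  (\int[P]_(w in A) (f w)%:E = \int[P]_w (\1_A w * f w)%:E)%E.
Proof. by rewrite integral_set_indic; apply: eq_integral => w _; rewrite mulrC. Qed.

Lemma Ex_le_integral (f g : T -> R) : measurable_fun setT f -> (forall w, 0 <= f w) ->
  L1 P g -> (forall w, g w <= f w) -> ((Ex P g)%:E <= \int[P]_w (f w)%:E)%E.
Proof.
move=> mf f0 Lg gf; have [fy|fy] := eqVneq (\int[P]_w (f w)%:E)%E +oo%E; first by rewrite fy leey.
have Lf : L1 P f.
  apply/integrableP; split; first exact/measurable_EFinP.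
  under eq_integral do rewrite abse_EFin ger0_norm//.
  by rewrite ltey.
by rewrite ExE// lee_fin; exact: le_Ex.
Qed.

Definition bdd_in (H : set (set T)) (f : T -> R) :=
  meas_in H f /\ exists N, forall w, `|f w| <= N.

Section sigma_algebra.
Variable H : set (set T).
Hypotheses (sH : sigma_algebra setT H) (HT : forall A, H A -> measurable A).

Lemma meas_inM (f g : T -> R) : meas_in H f -> meas_in H g -> meas_in H (fun w => f w * g w).
Proof. by move=> /(meas_inP sH) mf /(meas_inP sH) mg; apply/(meas_inP sH); exact: measurable_funM. Qed.

Lemma bdd_inM f g : bdd_in H f -> bdd_in H g -> bdd_in H (fun w => f w * g w).
Proof.
move=> [mf [N fN]] [mg [N' gN]]; split; first exact: meas_inM.
by exists (N * N') => w; rewrite normrM ler_pM.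
Qed.

Lemma bdd_in_cst c : bdd_in H (fun=> c).
Proof. by split; [apply/(meas_inP sH); exact: measurable_cst|exists `|c|]. Qed.

Lemma bdd_inZ c f : bdd_in H f -> bdd_in H (fun w => c * f w).
Proof. by apply: bdd_inM; exact: bdd_in_cst. Qed.

Lemma bdd_in_sum (I : Type) (r : seq I) (p : pred I) (f : I -> T -> R) :
  (forall i, p i -> bdd_in H (f i)) -> bdd_in H (fun w => \sum_(i <- r | p i) f i w).
Proof.
move=> hf; split.
  by apply/(meas_inP sH); apply: measurable_bigsum => i /hf[/(meas_inP sH)].
elim: r => [|i r [N hN]]; first by exists 0 => w; rewrite big_nil normr0.
have [pi|npi] := boolP (p i); last by exists N => w; rewrite big_cons (negbTE npi).
have [_ [N' hN']] := hf i pi; exists (N' + N) => w; rewrite big_cons pi.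
by apply: le_trans (ler_normD _ _) _; exact: lerD.
Qed.

Lemma bdd_in_indic A c N : H A -> meas_in H c -> (forall w, A w -> `|c w| <= N) ->
  bdd_in H (fun w => \1_A w * c w).
Proof.
move=> HA Hc cN; split.
  apply: meas_inM => //; apply/(meas_inP sH); apply: measurable_indic.
  by rewrite -sigma_algebraE.
exists `|N| => w; rewrite indicE; have [|_] := boolP (w \in A); last by rewrite mul0r normr0.
by rewrite inE mul1r => /cN h; apply: le_trans h _; exact: ler_norm.
Qed.

Lemma bdd_in_L1 f : bdd_in H f -> L1 P f.
Proof. by move=> [mf [N fN]]; apply: L1_bounded fN; exact: meas_in_measurable HT mf. Qed.

End sigma_algebra.
End bounded_coefficients.

Section decomposition.
Context {R : realType} {n p : nat} (M : model R n p).
Implicit Types (w : Omega M).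

Definition rotated_design w : 'M[R]_(n, p) := design w *m Defs.rot M.
Definition gram_inv w : 'M[R]_n := invmx (design w *m (design w)^T).
(** [U^T X^T (X X^T)^-1]: the pseudo-inverse of the design in the eigenbasis of [Sigma]. *)
Definition noise_gain w : 'M[R]_(p, n) := (rotated_design w)^T *m gram_inv w.
(** When [X X^T] is invertible, the orthogonal projection on the kernel of the rotated design. *)
Definition bias_mx w : 'M[R]_p := 1%:M - noise_gain w *m rotated_design w.
Definition error_coord (theta : 'cV[R]_p) (e : 'cV[R]_n) w i :=
  \sum_j bias_mx w i j * theta j 0 - \sum_l noise_gain w i l * e l 0.

Lemma rot_unitary : (Defs.rot M)^T *m Defs.rot M = 1%:M.
Proof. by apply: mulmx1C; exact: rot_orthogonal. Qed.

Lemma risk_decomposition (beta : 'cV[R]_p) w :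
  risk M beta (interpolator beta w) =
  (\sum_i lam M 0 i * error_coord ((Defs.rot M)^T *m beta) (noise (m:=M) w) w i ^+ 2)%:E.
Proof.
rewrite riskE; congr EFin.
set D := beta - _; pose U := Defs.rot M.
have UU : U *m U^T = 1%:M := rot_orthogonal M.
have XE : design w = rotated_design w *m U^T by rewrite /rotated_design -mulmxA UU mulmx1.
have DE i : (U^T *m D) i 0 = error_coord (U^T *m beta) (noise (m:=M) w) w i.
  have -> : U^T *m D = bias_mx w *m (U^T *m beta) - noise_gain w *m noise (m:=M) w.
    rewrite /D /interpolator /response -/(gram_inv w) mulmxBr.
    have -> : U^T *m ((design w)^T *m gram_inv w *m (design w *m beta + noise (m:=M) w)) =
       noise_gain w *m (design w *m beta + noise (m:=M) w).
      by rewrite /noise_gain /rotated_design -/U (trmx_mul (design w)) !mulmxA.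
    rewrite mulmxDr /bias_mx mulmxBl mul1mx opprD addrA; congr (_ - _ - _).
    by rewrite {1}XE !mulmxA.
  rewrite /error_coord !mxE; congr (_ - _); rewrite ?mxE; apply: eq_bigr => j _ //.
rewrite (Sigma_spectral M) -/U -!mulmxA dotv_mulmx dotvE; apply: eq_bigr => i _.
by rewrite DE mul_diag_mx mxE DE; ring.
Qed.

Definition dsigma : set (set (Omega M)) := sigma_mx (@design R n p M).

Lemma random_noise_gain (d' : measure_display) (T' : measurableType d') (X : T' -> 'M[R]_(n, p)) :
  random_mx X -> random_mx (fun v => (X v *m Defs.rot M)^T *m invmx (X v *m (X v)^T)).
Proof.
move=> mX; apply: random_mxM.
  by apply: random_mxT; apply: random_mxM => //; exact: random_mx_cst.
by apply: random_mx_invmx; apply: random_mxM => //; exact: random_mxT.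
Qed.

Lemma noise_gain_in i l : meas_in dsigma (fun w => noise_gain w i l).
Proof. by apply/sigma_mxP; apply: random_noise_gain; exact: sigma_mx_random. Qed.

Lemma bias_mx_in i j : meas_in dsigma (fun w => bias_mx w i j).
Proof.
apply/sigma_mxP; rewrite /bias_mx.
have -> : (fun w => (1%:M - noise_gain w *m rotated_design w) i j) =
   (fun w => (1%:M : 'M[R]_p) i j - (noise_gain w *m rotated_design w) i j).
  by apply/funext => w; rewrite !mxE.
apply: measurable_funB; first exact: measurable_cst.
apply: random_mxM; first by apply: random_noise_gain; exact: sigma_mx_random.
by apply: random_mxM; [exact: sigma_mx_random|exact: random_mx_cst].
Qed.

End decomposition.

Section second_moments.
Context {R : realType} {d : measure_display} {T : measurableType d}.
Variable P : probability T R.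

Section noise_part.
Variables (n : nat) (E : T -> 'cV[R]_n) (S : 'M[R]_n) (H : set (set T)).
Hypotheses (S0 : possemidef S) (gE : gaussian P E S).
Hypotheses (sH : sigma_algebra setT H) (HT : forall A, H A -> measurable A).
Hypothesis EH : indep2 P (sigma_mx E) H.
Variables (a : 'I_n -> T -> R) (b : T -> R).
Hypotheses (ha : forall l, bdd_in H (a l)) (hb : bdd_in H b).

Let GT A : sigma_mx E A -> measurable A.
Proof. by apply: sigma_mx_measurable; exact: gE.1. Qed.

Let entryE w l : E w l 0 = dotv (delta_mx l 0) (E w).
Proof. by rewrite /dotv trmx_delta -rowE mxE. Qed.

Let L1E l : L1 P (fun w => E w l 0).
Proof. by under eq_fun do rewrite entryE; exact: gaussian_L1 S0 gE. Qed.

Let L1EE l m : L1 P (fun w => E w l 0 * E w m 0).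
Proof. by under eq_fun do rewrite !entryE; exact: gaussian_L1M S0 gE. Qed.

Let ExE0 l : Ex P (fun w => E w l 0) = 0.
Proof. by under eq_Ex do rewrite entryE; exact: gaussian_mean S0 gE. Qed.

Let ExEE l m : Ex P (fun w => E w l 0 * E w m 0) = S l m.
Proof.
under eq_Ex do rewrite !entryE; rewrite (gaussian_cov _ _ S0 gE).
by rewrite /dotv trmx_delta -rowE mxE -colE mxE.
Qed.

Let mE l : meas_in (sigma_mx E) (fun w => E w l 0).
Proof. exact: sigma_mx_entry. Qed.

Let mEE l m : meas_in (sigma_mx E) (fun w => E w l 0 * E w m 0).
Proof. by apply: meas_inM => //; exact: smallest_sigma_algebra. Qed.

Lemma noise_quadratic_split w : (\sum_l a l w * E w l 0) ^+ 2 - 2 * (\sum_l a l w * E w l 0) * b w =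
  \sum_l \sum_m (E w l 0 * E w m 0) * (a l w * a m w) + \sum_l E w l 0 * (- 2 * a l w * b w).
Proof.
congr (_ + _).
  rewrite expr2 mulr_suml; apply: eq_bigr => l _; rewrite mulr_sumr.
  by apply: eq_bigr => m _; ring.
by rewrite mulr_sumr mulr_suml -sumrN; apply: eq_bigr => l _; ring.
Qed.

Let ba l m : bdd_in H (fun w => a l w * a m w) := bdd_inM sH (ha l) (ha m).

Let bb l : bdd_in H (fun w => - 2 * a l w * b w) := bdd_inM sH (bdd_inZ sH (- 2) (ha l)) hb.

Let L1aa l m : L1 P (fun w => (E w l 0 * E w m 0) * (a l w * a m w)).
Proof. exact: (L1M_indep2 GT HT EH (mEE l m) (ba l m).1 (L1EE l m) (bdd_in_L1 P HT (ba l m))). Qed.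

Let L1ab l : L1 P (fun w => E w l 0 * (- 2 * a l w * b w)).
Proof. exact: (L1M_indep2 GT HT EH (mE l) (bb l).1 (L1E l) (bdd_in_L1 P HT (bb l))). Qed.

Let L1sum1 : L1 P (fun w => \sum_l \sum_m (E w l 0 * E w m 0) * (a l w * a m w)).
Proof. by apply: L1_sum => l _; apply: L1_sum => m _. Qed.

Let L1sum2 : L1 P (fun w => \sum_l E w l 0 * (- 2 * a l w * b w)).
Proof. by apply: L1_sum => l _. Qed.

Lemma noise_quadratic_L1 :
  L1 P (fun w => (\sum_l a l w * E w l 0) ^+ 2 - 2 * (\sum_l a l w * E w l 0) * b w).
Proof.
under eq_fun do rewrite noise_quadratic_split.
exact: L1D.
Qed.

(** The integrand is the squared error without its noise-free square. The term linear in the noise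
    has mean 0, and the covariances give the form of [S]; boundedness of [a] and [b] makes every
    product integrable. *)
Lemma noise_quadratic_Ex :
  Ex P (fun w => (\sum_l a l w * E w l 0) ^+ 2 - 2 * (\sum_l a l w * E w l 0) * b w) =
  Ex P (fun w => \sum_l \sum_m S l m * (a l w * a m w)).
Proof.
under eq_Ex do rewrite noise_quadratic_split.
rewrite (@ExD _ _ _ P)//.
rewrite (@Ex_sum _ _ _ P _ _ _ (fun l w => E w l 0 * _))// [X in _ + X]big1 ?addr0; last first.
  move=> l _; rewrite (ExM_indep2 GT HT EH (mE l) (bb l).1 (L1E l) (bdd_in_L1 P HT (bb l))).
  by rewrite ExE0 mul0r.
have Laa l m : L1 P (fun w => a l w * a m w) := bdd_in_L1 P HT (ba l m).
rewrite !(@Ex_sum _ _ _ P); first last.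
- by move=> l _; apply: L1_sum => m _.
- by move=> l _; apply: L1_sum => m _; exact: L1Z.
apply: eq_bigr => l _; rewrite !(@Ex_sum _ _ _ P)//; last by move=> m _; exact: L1Z.
apply: eq_bigr => m _; rewrite (@ExZ _ _ _ P)// -ExEE.
exact: (ExM_indep2 GT HT EH (mEE l m) (ba l m).1 (L1EE l m) (bdd_in_L1 P HT (ba l m))).
Qed.

Lemma noise_linear_L1 : L1 P (fun w => \sum_l a l w * E w l 0).
Proof.
apply: L1_sum => l _; under eq_fun do rewrite mulrC.
exact: (L1M_indep2 GT HT EH (mE l) (ha l).1 (L1E l) (bdd_in_L1 P HT (ha l))).
Qed.

End noise_part.

Section sign_part.
Variables (p : nat) (G H : set (set T)).
Hypotheses (sG : sigma_algebra setT G) (GT : forall A, G A -> measurable A).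
Hypotheses (sH : sigma_algebra setT H) (HT : forall A, H A -> measurable A).
Hypothesis GH : indep2 P G H.
Variables (s : 'I_p -> T -> R) (i : 'I_p).
Hypotheses (s1 : forall w, s i w ^+ 2 = 1) (sb : forall j, bdd_in G (s j)).
Hypotheses (si0 : Ex P (s i) = 0) (sij : forall j, j != i -> Ex P (fun w => s i w * s j w) = 0).
Variables (b : 'I_p -> T -> R) (c : T -> R).
Hypotheses (hb : forall j, bdd_in H (b j)) (hc : meas_in H c) (Lc : L1 P (fun w => b i w * c w)).

Let Ls j : L1 P (fun w => s i w * s j w) := bdd_in_L1 P GT (bdd_inM sG (sb i) (sb j)).
Let ms j : meas_in G (fun w => s i w * s j w) := (bdd_inM sG (sb i) (sb j)).1.
Let Lb j : L1 P (fun w => b i w * b j w) := bdd_in_L1 P HT (bdd_inM sH (hb i) (hb j)).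
Let mb j : meas_in H (fun w => b i w * b j w) := (bdd_inM sH (hb i) (hb j)).1.
Let mc : meas_in H (fun w => b i w * c w) := meas_inM sH (hb i).1 hc.

Let q w := (s i w * b i w) ^+ 2 + 2 * (s i w * b i w) * (\sum_(j | j != i) s j w * b j w - c w).

Lemma sign_quadratic_split w : q w =
  b i w * b i w + 2 * \sum_(j | j != i) (s i w * s j w) * (b i w * b j w)
   - 2 * (s i w * (b i w * c w)).
Proof.
have -> : \sum_(j | j != i) s i w * s j w * (b i w * b j w) =
    s i w * b i w * \sum_(j | j != i) s j w * b j w.
  by rewrite mulr_sumr; apply: eq_bigr => j _; ring.
by rewrite /q exprMn s1; ring.
Qed.

Let L1sb j : L1 P (fun w => (s i w * s j w) * (b i w * b j w)).
Proof. exact: (L1M_indep2 GT HT GH). Qed.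

Let L1sc : L1 P (fun w => s i w * (b i w * c w)).
Proof. exact: (L1M_indep2 GT HT GH (sb i).1 mc (bdd_in_L1 P GT (sb i)) Lc). Qed.

Let L1sum : L1 P (fun w => \sum_(j | j != i) (s i w * s j w) * (b i w * b j w)).
Proof. by apply: L1_sum => j _. Qed.

Lemma sign_quadratic_L1 : L1 P q.
Proof.
rewrite (funext sign_quadratic_split).
by apply: L1B; [apply: L1D => //; exact: L1Z|exact: L1Z].
Qed.

(** [q] is the square of [s_i b_i + (rest)] without the square of the rest. The signs are
    uncorrelated and centred, so only [b_i^2] survives. [c] will contain the unbounded noise, hence
    the separate assumption [Lc]. *)
Lemma sign_quadratic_Ex : Ex P q = Ex P (fun w => b i w * b i w).
Proof.
rewrite (funext sign_quadratic_split).
have L2 : L1 P (fun w => 2 * \sum_(j | j != i) (s i w * s j w) * (b i w * b j w)) := L1Z 2 L1sum.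
rewrite (ExB (L1D (Lb i) L2) (L1Z 2 L1sc)) (ExD (Lb i) L2) (ExZ 2 L1sum) (ExZ 2 L1sc).
rewrite (@Ex_sum _ _ _ P)// big1 => [|j ji].
  by rewrite (ExM_indep2 GT HT GH (sb i).1 mc (bdd_in_L1 P GT (sb i)) Lc) si0; ring.
by rewrite (ExM_indep2 GT HT GH (ms j) (mb j) (Ls j) (Lb j)) sij ?mul0r.
Qed.

End sign_part.
End second_moments.

Section conditional_bounds.
Context {R : realType} {n p : nat} (M : model R n p).
Local Notation P := (Prob M).
Local Notation H := (@dsigma R n p M).

Lemma random_design : random_mx (@design R n p M).
Proof.
apply: random_mxM; last exact: random_mx_cst.
apply: random_mxM; last exact: random_mx_cst.
move=> j i; under eq_fun do rewrite mxE.
apply: random_mxM; first exact: random_mx_cst.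
by have [] := z_gaussian M i.
Qed.

Lemma dsigma_sigma : sigma_algebra setT H.
Proof. exact: smallest_sigma_algebra. Qed.

Lemma dsigma_measurable A : H A -> measurable A.
Proof. by apply: sigma_mx_measurable; exact: random_design. Qed.

Let lam0 i : 0 <= lam M 0 i := ltW (lam_gt0 M i).

Lemma measurable_error_coord (theta : Omega M -> 'cV[R]_p) i : random_mx theta ->
  measurable_fun setT (fun w => error_coord (theta w) (noise (m:=M) w) w i).
Proof.
move=> mt; apply: measurable_funB; apply: measurable_bigsum => j _; apply: measurable_funM => //.
- by apply: meas_in_measurable dsigma_measurable _; exact: bias_mx_in.
- by apply: meas_in_measurable dsigma_measurable _; exact: noise_gain_in.
- exact: (noise_gaussian M).1.
Qed.

Lemma measurable_weighted_error A (theta : Omega M -> 'cV[R]_p) : measurable A -> random_mx theta ->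
  measurable_fun setT (fun w => \1_A w *
    \sum_i lam M 0 i * error_coord (theta w) (noise (m:=M) w) w i ^+ 2).
Proof.
move=> mA mt; apply: measurable_funM => //.
apply: measurable_bigsum => i _; apply: measurable_funM => //.
by apply: measurable_funX; exact: measurable_error_coord.
Qed.

Section truncation.
Variables (A : set (Omega M)) (N : R).
Hypotheses (HA : H A) (BN : forall w i j, A w -> `|bias_mx w i j| <= N)
  (GN : forall w i l, A w -> `|noise_gain w i l| <= N).

Let ba i j : bdd_in H (fun w => \1_A w * bias_mx w i j).
Proof. exact: (bdd_in_indic dsigma_sigma HA (bias_mx_in i j) (fun w => BN i j)). Qed.

Let ga i l : bdd_in H (fun w => \1_A w * noise_gain w i l).
Proof. exact: (bdd_in_indic dsigma_sigma HA (noise_gain_in i l) (fun w => GN i l)). Qed.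

Let indic2 (w : Omega M) : \1_A w * \1_A w = \1_A w :> R.
Proof. by rewrite indicE; case: (_ \in _); rewrite ?mulr1 ?mulr0. Qed.

Let mA : measurable A := dsigma_measurable HA.

Lemma indic_error theta e w i : \1_A w * error_coord theta e w i ^+ 2 =
  (\sum_j (\1_A w * bias_mx w i j) * theta j 0 - \sum_l (\1_A w * noise_gain w i l) * e l 0) ^+ 2.
Proof.
have -> : \sum_j \1_A w * bias_mx w i j * theta j 0 - \sum_l \1_A w * noise_gain w i l * e l 0 =
    \1_A w * error_coord theta e w i.
  rewrite /error_coord mulrBr !mulr_sumr; congr (_ - _); apply: eq_bigr => j _; ring.
by rewrite exprMn; congr (_ * _); rewrite expr2 indic2.
Qed.

(** Multiplying by the indicator of [A] makes the coefficients bounded. The squared error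
    [(b - c)^2] is bounded below by [c^2 - 2 c b], whose mean is the variance term. *)
Lemma conditional_noise_bound (beta : 'cV[R]_p) :
  (\int[P]_(w in A) (\sum_i lam M 0 i *
     \sum_l \sum_m Upsilon M l m * (noise_gain w i l * noise_gain w i m))%:E
   <= \int[P]_(w in A) risk_interpolator (fun=> beta) w)%E.
Proof.
pose th := (Defs.rot M)^T *m beta.
pose b i w := \sum_j (\1_A w * bias_mx w i j) * th j 0.
pose a i l w := \1_A w * noise_gain w i l.
have hb i : bdd_in H (b i).
  apply: (bdd_in_sum dsigma_sigma) => j _.
  by apply: (bdd_inM dsigma_sigma) => //; exact: bdd_in_cst dsigma_sigma _.
pose c i w := \sum_l a i l w * noise (m:=M) w l 0.
pose q i w := c i w ^+ 2 - 2 * c i w * b i w.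
have Upsd := posdefW (Upsilon_posdef M).
have Lq i : L1 P (q i) := noise_quadratic_L1 Upsd (noise_gaussian M) dsigma_sigma
  dsigma_measurable (noise_indep (m:=M)) (ga i) (hb i).
have Eq i := noise_quadratic_Ex Upsd (noise_gaussian M) dsigma_sigma
  dsigma_measurable (noise_indep (m:=M)) (ga i) (hb i).
have bS i : bdd_in H (fun w => \sum_l \sum_m Upsilon M l m * (a i l w * a i m w)).
  apply: (bdd_in_sum dsigma_sigma) => l _; apply: (bdd_in_sum dsigma_sigma) => m _.
  by apply: (bdd_inZ dsigma_sigma); apply: (bdd_inM dsigma_sigma); exact: ga.
have LS i := bdd_in_L1 P dsigma_measurable (bS i).
rewrite /risk_interpolator; under [X in (_ <= X)%E]eq_integral do rewrite risk_decomposition.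
rewrite (@integral_set_indicM _ _ _ P A) (@integral_set_indicM _ _ _ P A).
have -> : (fun w => (\1_A w * (\sum_i lam M 0 i *
    \sum_l \sum_m Upsilon M l m * (noise_gain w i l * noise_gain w i m)))%:E) =
   (fun w => (\sum_i lam M 0 i * \sum_l \sum_m Upsilon M l m * (a i l w * a i m w))%:E).
  apply/funext => w; congr EFin; rewrite mulr_sumr; apply: eq_bigr => i _.
  rewrite mulrCA; congr (_ * _); rewrite mulr_sumr; apply: eq_bigr => l _.
  by rewrite mulr_sumr; apply: eq_bigr => m _; rewrite -{1}indic2 /a; ring.
have LZ i : L1 P (fun w => lam M 0 i * \sum_l \sum_m Upsilon M l m * (a i l w * a i m w)) := L1Z _ (LS i).
have LZq i : L1 P (fun w => lam M 0 i * q i w) := L1Z _ (Lq i).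
rewrite ExE; last by apply: L1_sum => i _.
apply: (@le_trans _ _ (Ex P (fun w => \sum_i lam M 0 i * q i w))%:E).
  rewrite lee_fin !(@Ex_sum _ _ _ P)// le_eqVlt; apply/orP; left; apply/eqP.
  by apply: eq_bigr => i _; rewrite !(@ExZ _ _ _ P)// Eq.
apply: Ex_le_integral.
- by apply: measurable_weighted_error => //; exact: random_mx_cst.
- move=> w; apply: mulr_ge0; first by rewrite indicE.
  by apply: sumr_ge0 => i _; apply: mulr_ge0 => //; exact: sqr_ge0.
- by apply: L1_sum => i _.
- move=> w; rewrite mulr_sumr; apply: ler_sum => i _; rewrite mulrCA ler_wpM2l// indic_error.
  rewrite -/(b i w) -/(c i w) /q; have := sqr_ge0 (b i w); lra.
Qed.

(* Off a null set s_i is the +-1 valued t_i, which is bounded everywhere. *)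
Lemma conditional_sign_bound (betabar : 'cV[R]_p) (s beta : Omega M -> 'cV[R]_p) :
  sign_prior betabar s beta ->
  (\int[P]_(w in A) (\sum_i lam M 0 i * (bias_mx w i i * betabar i 0) ^+ 2)%:E
   <= \int[P]_(w in A) risk_interpolator beta w)%E.
Proof.
case=> ms spos sneg sind sdes sbeta.
pose G := sigma_mx s.
have sG : sigma_algebra setT G by exact: smallest_sigma_algebra.
have GT B : G B -> measurable B by exact: sigma_mx_measurable.
(* The signs are independent of design and noise jointly; the coefficients and the noise term are
   measurable for this larger sigma-algebra. *)
pose H2 := sigma_mx (fun w => row_mx (design w) (noise (m:=M) w)).
have sH2 : sigma_algebra setT H2 by exact: smallest_sigma_algebra.
have nH2 l : meas_in H2 (fun w => noise (m:=M) w l 0).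
  rewrite (_ : (fun w => _) = (fun w => row_mx (design w) (noise (m:=M) w) l (rshift p 0))).
    exact: sigma_mx_entry.
  by apply/funext => w; rewrite row_mxEr.
have HH2 B : H B -> H2 B.
  apply: sigma_mx_sigma_mx => l j.
  rewrite (_ : (fun w => _) = (fun w => row_mx (design w) (noise (m:=M) w) l (lshift 1 j))).
    exact: sigma_mx_entry.
  by apply/funext => w; rewrite row_mxEl.
have H2T B : H2 B -> measurable B.
  apply: sigma_mx_measurable => l j; rewrite -(fintype.splitK j); case: (fintype.split j) => k /=.
    by under eq_fun do rewrite row_mxEl; exact: random_design.
  by under eq_fun do rewrite row_mxEr; exact: (noise_gaussian M).1.
pose t (i : 'I_p) w : R := if s w i 0 == 1 then 1 else -1.
have t2 i w : t i w ^+ 2 = 1 by rewrite /t; case: ifP => _; rewrite ?sqrrN expr1n.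
have t1 i w : `|t i w| <= 1 by rewrite /t; case: ifP => _; rewrite ?normrN normr1.
pose Gi (i : 'I_p) := preimage_set_system setT (fun w => s w i 0) measurable.
have GiT i B : Gi i B -> measurable B.
  by move=> [C mC <-]; exact: ms.
have tGi i : meas_in (Gi i) (t i).
  have mt : measurable_fun setT (fun x : R => if x == 1 then 1 else -1 : R).
    apply: measurable_fun_ifT; [|exact: measurable_cst..].
    by apply: measurable_fun_eqr => //; exact: measurable_cst.
  move=> B mB; exists ((fun x : R => if x == 1 then 1 else -1 : R) @^-1` B); last by rewrite setTI.
  by rewrite -[X in measurable X]setTI; exact: mt.
have GiG i B : Gi i B -> G B.
  by move=> GiB; apply: sub_gen_smallest; exists (i, 0).
have bt i : bdd_in G (t i).
  by split; [move=> B mB; apply: GiG; exact: tGi|exists 1].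
have ms1 i (r : R) : measurable [set w | s w i 0 = r].
  rewrite (_ : [set w | _] = (fun w => s w i 0) @^-1` [set r])//.
  by rewrite -[X in measurable X]setTI; exact: ms.
have Lt i : L1 P (t i) := bdd_in_L1 P GT (bt i).
have Et i : Ex P (t i) = 0.
  have -> : Ex P (t i) = Ex P (fun w => 2 * \1_[set w | s w i 0 = 1] w - 1).
    apply: eq_Ex => w; rewrite /t indicE; case: eqP => h.
      by rewrite mem_set//=; ring.
    by rewrite memNset//=; ring.
  have L1i := L1_indic P (ms1 i 1).
  by rewrite (ExB (L1Z 2 L1i) (L1_cst P 1)) (ExZ 2 L1i) Ex_indic// Ex_cst spos /=; field.
(* Two factors are completed by constants 1 into a product over all indices, the form in which
   independence is available. *)
have Ett i j : j != i -> Ex P (fun w => t i w * t j w) = 0.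
  move=> ji; pose h k w : R := if (k == i) || (k == j) then t k w else 1.
  have -> : Ex P (fun w => t i w * t j w) = Ex P (fun w => \prod_k h k w).
    apply: eq_Ex => w; rewrite (bigD1 i)//= (bigD1 j)//= big1 ?mulr1.
      by rewrite /h !eqxx orbT.
    by move=> k /andP[/negbTE ki /negbTE kj]; rewrite /h ki kj.
  rewrite (Ex_prod_indep_bounded GiT sind).
  - rewrite (bigD1 i)//=; have -> : h i = t i by apply/funext => w; rewrite /h eqxx.
    by rewrite Et mul0r.
  - move=> k; rewrite (_ : h k = if (k == i) || (k == j) then t k else fun=> 1); last first.
      by apply/funext => w; rewrite /h; case: ifP.
    case: ifP => _; first exact: tGi.
    move=> B mB; have [B1|B1] := pselect (B 1).
      exists setT => //; rewrite setTI preimage_setT.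
      by apply/seteqP; split.
    exists set0 => //; rewrite setTI preimage_set0.
    by apply/seteqP; split.
  - by move=> k w; rewrite /h; case: ifP => _; rewrite ?normr1.
pose b i j w := (\1_A w * bias_mx w i j) * betabar j 0.
have bH2 (f : Omega M -> R) : bdd_in H f -> bdd_in H2 f.
  by move=> [mf [K fK]]; split; [move=> B mB; apply: HH2; exact: mf|exists K].
have hbH i j : bdd_in H (b i j).
  by apply: (bdd_inM dsigma_sigma) => //; exact: bdd_in_cst dsigma_sigma _.
have hb i j : bdd_in H2 (b i j) := bH2 _ (hbH i j).
pose a i l w := \1_A w * noise_gain w i l.
have ha i l : bdd_in H2 (a i l) := bH2 _ (ga i l).
pose c i w := \sum_l a i l w * noise (m:=M) w l 0.
have hc i : meas_in H2 (c i).
  apply/(meas_inP sH2); apply: measurable_bigsum => l _; apply: measurable_funM.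
    by apply/(meas_inP sH2); exact: (ha i l).1.
  exact/(meas_inP sH2).
have Upsd := posdefW (Upsilon_posdef M).
have Lc i : L1 P (fun w => b i i w * c i w).
  have := noise_linear_L1 Upsd (noise_gaussian M) dsigma_measurable (noise_indep (m:=M))
    (fun l => bdd_inM dsigma_sigma (hbH i i) (ga i l)).
  by apply: etrans; congr L1; apply/funext => w; rewrite /c mulr_sumr; apply: eq_bigr => l _; rewrite mulrA.
pose q i w := (t i w * b i i w) ^+ 2 + 2 * (t i w * b i i w) *
   (\sum_(j | j != i) t j w * b i j w - c i w).
have Lq i : L1 P (q i) := sign_quadratic_L1 sG GT sH2 H2T sdes (t2 i) bt (hb i) (hc i) (Lc i).
have Eq i := sign_quadratic_Ex sG GT sH2 H2T sdes (t2 i) bt (Et i) (Ett i) (hb i) (hc i) (Lc i).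
have as_eq : (\int[P]_(w in A) risk_interpolator beta w =
   \int[P]_(w in A) (\sum_i lam M 0 i *
      error_coord (\col_j (t j w * betabar j 0)) (noise (m:=M) w) w i ^+ 2)%:E)%E.
  have ths w : (Defs.rot M)^T *m beta w = \col_j (s w j 0 * betabar j 0).
    by apply/colP => j; rewrite sbeta mxE.
  under [LHS]eq_integral do rewrite /risk_interpolator risk_decomposition ths.
  have me (u : Omega M -> 'cV[R]_p) : random_mx u -> measurable_fun A (fun w =>
      (\sum_i lam M 0 i * error_coord (u w) (noise (m:=M) w) w i ^+ 2)%:E).
    move=> mu; apply/measurable_EFinP; apply: (@measurable_funS _ _ _ _ setT) => //.
    apply: measurable_bigsum => i _; apply: measurable_funM => //.
    by apply: measurable_funX; exact: measurable_error_coord.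
  have mcol (u : 'I_p -> Omega M -> R) : (forall j, measurable_fun setT (u j)) ->
      random_mx (fun w => \col_j (u j w * betabar j 0)).
    by move=> mu i j; under eq_fun do rewrite mxE; exact: measurable_funM.
  apply: ae_eq_integral => //; [by apply: me; apply: mcol => j; exact: ms|by apply: me; apply: (mcol t) => j; exact: L1_measurable (Lt j)|].
  have : {ae P, forall w, forall j, s w j 0 = t j w}.
    apply: filter_forall => j; exists (~` ([set w | s w j 0 = 1] `|` [set w | s w j 0 = -1])); split.
    - by apply: measurableC; exact: measurableU.
    - change (P (~` ([set w | s w j 0 = 1] `|` [set w | s w j 0 = -1])) = 0%E).
      rewrite probability_setC; last exact: measurableU.
      rewrite measureU//; last first.
        apply/seteqP; split => w //= -[-> h].
        by exfalso; lra.
      have h : (P [set w | (s w j 0 = 1)%R] + P [set w | (s w j 0 = -1)%R] = 1)%E.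
        by rewrite spos sneg -EFinD; congr EFin; lra.
      by rewrite -[X in X = 0%E]/(1 - (P [set w | (s w j 0 = 1)%R] + P [set w | (s w j 0 = -1)%R]))%E h subee.
    - move=> w /= h [] h1; apply: h; rewrite /t h1 ?eqxx//.
      by case: eqP => // e; rewrite -e.
  apply: filterS => w h Aw; congr EFin; apply: eq_bigr => i _; congr (_ * error_coord _ _ _ _ ^+ 2).
  by apply/colP => j; rewrite !mxE h.
rewrite as_eq.
rewrite (@integral_set_indicM _ _ _ P A) (@integral_set_indicM _ _ _ P A).
have -> : (fun w => (\1_A w * (\sum_i lam M 0 i * (bias_mx w i i * betabar i 0) ^+ 2))%:E) =
   (fun w => (\sum_i lam M 0 i * (b i i w * b i i w))%:E).
  apply/funext => w; congr EFin; rewrite mulr_sumr; apply: eq_bigr => i _.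
  by rewrite -{1}indic2 /b; ring.
have Lb i : L1 P (fun w => b i i w * b i i w) := bdd_in_L1 P H2T (bdd_inM sH2 (hb i i) (hb i i)).
have LZ i : L1 P (fun w => lam M 0 i * (b i i w * b i i w)) := L1Z _ (Lb i).
have LZq i : L1 P (fun w => lam M 0 i * q i w) := L1Z _ (Lq i).
rewrite ExE; last by apply: L1_sum => i _.
apply: (@le_trans _ _ (Ex P (fun w => \sum_i lam M 0 i * q i w))%:E).
  rewrite lee_fin !(@Ex_sum _ _ _ P)// le_eqVlt; apply/orP; left; apply/eqP.
  by apply: eq_bigr => i _; rewrite !(@ExZ _ _ _ P)// Eq.
apply: Ex_le_integral.
- apply: measurable_weighted_error => // i j.
  by under eq_fun do rewrite mxE; apply: measurable_funM => //; exact: L1_measurable (Lt i).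
- move=> w; apply: mulr_ge0; first by rewrite indicE.
  by apply: sumr_ge0 => i _; apply: mulr_ge0 => //; exact: sqr_ge0.
- by apply: L1_sum => i _.
- move=> w; rewrite mulr_sumr; apply: ler_sum => i _; rewrite mulrCA ler_wpM2l// indic_error.
  have -> : \sum_j \1_A w * bias_mx w i j * (\col_j (t j w * betabar j 0)) j 0 =
      t i w * b i i w + \sum_(j | j != i) t j w * b i j w.
    rewrite (bigD1 i)//=; congr (_ + _); first by rewrite mxE /b; ring.
    by apply: eq_bigr => j _; rewrite mxE /b; ring.
  rewrite -/(c i w) /q; set S := \sum_(j | _) _.
  have := sqr_ge0 (S - c i w); lra.
Qed.
End truncation.
End conditional_bounds.

(** * Leverages *)

Section leverage_probability.
Context {R : realType} {d : measure_display} {T : measurableType d}.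
Variable P : probability T R.
Context {p n : nat}.
Variable G : 'I_p -> set (set T).
Hypothesis GT : forall i A, G i A -> measurable A.
Hypothesis indepG : mutual_indep P G.
Variables (y : 'I_p -> T -> 'cV[R]_n) (eps : R).
Hypotheses (eps0 : 0 < eps) (eps1 : eps <= 1).
Hypothesis yG : forall i u, meas_in (G i) (fun w => dotv u (y i w)).
Hypothesis yl : forall i u, exists v, [/\ eps * dotv u u <= v, v <= eps^-1 * dotv u u &
  normal_law P (fun w => dotv u (y i w)) v].
Hypothesis n0 : (0 < n)%N.
Variables (l : 'I_p -> R) (S W : 'M[R]_n) (x : 'I_p -> T -> 'cV[R]_n).
Hypotheses (l0 : forall i, 0 < l i) (lmono : forall i j : 'I_p, (i <= j)%N -> l j <= l i).
Hypotheses (sS : S^T = S) (SW : S *m W = 1%:M) (xE : forall w i, x i w = S *m y i w).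
Variables (K : nat) (s : R).
Hypotheses (K2 : (2 <= K)%N) (KC : 128 * (80 / eps) / eps <= K%:R).
Hypotheses (s0 : 0 < s) (sE : s ^+ 2 * eps = 4 * expR 3) (KS : 8 * (80 / eps) * s ^+ 2 <= K%:R).

Let C := 80 / eps.
Let e0 : 0 < C. Proof. by rewrite divr_gt0. Qed.
Let n1 : 1 <= n%:R :> R. Proof. by rewrite ler1n. Qed.

Let Cn0 : 0 < 2 * C * n%:R.
Proof. by apply: mulr_gt0; [exact: mulr_gt0|exact: lt_le_trans n1]. Qed.

Let lev i w := l i * dotv (x i w) (invmx (gram l (x ^~ w)) *m x i w).

(** [conc_upper] for the single column [i] with weight 1 holds for all [u] at once, so also at the
    random vector [u = y i w], where one factor of the squared norm cancels. *)
Lemma norm_upper i : whp P (expR (- n%:R)) (fun w => dotv (y i w) (y i w) <= 2 * C * n%:R).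
Proof.
have l1 j : pred1 i j -> 0 <= (1 : R) <= 1 by rewrite ler01 lexx.
have := conc_upper GT indepG eps0 yG yl ltr01 l1.
apply: whp_imp => // w /(_ (y i w)); rewrite /wform !big_pred1_eq mul1r mulr1 -/C.
set q := dotv _ _ => h; have [->|q0] := eqVneq q 0; first exact: ltW.
have qp : 0 < q by rewrite lt_neqAle eq_sym q0 dotv_ge0.
move: h; rewrite expr2 ler_pM2r// => h; apply: le_trans h _.
by have := ler_wpM2l (ltW e0) n1; lra.
Qed.

Variable k : 'I_p.
Let L := \sum_(j < p | (k <= j)%N) l j.

Let tail_le (j : 'I_p) : (k <= j)%N -> 0 <= l j <= l k.
Proof. by move=> kj; rewrite (ltW (l0 j)) lmono. Qed.

Let L_ge : l k <= L.
Proof. by rewrite /L (bigD1 k)//= lerDl sumr_ge0// => j _; exact: ltW. Qed.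

Lemma gram_unit_whp : 16 * (K%:R + 3) / eps * (n%:R * l k) <= L ->
  whp P (2 * expR (- n%:R)) (fun w => gram l (x ^~ w) \in unitmx).
Proof.
move=> hL.
have := conc_lower GT indepG eps0 eps1 yG yl (l0 k) tail_le K2 KC hL.
apply: whp_imp => // w h.
have m0 : 0 < eps / 64 * L by rewrite mulr_gt0 ?divr_gt0// (lt_le_trans (l0 k)).
exact: (gram_unit l0 sS SW (fun i => xE w i) m0 h).
Qed.

(** Apply [leverage_ge] with the leading columns other than [i] projected out: [conc_sv] gives the
    size of the residual and [conc_upper] the tail constant [D = 2 * C * L]. *)
Lemma leverage_lower_whp i : n%:R * l k <= L ->
  16 * (K%:R + 3) / eps * (n%:R * l k) <= L ->
  (2 * (K + 2) * k.+1 <= n)%N ->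
  whp P (6 * expR (- (n%:R / 2))) (fun w => [/\ gram l (x ^~ w) \in unitmx,
    dotv (y i w) (y i w) <= 2 * C * n%:R &
    (1 + 2 * C * L / (l i * (n%:R / (4 * s ^+ 2))))^-1 <= lev i w]).
Proof.
move=> nL hL kn.
pose Jt := [pred j : 'I_p | (k <= j)%N && (j != i)].
have Jtl j : Jt j -> 0 <= l j <= l k by move=> /andP[/tail_le].
have up := conc_upper GT indepG eps0 yG yl (l0 k) Jtl.
(* Column [i] may itself lie in the tail, hence up to [k + 1] columns. *)
pose J := [pred j : 'I_p | (j < k)%N || (j == i)].
have J1 : (#|J| <= k.+1)%N.
  rewrite -(addn1 k) -sum1_card (bigID (fun j => j == i))/= addnC; apply: leq_add.
    have -> : (k : nat) = \sum_(j < p | (j < k)%N) 1.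
      by rewrite -(big_ord_widen p (fun=> 1%N)) ?sum1_card ?card_ord// ltnW.
    rewrite [leqRHS]big_mkcond [leqLHS]big_mkcond; apply: leq_sum => j _.
    by rewrite inE; case: (j < k)%N; case: (j == i).
  rewrite (eq_bigl (pred1 i)); first by rewrite big_pred1_eq.
  by move=> j; rewrite !inE /= orbC; case: eqP => //; rewrite andbF.
have sv := conc_sv GT indepG eps0 yG yl K2 s0 sE KS (J := J)
   (leq_trans (leq_mul (leqnn _) J1) kn).
apply: whp_imp (whp_and (whp_and (norm_upper i) (gram_unit_whp hL)) (whp_and up sv)).
  have e : expR (- n%:R) <= expR (- (n%:R / 2)) :> R by rewrite ler_expR lerN2; have := n1; lra.
  lra.
move=> w [[h1 h2] [h3 h4]]; split => //.
have D0 : 0 <= 2 * C * L.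
  by apply: mulr_ge0; [apply: mulr_ge0 => //; exact: ltW|exact: le_trans (ltW (l0 k)) L_ge].
have rho0 : 0 < n%:R / (4 * s ^+ 2) by rewrite divr_gt0 ?ltr0n// mulr_gt0// exprn_gt0.
apply: (leverage_ge l0 sS SW (fun i => xE w i) h2 (J := [pred j : 'I_p | (j < k)%N && (j != i)]) rho0 D0).
- by rewrite /= eqxx andbF.
- move=> a ha; apply: h4 => j; rewrite /= negb_or => /andP[jk ji]; apply: ha => //=.
  by rewrite ji andbT.
- move=> u; apply: le_trans (le_trans (h3 u) _).
    rewrite /wform le_eqVlt; apply/orP; left; apply/eqP; apply: eq_bigl => j /=.
    by case: (j != i); rewrite ?andbF ?andbT// -leqNgt.
  rewrite ler_wpM2r ?dotv_ge0// -/C.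
  have LJ : \sum_(j | Jt j) l j <= L.
    rewrite /L [leRHS](bigID (fun j => j != i))/= lerDl.
    by apply: sumr_ge0 => j _; exact: ltW.
  have := ler_wpM2l (ltW e0) (lerD LJ nL); lra.
Qed.

(** The other columns must dominate without [i]. Removing [i] from the tail costs at most [l k],
    hence half of [L]; this is why the second part asks for twice the constant [b]. *)
Lemma leverage_upper_whp i : 2 * l k <= L ->
  2 * (16 * (K%:R + 3) / eps) * (n%:R * l k) <= L ->
  whp P (3 * expR (- n%:R)) (fun w =>
    (1 + l i * (2 * C * n%:R) / (eps / 128 * L))^-1 <= 1 - lev i w).
Proof.
move=> kL hL.
pose Jt := [pred j : 'I_p | (k <= j)%N && (j != i)].
have Jtl j : Jt j -> 0 <= l j <= l k by move=> /andP[/tail_le].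
have LJ : L / 2 <= \sum_(j | Jt j) l j.
  have : L <= \sum_(j | Jt j) l j + l k.
    rewrite /L (bigID (fun j => j != i))/= lerD2l.
    have [ki|ki] := boolP (k <= i)%N.
      rewrite (big_pred1 i); first exact: lmono.
      by move=> j /=; rewrite negbK andbC; case: eqP => // ->.
    rewrite big_pred0 ?ltW// => j; rewrite negbK.
    by case: eqP => [->|]; rewrite ?andbF// (negbTE ki).
  lra.
have hLJ : 16 * (K%:R + 3) / eps * (n%:R * l k) <= \sum_(j | Jt j) l j.
  by apply: le_trans LJ; move: hL; rewrite -mulrA; lra.
have low := conc_lower GT indepG eps0 eps1 yG yl (l0 k) Jtl K2 KC hLJ.
apply: whp_imp (whp_and (norm_upper i) low).
  lra.
move=> w [h1 h2].
have m0 : 0 < eps / 128 * L by rewrite mulr_gt0 ?divr_gt0// (lt_le_trans (l0 k)).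
have K0 := Cn0.
have hu u : eps / 128 * L * dotv u u <= \sum_(j | j != i) l j * dotv u (y j w) ^+ 2.
  apply: (@le_trans _ _ (wform y l Jt w u)).
    apply: le_trans (h2 u); rewrite ler_wpM2r ?dotv_ge0//.
    have e64 : 0 <= eps / 64 by rewrite divr_ge0// ltW.
    by have := ler_wpM2l e64 LJ; lra.
  rewrite /wform [leRHS](bigID (fun j : 'I_p => (k <= j)%N))/=.
  rewrite (eq_bigl (fun j => (j != i) && (k <= j)%N)) => [|j]; last by rewrite andbC.
  by rewrite lerDl; apply: sumr_ge0 => j _; rewrite mulr_ge0 ?sqr_ge0// ltW.
have guw : gram l (x ^~ w) \in unitmx := gram_unit l0 sS SW (fun i => xE w i) m0 hu.
exact: (one_sub_leverage_ge l0 sS (fun i => xE w i) guw K0 h1 m0 hu).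
Qed.
End leverage_probability.

(** * From single coordinates to sums *)

Section average_whp.
Context {R : realType} {d : measure_display} {T : measurableType d}.
Variable P : probability T R.

(* Markov's inequality for the weight of the terms that fail. *)
Lemma whp_sum_half (I : finType) (t : I -> R) (eta : I -> T -> R) (delta : R) : 0 <= delta ->
  (forall i, 0 <= t i) -> (forall i w, 0 <= eta i w) ->
  (forall i, whp P delta (fun w => t i <= eta i w)) ->
  whp P (2 * delta) (fun w => 2^-1 * \sum_i t i <= \sum_i eta i w).
Proof.
move=> d0 t0 eta0 /choice[B hB].
have [T0|T0] := eqVneq (\sum_i t i) 0.
  exists set0; split => //; first by rewrite measure0 lee_fin mulr_ge0.
  by move=> w _; rewrite T0 mulr0 sumr_ge0.
have Tp : 0 < \sum_i t i by rewrite lt_neqAle eq_sym T0 sumr_ge0.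
have mB i : measurable (B i) by have [] := hB i.
pose X w := \sum_i t i * \1_(B i) w.
have LX : L1 P X by apply: L1_sum => i _; apply: L1Z; exact: L1_indic.
have mX := L1_measurable LX.
exists [set w | 2^-1 * (\sum_i t i) < X w]; split.
- by apply: measurable_lt_set => //; exact: measurable_cst.
- apply: (@markov_fun _ _ _ P _ (fun w => 2 / (\sum_i t i) * X w)).
  + by apply: measurable_lt_set => //; exact: measurable_cst.
  + exact: measurable_funM.
  + move=> w; apply: mulr_ge0; first by rewrite divr_ge0// ltW.
    by apply: sumr_ge0 => i _; rewrite mulr_ge0// indicE.
  + move=> w /= h; rewrite mulrAC ler_pdivlMr// mul1r; lra.
  + rewrite (ExE (L1Z _ LX)) lee_fin (ExZ _ LX) mulrAC ler_pdivrMr//.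
    have -> : Ex P X = \sum_i t i * fine (P (B i)).
      rewrite /X (@Ex_sum _ _ _ P) => [|i _]; last by apply: L1Z; exact: L1_indic.
      by apply: eq_bigr => i _; rewrite (ExZ _ (L1_indic P (mB i))) Ex_indic.
    rewrite -mulrA ler_wpM2l// mulr_sumr; apply: ler_sum => i _; rewrite mulrC ler_wpM2r//.
    have [_ PB _] := hB i.
    by rewrite -lee_fin fineK//; exact: fin_num_measure.
- move=> w /negP; rewrite -leNgt => h.
  have : \sum_i t i - X w <= \sum_i eta i w.
    rewrite /X -sumrB; apply: ler_sum => i _; have [_ _ hi] := hB i.
    rewrite indicE; have [|] := boolP (w \in B i).
      by rewrite mulr1 subrr.
    by rewrite notin_setE mulr0 subr0 => /hi.
  lra.
Qed.
End average_whp.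

Section ranks.
Context {R : realType} {p : nat}.
Implicit Type lam : 'rV[R]_p.

Lemma ev_ord lam (i : 'I_p) : ev lam i = lam 0 i.
Proof. by rewrite /ev valK. Qed.

Lemma ev_tail (f : R -> R) lam k :
  \sum_(k <= i < p) f (ev lam i) = \sum_(i < p | (k <= i)%N) f (lam 0 i).
Proof. by rewrite big_geq_mkord; apply: eq_bigr => i _; rewrite ev_ord. Qed.

Lemma kstarP lam n b k : kstar lam n b = Some k ->
  r_ge lam k (b * n%:R) /\ forall j, (j < k)%N -> ~~ r_ge lam j (b * n%:R).
Proof.
suff h (Q : pred nat) m q : ohead [seq k <- iota m q | Q k] = Some k ->
    Q k /\ forall j, (m <= j < k)%N -> ~~ Q j by move=> /h[].
elim: q m => // q IH m /=; case: ifP => [Qm [<-]|Qm /IH[Qk hk]].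
  by split=> // j /andP[mj]; rewrite ltnNge mj.
split => // j /andP[]; rewrite leq_eqVlt => /predU1P[<- _|mj jk]; first by rewrite Qm.
by apply: hk; rewrite mj.
Qed.

End ranks.

Section model_columns.
Context {R : realType} {n p : nat} (M : model R n p).
Variables (Xi0 : 'M[R]_n) (eps : R).
Hypotheses (eps0 : 0 < eps) (coh : coherent eps Xi0 (Xi M)).

Definition column i (w : Omega M) : 'cV[R]_n := mxsqrt (Xi M i) *m z (m:=M) i w.

Lemma rotated_designE w j i : rotated_design w j i = column i w j 0 * Num.sqrt (lam M 0 i).
Proof.
rewrite /rotated_design /design /design_of -mulmxA rot_unitary mulmx1.
by rewrite mul_mx_diag !mxE.
Qed.

Lemma designE (w : Omega M) : design w = rotated_design w *m (Defs.rot M)^T.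
Proof. by rewrite /rotated_design -mulmxA rot_orthogonal mulmx1. Qed.

Lemma gramE w : design w *m (design w)^T = gram (lam M 0) (column ^~ w).
Proof.
rewrite designE trmx_mul trmxK -mulmxA (mulmxA _ _ (_^T)) rot_unitary mul1mx.
apply/matrixP => a b; rewrite mxE /gram summxE; apply: eq_bigr => i _.
rewrite [_^T i b]mxE !rotated_designE [RHS]mxE [X in _ = _ * X]mxE big_ord1 [_^T _ _]mxE mulrACA -expr2 sqr_sqrtr; first by rewrite mulrC.
by rewrite ltW ?lam_gt0.
Qed.

Definition dual_column i w := invmx (gram (lam M 0) (column ^~ w)) *m column i w.

Lemma noise_gainE w i l : noise_gain w i l = Num.sqrt (lam M 0 i) * dual_column i w l 0.
Proof.
rewrite /noise_gain /gram_inv gramE /dual_column !mxE mulr_sumr; apply: eq_bigr => j _.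
rewrite mxE rotated_designE -[in RHS](gram_sym (lam M 0) (column ^~ w)) -trmx_inv [in RHS]mxE.
ring.
Qed.

Lemma noise_formE w i : lam M 0 i *
    (\sum_l \sum_m Upsilon M l m * (noise_gain w i l * noise_gain w i m)) =
  lam M 0 i ^+ 2 * dotv (dual_column i w) (Upsilon M *m dual_column i w).
Proof.
rewrite expr2 -mulrA; congr (_ * _); rewrite dotvE mulr_sumr; apply: eq_bigr => l _.
have -> : (Upsilon M *m dual_column i w) l 0 = \sum_m Upsilon M l m * dual_column i w m 0 by rewrite mxE.
rewrite !mulr_sumr; apply: eq_bigr => m _; rewrite !noise_gainE.
rewrite -[in RHS](sqr_sqrtr (ltW (lam_gt0 M i))); ring.
Qed.

Lemma bias_mxE w i : bias_mx w i i = 1 - lam M 0 i * dotv (column i w) (dual_column i w).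
Proof.
rewrite !mxE eqxx; congr (_ - _); rewrite dotvE mulr_sumr; apply: eq_bigr => l _.
rewrite noise_gainE rotated_designE -[in RHS](sqr_sqrtr (ltW (lam_gt0 M i))); ring.
Qed.

Definition white i w := invmx (mxsqrt Xi0) *m column i w.

Let Xi0pd : posdef Xi0 := coh.1.

Lemma mxsqrt_invmx : mxsqrt Xi0 *m invmx (mxsqrt Xi0) = 1%:M.
Proof. by rewrite mulmxV// mxsqrt_unit. Qed.

Lemma column_white w i : column i w = mxsqrt Xi0 *m white i w.
Proof. by rewrite /white mulmxA mxsqrt_invmx mul1mx. Qed.

Lemma dotv_white_z u i w : dotv u (white i w) =
  dotv (mxsqrt (Xi M i) *m (invmx (mxsqrt Xi0) *m u)) (z (m:=M) i w).
Proof.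
have s1 := mxsqrt_sym (posdefW (Xi_posdef M i)); have s2 := mxsqrt_sym (posdefW Xi0pd).
by rewrite /white /column !dotv_mulmx trmx_inv s2 s1.
Qed.

Lemma white_in i u : meas_in (sigma_mx (z (m:=M) i)) (fun w => dotv u (white i w)).
Proof.
apply/sigma_mxP; under eq_fun do rewrite dotv_white_z.
by apply: measurable_dotv; [exact: random_mx_cst|exact: sigma_mx_random].
Qed.

Lemma white_law i u : exists v, [/\ eps * dotv u u <= v, v <= eps^-1 * dotv u u &
  normal_law (Prob M) (fun w => dotv u (white i w)) v].
Proof.
pose u' := mxsqrt (Xi M i) *m (invmx (mxsqrt Xi0) *m u).
exists (dotv u' u').
have Xpd := Xi_posdef M i; have [_ /(_ i)[c1 c2 c3]] := coh.
have := generalized_rayleigh Xi0pd Xpd c1 c3 u.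
have -> : dotv u (invmx (mxsqrt Xi0) *m Xi M i *m invmx (mxsqrt Xi0) *m u) = dotv u' u'.
  have s1 := mxsqrt_sym (posdefW Xpd); have s2 := mxsqrt_sym (posdefW Xi0pd).
  have [_ e] := mxsqrtP (posdefW Xpd).
  by rewrite -[in LHS]e -!mulmxA dotv_mulmx trmx_inv s2 dotv_mulmx s1.
move=> /andP[h1 h2]; split => //.
under eq_fun do rewrite dotv_white_z -/u'.
by have := gaussian_law u' (z_gaussian M i); rewrite mul1mx.
Qed.

Lemma z_sigma_measurable i A : sigma_mx (z (m:=M) i) A -> measurable A.
Proof. by apply: sigma_mx_measurable; exact: (z_gaussian M i).1. Qed.

Lemma opnorm_coherence_gt0 : (0 < n)%N -> 0 < opnorm (invmx (Upsilon M) *m Xi0).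
Proof.
move=> n0; pose u : 'cV[R]_n := const_mx 1.
have u0 : u != 0.
  apply/eqP => /matrixP /(_ (Ordinal n0) 0); rewrite !mxE => /eqP; by rewrite oner_eq0.
have h := le_opnorm_posdef u Xi0pd (Upsilon_posdef M).
have a0 := Xi0pd.2 u u0; have b0 := (Upsilon_posdef M).2 u u0.
by have := lt_le_trans a0 h; rewrite pmulr_lgt0.
Qed.

End model_columns.

(** * The two lower bounds on the expected risk *)

Section lower_bounds.
Context {R : realType} {n p : nat} (M : model R n p).
Variables (Xi0 : 'M[R]_n) (eps : R) (K : nat) (s : R).
Hypotheses (eps0 : 0 < eps) (eps1 : eps <= 1) (coh : coherent eps Xi0 (Xi M)) (n0 : (0 < n)%N).
Hypotheses (K2 : (2 <= K)%N) (KC : 128 * (80 / eps) / eps <= K%:R).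
Hypotheses (s0 : 0 < s) (sE : s ^+ 2 * eps = 4 * expR 3) (KS : 8 * (80 / eps) * s ^+ 2 <= K%:R).

Let C := 80 / eps.
Let C0 : 0 < C. Proof. by rewrite divr_gt0. Qed.
Let b0 := 16 * (K%:R + 3) / eps.
Let n1 : 1 <= n%:R :> R. Proof. by rewrite ler1n. Qed.
Let Cn0 : 0 < 2 * C * n%:R.
Proof. by apply: mulr_gt0; [exact: mulr_gt0|exact: lt_le_trans n1]. Qed.

Let b01 : 1 <= b0.
Proof.
rewrite /b0 ler_pdivlMr// mul1r; apply: (le_trans eps1).
by have := ler0n R K; lra.
Qed.

Local Notation P := (Prob M).
Local Notation l := (fun i => lam M 0 i).

Let l0 i : 0 < l i := lam_gt0 M i.

Section tail.
Variable k : 'I_p.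
Let L := \sum_(j < p | (k <= j)%N) lam M 0 j.

Lemma r_geP x : r_ge (lam M) k x -> x * lam M 0 k <= L.
Proof.
by move=> /andP[_]; rewrite /small_r ev_ord (ev_tail id) /= -/L ler_pdivlMr.
Qed.

Let lk_le : lam M 0 k <= L.
Proof. by rewrite /L (bigD1 k)//= lerDl sumr_ge0// => j _; exact: ltW. Qed.

Let L0 : 0 < L := lt_le_trans (l0 k) lk_le.

Lemma variance_whp i : b0 * n%:R * lam M 0 k <= L -> (2 * (K + 2) * k.+1 <= n)%N ->
  whp P (6 * expR (- (n%:R / 2))) (fun w =>
    ((1 + 8 * C * s ^+ 2 * L / (n%:R * lam M 0 i))^-1) ^+ 2 /
       (opnorm (invmx (Upsilon M) *m Xi0) * (2 * C * n%:R)) <=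
    lam M 0 i ^+ 2 * dotv (dual_column i w) (Upsilon M *m dual_column i w)).
Proof.
move=> hL kn.
have nk0 : 0 <= n%:R * lam M 0 k by rewrite mulr_ge0// ltW.
have nL : n%:R * lam M 0 k <= L.
  by apply: le_trans hL; rewrite -mulrA ler_peMl.
have sS := mxsqrt_sym (posdefW coh.1); have SW := mxsqrt_invmx coh.
have hL' : 16 * (K%:R + 3) / eps * (n%:R * lam M 0 k) <= L by rewrite mulrA.
have := leverage_lower_whp (@z_sigma_measurable R n p M) (z_indep (m:=M)) eps0 eps1
  (white_in coh) (white_law coh) n0 l0 (lam_nonincreasing M) sS SW (fun w i => column_white coh w i)
  K2 KC s0 sE KS i nL hL' kn.
apply: whp_imp => // w [gu yK hq].
have v := variance_term_ge l sS (fun i => column_white coh w i) Cn0 yK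
  (mxsqrtP (posdefW coh.1)).2 coh.1 (Upsilon_posdef M).
apply: le_trans v.
have ka := opnorm_coherence_gt0 coh n0.
rewrite ler_pM2r; last by rewrite invr_gt0; exact: mulr_gt0.
have ns0 : 0 < n%:R / (4 * s ^+ 2).
  by apply: divr_gt0; [exact: lt_le_trans n1|apply: mulr_gt0 => //; exact: exprn_gt0].
have q0 : 0 <= (1 + 2 * C * L / (lam M 0 i * (n%:R / (4 * s ^+ 2))))^-1.
  rewrite invr_ge0; apply: addr_ge0 => //; apply: divr_ge0; last exact/ltW/mulr_gt0.
  by apply/ltW/mulr_gt0 => //; exact: mulr_gt0.
have qE : (1 + 8 * C * s ^+ 2 * L / (n%:R * lam M 0 i))^-1 =
    (1 + 2 * C * L / (lam M 0 i * (n%:R / (4 * s ^+ 2))))^-1.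
  have li := l0 i; have s20 : 0 < s ^+ 2 by exact: exprn_gt0.
  have nn : 0 < n%:R :> R by exact: lt_le_trans n1.
  congr (_ + _)^-1; move: (s ^+ 2) (n%:R) (lam M 0 i) s20 nn li => x u v x0 u0 v0.
  by field; rewrite !gt_eqF.
by rewrite qE; apply: lerXn2r; rewrite ?nnegrE//; exact: le_trans hq.
Qed.

Lemma bias_whp i : 2 * b0 * n%:R * lam M 0 k <= L ->
  whp P (3 * expR (- n%:R)) (fun w =>
    (1 + 256 * C / eps * lam M 0 i * n%:R / L)^-1 <= bias_mx w i i).
Proof.
move=> hL.
have sS := mxsqrt_sym (posdefW coh.1); have SW := mxsqrt_invmx coh.
have lk0 := l0 k.
have kL : 2 * lam M 0 k <= L.
  have b0n : 1 <= b0 * n%:R by exact: mulr_ege1.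
  by have := ler_wpM2r (ltW lk0) b0n; lra.
have hL' : 2 * (16 * (K%:R + 3) / eps) * (n%:R * lam M 0 k) <= L.
  by rewrite -/b0 [leLHS]mulrA.
have := leverage_upper_whp (@z_sigma_measurable R n p M) (z_indep (m:=M)) eps0 eps1
  (white_in coh) (white_law coh) n0 l0 (lam_nonincreasing M) sS SW (fun w i => column_white coh w i)
  K2 KC i kL hL'.
apply: whp_imp => // w; rewrite bias_mxE; apply: le_trans.
rewrite le_eqVlt; apply/orP; left; apply/eqP; congr (_ + _)^-1.
by rewrite -/C -/L; field; rewrite !gt_eqF.
Qed.

End tail.

(** All design-dependent coefficients of the error gathered in one finite family, the one truncated
    in [cond_expectation_ge]. *)
Let coef (i : 'I_p * 'I_p + 'I_p * 'I_n) (w : Omega M) : R :=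
  match i with inl ij => bias_mx w ij.1 ij.2 | inr il => noise_gain w il.1 il.2 end.

Let coef_in i : meas_in (@dsigma R n p M) (coef i).
Proof. by case: i => ij; [exact: bias_mx_in|exact: noise_gain_in]. Qed.

Let risk0 (beta : Omega M -> 'cV[R]_p) w : (0 <= risk_interpolator beta w)%E.
Proof.
rewrite /risk_interpolator risk_decomposition lee_fin sumr_ge0// => i _.
by rewrite mulr_ge0 ?sqr_ge0// ltW.
Qed.

Lemma expected_risk_ge_noise (beta : 'cV[R]_p) g (h delta : R) :
  is_expected_risk (fun _ => beta) g -> 0 <= h ->
  whp P delta (fun w => h <= \sum_i lam M 0 i ^+ 2 *
    dotv (dual_column i w) (Upsilon M *m dual_column i w)) ->
  ((1 - delta)%:E <= P [set w | (h%:E <= g w)%E])%E.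
Proof.
move=> hg h0 hw.
pose F w := \sum_i lam M 0 i *
  \sum_a \sum_b Upsilon M a b * (noise_gain (M:=M) w i a * noise_gain w i b).
have FE w : F w = \sum_i lam M 0 i ^+ 2 * dotv (dual_column i w) (Upsilon M *m dual_column i w).
  by apply: eq_bigr => i _; exact: noise_formE.
apply: (cond_expectation_ge (dsigma_sigma M) (@dsigma_measurable R n p M) hg (risk0 _)
  (F := F) (c := coef)) => //.
- apply/(meas_inP (dsigma_sigma M)); apply: measurable_bigsum => i _; apply: measurable_funM => //.
  apply: measurable_bigsum => a _; apply: measurable_bigsum => b _; apply: measurable_funM => //.
  by apply: measurable_funM; apply/(meas_inP (dsigma_sigma M)); exact: noise_gain_in.
- move=> A N HA hA; apply: (conditional_noise_bound HA (N := N)).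
  + by move=> w i j Aw; exact: (hA w (inl (i, j))).
  + by move=> w i a Aw; exact: (hA w (inr (i, a))).
- by apply: whp_imp hw => // w; rewrite FE.
Qed.

Lemma expected_risk_ge_bias (betabar : 'cV[R]_p) (sg beta : Omega M -> 'cV[R]_p) g (h delta : R) :
  sign_prior betabar sg beta -> is_expected_risk beta g -> 0 <= h ->
  whp P delta (fun w => h <= \sum_i lam M 0 i * (bias_mx w i i * betabar i 0) ^+ 2) ->
  ((1 - delta)%:E <= P [set w | (h%:E <= g w)%E])%E.
Proof.
move=> sp hg h0 hw.
apply: (cond_expectation_ge (dsigma_sigma M) (@dsigma_measurable R n p M) hg (risk0 _)
  (F := fun w => \sum_i lam M 0 i * (bias_mx w i i * betabar i 0) ^+ 2) (c := coef)) => //.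
- apply/(meas_inP (dsigma_sigma M)); apply: measurable_bigsum => i _; apply: measurable_funM => //.
  apply: measurable_funX; apply: measurable_funM => //.
  by apply/(meas_inP (dsigma_sigma M)); exact: bias_mx_in.
- move=> A N HA hA; apply: (conditional_sign_bound HA (N := N) _ _ sp).
  + by move=> w i j Aw; exact: (hA w (inl (i, j))).
  + by move=> w i a Aw; exact: (hA w (inr (i, a))).
Qed.

Let a := 8 * C * s ^+ 2.
Let a0 : 0 <= a.
Proof. by apply: mulr_ge0 (sqr_ge0 _); apply: mulr_ge0 => //; exact: ltW. Qed.

(** The three summands in the bound on [c] pay for the failure probability, for the dimension of the
    nets (and small [n]), and for the prefactor left by Markov's inequality and [variance_whp]. *)
Lemma noise_lower_bound (c : R) (beta : 'cV[R]_p) k g :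
  12 + 4 * (K%:R + 2) + 4 * C * (1 + a * b0) ^+ 2 <= c ->
  kstar (lam M) n b0 = Some k -> k%:R <= n%:R / c ->
  is_expected_risk (fun _ => beta) g ->
  ((1 - c * expR (- (n%:R / c)))%:E <=
    P [set w | (((c * opnorm (invmx (Upsilon M) *m Xi0))^-1 *
       (k%:R / n%:R + n%:R / big_R (lam M) k))%:E <= g w)%E])%E.
Proof.
move=> hc /kstarP[rk kmin] kn hg.
have K0 : 0 <= K%:R :> R by exact: ler0n.
have ab0 : 0 <= a * b0 by apply: mulr_ge0 => //; exact: le_trans b01.
have q0 : 0 <= 4 * C * (1 + a * b0) ^+ 2.
  by apply: mulr_ge0 (sqr_ge0 _); apply: mulr_ge0 => //; exact: ltW.
have c12 : 12 <= c by lra.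
have c0 : 0 < c by lra.
(* For small [n] the claim is void: [n / c <= 1] and [c >= 12] make the probability bound
   negative. *)
have [nsmall|nbig] := leqP n (4 * (K + 2)).
  apply: (@le_trans _ _ 0%E); last exact: measure_ge0.
  rewrite lee_fin subr_le0.
  have e4 : 4^-1 <= expR (- 1) :> R.
    have -> : -1 = - 2^-1 + - 2^-1 :> R by field.
    rewrite expRD; have := expR_ge1Dx (- 2^-1 : R) => h; nra.
  have nc : n%:R / c <= 1.
    rewrite ler_pdivrMr// mul1r; apply: (@le_trans _ _ (4 * (K + 2))%:R); first by rewrite ler_nat.
    by rewrite natrM natrD; lra.
  have e5 : 4^-1 <= expR (- (n%:R / c)) by apply: le_trans e4 _; rewrite ler_expR lerN2.
  by have := ler_wpM2l (ltW c0) e5; lra.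
have kp : (k < p)%N by have /andP[] := rk.
pose k' := Ordinal kp.
pose L := \sum_(j < p | (k <= j)%N) lam M 0 j.
have hL : b0 * n%:R * lam M 0 k' <= L := r_geP (k := k') rk.
have nk : (4 * (K + 2) * k <= n)%N.
  rewrite -(ler_nat R) !natrM natrD; move: kn; rewrite ler_pdivlMr//; apply: le_trans.
  by rewrite mulrC ler_wpM2l//; lra.
(* The average of [nk] and [nbig]; the extra column is absorbed by [n] being large. *)
have kn' : (2 * (K + 2) * k'.+1 <= n)%N.
  rewrite /= mulnS; move: nk nbig; rewrite -!mulnA.
  by move: ((K + 2) * k)%N (K + 2)%N; clear; lia.
set ka := opnorm _.
have ka0 : 0 < ka := opnorm_coherence_gt0 coh n0.
have L0 : 0 < L.
  by rewrite /L (bigD1 k')//= ltr_pwDl// sumr_ge0// => j _; exact: ltW.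
pose t i := ((1 + a * L / (n%:R * lam M 0 i))^-1) ^+ 2 / (ka * (2 * C * n%:R)).
have ht i := variance_whp i hL kn'.
have t0 i : 0 <= t i by rewrite divr_ge0 ?sqr_ge0// mulr_ge0 ?ltW.
pose h := (c * ka)^-1 * (k%:R / n%:R + n%:R / big_R (lam M) k).
pose S2 := \sum_(j < p | (k <= j)%N) lam M 0 j ^+ 2.
have RE : n%:R / big_R (lam M) k = n%:R * S2 / L ^+ 2.
  by rewrite /big_R (ev_tail id) (ev_tail (fun x => x ^+ 2)) -/S2 -/L invf_div mulrA.
have S20 : 0 <= S2 by apply: sumr_ge0 => j _; exact: sqr_ge0.
have nn : 0 < n%:R :> R by exact: lt_le_trans n1.
have kR0 : 0 <= k%:R :> R by [].
have m0 : 0 <= k%:R / n%:R + n%:R * S2 / L ^+ 2.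
  apply: addr_ge0; first by apply: divr_ge0 => //; exact: ltW.
  by apply: divr_ge0 (sqr_ge0 _); apply: mulr_ge0 => //; exact: ltW.
have h0 : 0 <= h.
  by rewrite /h RE; apply: mulr_ge0 => //; rewrite invr_ge0; exact/ltW/mulr_gt0.
(* Up to the factor [1 + a * b0], the lower bound on the leverage in each regime; the sum of its
   squares is [n] times the announced quantity. *)
pose v (i : 'I_p) := if (i < k)%N then 1 else n%:R * lam M 0 i / L.
have gab : 0 < 1 + a * b0 by lra.
have hv i : (1 + a * b0)^-1 * v i <= (1 + a * L / (n%:R * lam M 0 i))^-1.
  have li := l0 i; have nli : 0 < n%:R * lam M 0 i by exact: mulr_gt0.
  have x0 : 0 < L / (n%:R * lam M 0 i) by exact: divr_gt0.
  rewrite -mulrA /v; case: ltnP => ik.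
    (* Minimality of [k]: the rank condition fails at [i], and the tail from [i] contains the tail
       from [k]. *)
    have xb : L / (n%:R * lam M 0 i) <= b0.
      have := kmin _ ik; rewrite /r_ge ltn_ord /= -ltNge /small_r ev_ord (ev_tail id) /=.
      rewrite ltr_pdivrMr// => hi; rewrite ler_pdivrMr// mulrA; apply: le_trans (ltW hi).
      rewrite /L [leRHS](bigID (fun j : 'I_p => (k <= j)%N))/=.
      rewrite [X in _ <= X + _](eq_bigl (fun j : 'I_p => (k <= j)%N)); last first.
        by move=> j; rewrite andb_idl// => kj; exact: leq_trans (ltnW ik) kj.
      by rewrite lerDl; apply: sumr_ge0 => j _; exact: ltW.
    rewrite mulr1 lef_pV2 ?posrE//; first by rewrite lerD2l ler_wpM2l.
    by apply: ltr_wpDr => //; apply: mulr_ge0 => //; exact: ltW.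
  have x1 : 1 <= L / (n%:R * lam M 0 i).
    rewrite ler_pdivlMr// mul1r; apply: (@le_trans _ _ (n%:R * lam M 0 k')).
      by rewrite ler_pM2l//; exact: lam_nonincreasing.
    by apply: le_trans hL; rewrite -mulrA ler_peMl// ltW// mulr_gt0.
  have -> : (1 + a * b0)^-1 * (n%:R * lam M 0 i / L) = ((1 + a * b0) * (L / (n%:R * lam M 0 i)))^-1.
    by rewrite invfM invf_div.
  move: (L / _) x0 x1 => x x0 x1.
  rewrite lef_pV2 ?posrE ?mulr_gt0//; last by apply: ltr_wpDr => //; apply: mulr_ge0 => //; exact: ltW.
  have ax : 0 <= a * x by apply: mulr_ge0 => //; exact: ltW.
  have := ler_wpM2l ax b01; lra.
have v0 i : 0 <= v i.
  rewrite /v; case: ifP => // _; apply: divr_ge0; last exact: ltW.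
  by apply/ltW/mulr_gt0.
have vsum : \sum_i v i ^+ 2 = k%:R + n%:R ^+ 2 * S2 / L ^+ 2.
  rewrite (bigID (fun i : 'I_p => (i < k)%N))/=; congr (_ + _).
    rewrite (eq_bigr (fun=> 1)) => [|i ik]; last by rewrite /v ik expr1n.
    by rewrite -(big_ord_widen p (fun=> 1)) ?sumr_const ?card_ord// ltnW.
  rewrite /S2 mulr_sumr mulr_suml; apply: eq_big => [i|i ik]; first by rewrite -leqNgt.
  by rewrite /v (negbTE ik) !exprMn exprVn.
have rescale (e u m q r x y : R) : 0 < e -> 0 < m -> 0 < q -> 0 < r -> 0 < x ->
    2^-1 * (e^-1 ^+ 2 * (u + m ^+ 2 * y / r ^+ 2) / (q * (2 * x * m))) =
    (4 * x * e ^+ 2 * q)^-1 * (u / m + m * y / r ^+ 2).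
  by move=> *; field; rewrite !gt_eqF.
have hsum : h <= 2^-1 * \sum_i t i.
  apply: (@le_trans _ _ (2^-1 * \sum_i ((1 + a * b0)^-1 * v i) ^+ 2 / (ka * (2 * C * n%:R)))).
    rewrite -mulr_suml; under eq_bigr do rewrite exprMn.
    rewrite -mulr_sumr vsum /h RE.
    have -> : 2^-1 * ((1 + a * b0)^-1 ^+ 2 * (k%:R + n%:R ^+ 2 * S2 / L ^+ 2) / (ka * (2 * C * n%:R))) =
       (4 * C * (1 + a * b0) ^+ 2 * ka)^-1 * (k%:R / n%:R + n%:R * S2 / L ^+ 2).
      exact: rescale.
    apply: ler_wpM2r => //; rewrite lef_pV2 ?posrE//.
    - by rewrite ler_pM2r//; lra.
    - exact: mulr_gt0.
    - by apply: mulr_gt0 => //; apply: mulr_gt0; [exact: mulr_gt0|exact: exprn_gt0].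
  rewrite ler_pM2l// /t; apply: ler_sum => i _; rewrite ler_pM2r; last by rewrite invr_gt0; exact: mulr_gt0.
  apply: lerXn2r; rewrite ?nnegrE//.
  - by apply: mulr_ge0 => //; rewrite invr_ge0 ltW.
  - by apply: le_trans (hv i); apply: mulr_ge0 => //; rewrite invr_ge0 ltW.
have e0 : 0 <= 6 * expR (- (n%:R / 2)) :> R by rewrite mulr_ge0 ?expR_ge0.
have eta0 i (w : Omega M) : 0 <= lam M 0 i ^+ 2 * dotv (dual_column i w) (Upsilon M *m dual_column i w).
  by rewrite mulr_ge0 ?sqr_ge0// (posdefW (Upsilon_posdef M)).2.
have := whp_sum_half e0 t0 eta0 ht.
move/(whp_imp (lexx _) (fun w => le_trans hsum))/(expected_risk_ge_noise hg h0).
(* The failure probability is [2 * 6 * expR (- n / 2)]; [c >= 12] covers both the factor and the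
   rate. *)
apply: le_trans; rewrite lee_fin lerD2l lerN2 mulrA.
apply: ler_pM; rewrite ?mulr_ge0 ?expR_ge0//; first lra.
by rewrite ler_expR lerN2 ler_pM2l ?lef_pV2 ?posrE//; lra.
Qed.

Lemma bias_lower_bound (c : R) (betabar : 'cV[R]_p) (sg beta : Omega M -> 'cV[R]_p) k g :
  1 + 256 * C / eps <= c ->
  sign_prior betabar sg beta ->
  r_ge (lam M) k (2 * b0 * n%:R) ->
  is_expected_risk beta g ->
  ((1 - 10 * expR (- (n%:R / c)))%:E <=
    P [set w | ((2^-1 * \sum_(i < p)
         lam M 0 i * betabar i 0 ^+ 2 /
         (1 + c * lam M 0 i * n%:R /
            (ev (lam M) k * small_r (lam M) k)) ^+ 2)%:E <= g w)%E])%E.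
Proof.
move=> hc sp rk hg.
have kp : (k < p)%N by have /andP[] := rk.
pose k' := Ordinal kp.
pose L := \sum_(j < p | (k <= j)%N) lam M 0 j.
have hL : 2 * b0 * n%:R * lam M 0 k' <= L := r_geP (k := k') rk.
have LE : ev (lam M) k * small_r (lam M) k = L.
  have ek : ev (lam M) k != 0 by rewrite (ev_ord (lam M) k') gt_eqF.
  by rewrite /small_r mulrC divfK// (ev_tail id).
have L0 : 0 < L.
  by rewrite /L (bigD1 k')//= ltr_pwDl// sumr_ge0// => j _; exact: ltW.
have Ce : 0 <= 256 * C / eps.
  exact: (divr_ge0 (mulr_ge0 (ler0n R 256) (ltW C0)) (ltW eps0)).
have c1 : 1 <= c by lra.
rewrite LE.
pose t i := lam M 0 i * betabar i 0 ^+ 2 / (1 + c * lam M 0 i * n%:R / L) ^+ 2.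
have x0 i : 0 <= lam M 0 i * n%:R / L by rewrite divr_ge0 ?mulr_ge0// ltW.
have t0 i : 0 <= t i.
  by rewrite divr_ge0 ?sqr_ge0// mulr_ge0 ?sqr_ge0// ltW.
have e0 : 0 <= 3 * expR (- n%:R) :> R by rewrite mulr_ge0 ?expR_ge0.
have eta0 i (w : Omega M) : 0 <= lam M 0 i * (bias_mx w i i * betabar i 0) ^+ 2.
  by rewrite mulr_ge0 ?sqr_ge0// ltW.
have ht i : whp P (3 * expR (- n%:R)) (fun w => t i <= lam M 0 i * (bias_mx w i i * betabar i 0) ^+ 2).
  apply: whp_imp (bias_whp i hL) => // w hb.
  rewrite /t -mulrA ler_wpM2l ?(ltW (l0 i))// mulrC exprMn ler_wpM2r ?sqr_ge0// -exprVn.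
  have x1 : 0 < 1 + 256 * C / eps * lam M 0 i * n%:R / L.
    by have := mulr_ge0 Ce (x0 i); move: (256 * C / eps) => q; lra.
  have xle : 1 + 256 * C / eps * lam M 0 i * n%:R / L <= 1 + c * lam M 0 i * n%:R / L.
    have h : 256 * C / eps <= c by lra.
    by have := ler_wpM2r (x0 i) h; move: (256 * C / eps) => q; lra.
  have x2 : 0 < 1 + c * lam M 0 i * n%:R / L := lt_le_trans x1 xle.
  apply: lerXn2r; rewrite ?nnegrE.
  - by rewrite invr_ge0 ltW.
  - by apply: le_trans hb; rewrite invr_ge0 ltW.
  - by apply: le_trans hb; rewrite lef_pV2 ?posrE.
have h0 : 0 <= 2^-1 * \sum_i t i by rewrite mulr_ge0// sumr_ge0.
have := whp_sum_half e0 t0 eta0 ht.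
move/(expected_risk_ge_bias sp hg h0).
apply: le_trans; rewrite lee_fin lerD2l lerN2.
(* The failure probability obtained is [2 * 3 * expR (- n)], within the announced bound because
   [c >= 1]. *)
have e1 : expR (- n%:R) <= expR (- (n%:R / c)) :> R.
  by rewrite ler_expR lerN2 ler_pdivrMr ?ler_peMr//; lra.
have := expR_ge0 (- (n%:R / c)); lra.
Qed.

End lower_bounds.

Theorem theorem2 (R : realType) (eps : R) (heps0 : 0 < eps) (heps1 : eps <= 1) :
  (exists b c : R, [/\ 1 <= b, 1 <= c &
    forall (n p : nat) (M : model R n p) (Xi0 : 'M[R]_n) (beta : 'cV[R]_p),
      (0 < n)%N ->
      0 < ev (lam M) n ->
      coherent eps Xi0 (Xi M) ->
      forall k : nat, kstar (lam M) n b = Some k -> k%:R <= n%:R / c ->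
      forall g : Omega M -> \bar R, is_expected_risk (fun _ => beta) g ->
      ((1 - c * expR (- (n%:R / c)))%:E <=
        Prob M [set w | ((c * opnorm (invmx (Upsilon M) *m Xi0))^-1 *
                      (k%:R / n%:R + n%:R / big_R (lam M) k))%:E <= g w])%E])
  /\
  (exists b c : R, [/\ 1 <= b, 1 <= c &
    forall (n p : nat) (M : model R n p) (Xi0 : 'M[R]_n)
           (betabar : 'cV[R]_p) (s beta : Omega M -> 'cV[R]_p),
      (0 < n)%N ->
      0 < ev (lam M) n ->
      coherent eps Xi0 (Xi M) ->
      sign_prior betabar s beta ->
      forall k : nat, (1 <= k <= p)%N -> r_ge (lam M) k (b * n%:R) ->
      forall g : Omega M -> \bar R, is_expected_risk beta g ->
      ((1 - 10 * expR (- (n%:R / c)))%:E <=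
        Prob M [set w | (2^-1 * \sum_(i < p)
                       lam M 0 i * betabar i 0 ^+ 2 /
                       (1 + c * lam M 0 i * n%:R /
                            (ev (lam M) k * small_r (lam M) k)) ^+ 2)%:E
                     <= g w])%E]).
Proof.
pose C : R := 80 / eps.
(* Normalized so that [s ^+ 2 * eps = 4 * expR 3], the rate required in [combination_small_ball]. *)
pose s : R := Num.sqrt (4 * expR 3 / eps).
have e40 : 0 < 4 * expR 3 / eps.
  by apply: divr_gt0 => //; apply: mulr_gt0 => //; exact: expR_gt0.
have s0 : 0 < s by rewrite sqrtr_gt0.
have sE : s ^+ 2 * eps = 4 * expR 3.
  by rewrite sqr_sqrtr ?(ltW e40)// divfK// gt_eqF.
have C0 : 0 < C by exact: divr_gt0.
pose A := 128 * C / eps + 8 * C * s ^+ 2.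
have A1 : 0 <= 128 * C / eps by apply: divr_ge0 (ltW heps0); apply: mulr_ge0 => //; exact: ltW.
have A2 : 0 <= 8 * C * s ^+ 2 by apply: mulr_ge0 (sqr_ge0 s); apply: mulr_ge0 => //; exact: ltW.
(* Large enough for both net conditions at once; the two successors guarantee [K >= 2]. *)
pose K := (Num.bound A).+2.
have AK : A <= K%:R.
  have h := archi_boundP (addr_ge0 A1 A2).
  by apply: (le_trans (ltW h)); rewrite ler_nat (leq_trans (leqnSn _) (leqnSn _)).
have KC : 128 * C / eps <= K%:R by apply: le_trans AK; rewrite lerDl.
have KS : 8 * C * s ^+ 2 <= K%:R by apply: le_trans AK; rewrite lerDr.
pose b := 16 * (K%:R + 3) / eps.
have K0 : 0 <= K%:R :> R by exact: ler0n.
have b1 : 1 <= b by rewrite /b ler_pdivlMr// mul1r; apply: (le_trans heps1); lra.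
split.
- exists b, (12 + 4 * (K%:R + 2) + 4 * C * (1 + 8 * C * s ^+ 2 * b) ^+ 2); split => //.
    have h := mulr_ge0 (mulr_ge0 (ler0n R 4) (ltW C0)) (sqr_ge0 (1 + 8 * C * s ^+ 2 * b)).
    lra.
  move=> n p M Xi0 beta n0 _ coh k hk kn g hg.
  by apply: (noise_lower_bound heps0 heps1 coh n0 _ KC s0 sE KS _ hk kn hg).
- exists (2 * b), (1 + 256 * C / eps); split => //; first lra.
    have := mulr_ge0 (mulr_ge0 (ler0n R 256) (ltW C0)) (ltW (_ : 0 < eps^-1)); rewrite invr_gt0 => /(_ heps0); lra.
  move=> n p M Xi0 betabar sg beta n0 _ coh sp k _ rk g hg.
  by apply: (bias_lower_bound heps0 heps1 coh n0 _ KC _ sp rk hg).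
Qed.
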